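(* Let $\alpha\in(0,2]$ and $p>0$, let $X_1,X_2,\ldots$ be i.i.d. symmetric real random variables belonging to $DA(\alpha)$, and let $Y_{n,p}$ be the associated self-normalized process, $Y_{n,p}(t)=\frac{1}{V_{n,p}}\sum_{i=1}^{[nt]}X_i+(nt-[nt])\frac{X_{[nt]+1}}{V_{n,p}}$ for $t\in[0,1]$. Then, as $n\to\infty$, $Y_{n,p}$ converges weakly in $C[0,1]$ to standard Brownian motion on $[0,1]$ if and only if $p=\alpha=2$.
   Context: $DA(\alpha)$, for $\alpha\in(0,2]$, is the domain of attraction of an $\alpha$-stable law: i.i.d. random variables $X_1,X_2,\ldots$ belong to $DA(\alpha)$ if there are constants $a_n>0$ and $b_n\in\mathbb{R}$ such that $(X_1+\cdots+X_n-b_n)/a_n$ converges in distribution to a non-degenerate $\alpha$-stable law (for $\alpha=2$, a normal law). Symmetric means that $X_i$ and $-X_i$ have the same distribution. For $p>0$, $V_{n,p}=\left(\sum_{i=1}^n|X_i|^p\right)^{1/p}$. $[x]$ denotes the largest integer less than or equal to $x$. Ratios with denominator $V_{n,p}$ are taken to be $0$ on the event $V_{n,p}=0$. $C[0,1]$ is the space of continuous real functions on $[0,1]$ with the sup norm. *)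

(* Defs.v *)
From HB Require Import structures.
From mathcomp Require Import all_boot all_order all_algebra.
From mathcomp Require Import all_classical all_reals all_analysis.
Set Implicit Arguments.
Unset Strict Implicit.
Unset Printing Implicit Defensive.
Import Order.TTheory GRing.Theory Num.Theory.
Import numFieldTopology.Exports numFieldNormedType.Exports.
Local Open Scope classical_set_scope.
Local Open Scope ring_scope.

Definition mutual_indep d (T : measurableType d) (R : realType)
    (P : probability T R) (X : nat -> T -> R) : Prop :=
  forall (s : seq nat) (B : nat -> set R), uniq s ->
    (forall i, measurable (B i)) ->
    P (\bigcap_(i in [set` s]) (X i @^-1` B i)) =
    (\prod_(i <- s) P (X i @^-1` B i))%E.

Definition iid d (T : measurableType d) (R : realType) (P : probability T R)
    (X : nat -> {RV P >-> R}) : Prop :=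
  mutual_indep P (fun i => X i) /\
  forall i (A : set R), measurable A ->
    distribution P (X i) A = distribution P (X 0%N) A.

Definition symmetric_RV d (T : measurableType d) (R : realType)
    (P : probability T R) (X : {RV P >-> R}) : Prop :=
  forall A : set R, measurable A ->
    P (X @^-1` A) = P ((fun w => - X w) @^-1` A).

(* [W] may live on another probability space than the [Z n].  Taking [S := R]
   and [W := id] gives convergence in distribution to the law [Q] on [R]. *)
Definition cvg_in_law (R : realType) (S : topologicalType)
    d (T : measurableType d) (P : probability T R) (Z : nat -> T -> S)
    d' (T' : measurableType d') (Q : probability T' R) (W : T' -> S) : Prop :=
  forall Phi : S -> R, continuous Phi ->
    (exists M : R, forall x, `|Phi x| <= M) ->
    ('E_P[Phi \o Z n])%E @[n --> \oo] --> ('E_Q[Phi \o W])%E.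

Definition nondegenerate (R : realType)
    (mu : probability (measurableTypeR R) R) : Prop :=
  forall c : R, mu [set c] <> 1%E.

(* If [U], [U'] are independent with law [mu] then [a U + b U'] has the law of
   [c U + m], where [c `^ alpha = a `^ alpha + b `^ alpha]. *)
Definition stable_law (R : realType) (alpha : R)
    (mu : probability (measurableTypeR R) R) : Prop :=
  forall a b : R, 0 < a -> 0 < b -> exists m : R,
    forall A : set (measurableTypeR R), measurable A ->
      (mu \x mu)%E [set z | A (a * z.1 + b * z.2)] =
      mu [set x | A ((a `^ alpha + b `^ alpha) `^ alpha^-1 * x + m)].

Definition normal_law (R : realType)
    (mu : probability (measurableTypeR R) R) : Prop :=
  exists m s : R, s != 0 /\
    forall A : set (measurableTypeR R), measurable A -> mu A = normal_prob m s A.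

(* The nondegenerate 2-stable laws are the normal ones. *)
Definition limit_law (R : realType) (alpha : R)
    (mu : probability (measurableTypeR R) R) : Prop :=
  if alpha == 2 then normal_law mu
  else stable_law alpha mu /\ nondegenerate mu.

Definition in_DA d (T : measurableType d) (R : realType) (P : probability T R)
    (alpha : R) (X : nat -> {RV P >-> R}) : Prop :=
  exists (mu : probability (measurableTypeR R) R) (a b : nat -> R),
    [/\ limit_law alpha mu, forall n, 0 < a n &
      cvg_in_law P (fun n w => (\sum_(i < n) X i w - b n) / a n) mu
        (fun x : R => x)].

Definition I01 (R : realType) : Type := set_type (`[0, 1] : set R).

HB.instance Definition _ (R : realType) := PseudoMetric.on (I01 R).

Definition I01_val (R : realType) (t : I01 R) : R := set_val t.

(* The pseudometric of [arrow_uniform_type] is the one of uniform convergence,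
   see [C01_nbhsP]. *)
Definition C01 (R : realType) : Type :=
  initial_topology (fun f : continuousType (I01 R) R =>
    (f : arrow_uniform_type (I01 R) R)).

HB.instance Definition _ (R : realType) := PseudoMetric.on (C01 R).

Definition C01_fun (R : realType) (f : C01 R) : I01 R -> R :=
  (f : continuousType (I01 R) R).

Coercion C01_fun : C01 >-> Funclass.

Lemma C01_nbhsP (R : realType) (f : C01 R) (A : set (C01 R)) :
  nbhs f A <->
  exists2 e : R, 0 < e & forall g : C01 R, (forall t, `|f t - g t| < e) -> A g.
Proof.
rewrite nbhs_ballP; split => -[e e0 fA]; exists e => // g fg; exact: fA.
Qed.

(* In the third clause, [t] is eventually constant when it encodes a finite
   partition; independence concerns finitely many increments at a time. *)
Definition standard_BM (R : realType) d (T : measurableType d)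
    (Q : probability T R) (W : T -> C01 R) : Prop :=
  [/\ forall t : I01 R, measurable_fun [set: T] (fun w => W w t),
      forall t : I01 R, I01_val t = 0 -> {ae Q, forall w, W w t = 0},
      forall t : nat -> I01 R, (forall i, I01_val (t i) <= I01_val (t i.+1)) ->
        mutual_indep Q (fun i w => W w (t i.+1) - W w (t i)) &
      forall s t : I01 R, I01_val s < I01_val t ->
        forall A : set R, measurable A ->
          Q ((fun w => W w t - W w s) @^-1` A) =
          normal_prob 0 (Num.sqrt (I01_val t - I01_val s)) A].

(* The variables are indexed from 0: [x i] stands for X_{i+1}. *)
Definition Vnorm (R : realType) (p : R) (n : nat) (x : nat -> R) : R :=
  (\sum_(i < n) `|x i| `^ p) `^ p^-1.

(* [Num.truncn] is the integer part since [0 <= n%:R * t]; a quotient by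
   [Vnorm p n x = 0] is 0 since [0^-1 = 0]. *)
Definition selfnorm_fun (R : realType) (p : R) (n : nat) (x : nat -> R)
    (t : I01 R) : R :=
  let k := Num.truncn (n%:R * I01_val t) in
  (Vnorm p n x)^-1 * (\sum_(i < k) x i) +
  (n%:R * I01_val t - k%:R) * (x k / Vnorm p n x).

Lemma selfnorm_funE (R : realType) (p : R) (n : nat) (x : nat -> R) :
  selfnorm_fun p n x = fun t : I01 R => (Vnorm p n x)^-1 *
    \sum_(i < n) Num.max 0 (Num.min 1 (n%:R * I01_val t - i%:R)) * x i.
Proof.
apply/funext => t; rewrite /selfnorm_fun.
have : `[0, 1]%classic (I01_val t) by exact: set_valP.
rewrite /= in_itv/= => /andP[t0 t1].
set V := Vnorm p n x; set y := n%:R * I01_val t; set k := Num.truncn y.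
have y0 : 0 <= y by rewrite mulr_ge0.
have yn : y <= n%:R by rewrite ler_piMr.
have /andP[ky yk] := truncn_itv y0; rewrite -/k in ky yk.
have kn : (k <= n)%N by rewrite -(ler_nat R) (le_trans ky).
have E i : Num.max 0 (Num.min 1 (y - i%:R)) =
    if (i < k)%N then 1 else if i == k then y - k%:R else 0.
  case: (ltngtP i k) => [ik|ki|->].
  - have yi : 1 <= y - i%:R.
      by rewrite lerBrDr addrC natr1 (le_trans _ ky)// ler_nat.
    by rewrite min_l// max_r.
  - have yi : y - i%:R <= 0.
      by rewrite subr_le0 (le_trans (ltW yk))// ler_nat.
    by rewrite min_r ?max_l// (le_trans yi).
  - rewrite min_r ?max_r ?subr_ge0// lerBlDr addrC natr1; exact: ltW.
have -> : (y - k%:R) * (x k / V) = V^-1 * ((y - k%:R) * x k).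
  by rewrite mulrA mulrC.
rewrite -mulrDr; congr (_ * _).
rewrite -(subnKC kn) big_split_ord/=; congr (_ + _).
  by apply: eq_bigr => i _; rewrite E ltn_ord mul1r.
case En : (n - k)%N => [|m].
  rewrite big_ord0.
  have nk : k = n by apply/eqP; rewrite eqn_leq kn/= -subn_eq0 En.
  suff -> : y = k%:R by rewrite subrr mul0r.
  by apply/eqP; rewrite eq_le ky {1}nk yn.
rewrite big_ord_recl/= addn0 E ltnn eqxx big1 ?addr0// => i _.
rewrite E /bump/= add1n addnS ltnNge leqW ?leq_addr//=.
by rewrite gtn_eqF ?mul0r// ltnS leq_addr.
Qed.

Lemma selfnorm_fun_continuous (R : realType) (p : R) (n : nat) (x : nat -> R) :
  continuous (selfnorm_fun p n x).
Proof.
rewrite selfnorm_funE => t.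
have cM (f g : I01 R -> R) : {for t, continuous f} -> {for t, continuous g} ->
  {for t, continuous (fun u : I01 R => f u * g u : R)}.
  by move=> cf cg; exact: cvgM cf cg.
have c0 a : {for t, continuous (fun _ : I01 R => a : R)}
  by exact: cst_continuous.
refine (cM _ _ (c0 _) _).
have cS (h : 'I_n -> I01 R -> R) : (forall i, {for t, continuous (h i)}) ->
  {for t, continuous (fun u => \sum_(i < n) h i u : R)}.
  move=> ch; apply: (@cvg_big R _ +%R 0).
  - exact: add_continuous.
  - exact: (nbhs_filter t).
  - by move=> i _; exact: ch.
apply: cS => i; refine (cM _ _ _ (c0 _)).
have cv : {for t, continuous (fun u : I01 R => n%:R * I01_val u - i%:R : R)}.
  have cB (f g : I01 R -> R) : {for t, continuous f} ->
    {for t, continuous g} -> {for t, continuous (fun u => f u - g u : R)}.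
    by move=> cf cg; exact: cvgB cf cg.
  refine (cB _ _ (cM _ _ (c0 _) _) (c0 _)).
  exact: (@initial_continuous _ R set_val).
apply: (@continuous_max R _ (fun=> 0)) => //.
exact: (@continuous_min R _ (fun=> 1)).
Qed.

Definition selfnorm_path (R : realType) (p : R) (n : nat) (x : nat -> R) : C01 R :=
  (mkcts (@selfnorm_fun_continuous R p n x) : continuousType (I01 R) R).

Definition selfnorm_process d (T : measurableType d) (R : realType)
    (P : probability T R) (p : R) (X : nat -> {RV P >-> R}) (n : nat) (w : T) :
    C01 R :=
  selfnorm_path p n (fun i => X i w).

(* Main.v *)
Require Import Defs.
From HB Require Import structures.
From mathcomp Require Import all_boot all_order all_algebra.
From mathcomp Require Import all_classical all_reals all_analysis.
From mathcomp Require Import measurable_realfun ring lra.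
Set Implicit Arguments.
Unset Strict Implicit.
Unset Printing Implicit Defensive.
Import Order.TTheory GRing.Theory Num.Theory.
Import numFieldTopology.Exports numFieldNormedType.Exports.
Local Open Scope classical_set_scope.
Local Open Scope ring_scope.

(* Given the absolute values of the sample, symmetry makes the increments of the
   process a Rademacher sum with weights [c_i = X_i / V_{n,p}].

   If the largest weight tends to 0 in probability and [p = 2], exchangeability
   forces [c_1 ^ 2 + ... + c_k ^ 2] to be close to [k / n], so that the central
   limit theorem for Rademacher sums on blocks of indices, together with the
   fourth-moment and Levy inequalities for tightness, gives convergence to
   Brownian motion; by inf-convolution it is enough to test Lipschitz
   functionals.  When [alpha = 2] the largest weight does tend to 0: the squared
   modulus [h] of the characteristic function of the limit law satisfies
   [h (sqrt 2 * t) = h t ^ 2], whence [n * E (1 - cos (t X / a_n)) ^ 2 --> 0], so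
   [max |X_i| / a_n --> 0] in probability, while [V_n / a_n] stays away from 0.

   Conversely, convergence to a process with continuous paths forces the largest
   weight to tend to 0.  If [p < 2] then [Y_n(1) --> 0], because the sum of the
   [c_i ^ 2] is at most [max |c_i| ^ (2 - p)]; if [2 < p] that sum tends to
   infinity and [Y_n(1)] is not tight, by anticoncentration of Rademacher sums.
   If [p = 2], comparing [S_n] with [S_{2n}] through the same Gaussian average
   gives [h (sqrt 2 * t) = h t ^ 2]; stability gives
   [h (2 ^ (1 / alpha) * t) = h t ^ 2], and both hold for a nondegenerate law only
   if [alpha = 2]. *)

(** * Expectation of bounded measurable functions *)

(** Three obstacles shape the argument. Conditioning is avoided: a sign flip preserves the law of
    the sample, so a mean equals the mean of its average over signs, which is a finite deterministic
    recursion; resampling one coordinate by Fubini plays the same role for Brownian increments. No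
    growth of the norming constants is assumed and the centring is arbitrary: the squared modulus of
    the characteristic function removes the centring, and the convergence of [charfun X (t / a n)]
    to 1 is derived from the limit law. Finally the weights degenerate when [Vnorm] vanishes, so the
    estimates that rely on the squares summing to 1 carry the probability [null_prob] of that event;
    it decays geometrically because the limit law is nondegenerate. Errors are expressed by
    quantities whose means are controlled, namely [max_weight] and squared deviations of partial
    sums of squared weights; square roots and real powers are first replaced by affine bounds in
    these. *)

Section bounded_expectation.
Context d (T : measurableType d) (R : realType).
Implicit Types (f g : T -> R).

Definition bmeas f := measurable_fun [set: T] f /\ exists M : R, forall x, `|f x| <= M.

Lemma eq_bmeas f g : (forall x, f x = g x) -> bmeas f -> bmeas g.
Proof. by move=> fg; rewrite (_ : g = f)//; apply/funext => x. Qed.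

Lemma bmeas_cst c : bmeas (fun=> c).
Proof. by split => //; exists `|c|. Qed.

Lemma bmeasD f g : bmeas f -> bmeas g -> bmeas (fun x => f x + g x).
Proof.
move=> [mf [M fM]] [mg [N gN]]; split; first exact: measurable_funD.
by exists (M + N) => x; rewrite (le_trans (ler_normD _ _))// lerD.
Qed.

Lemma bmeasM f g : bmeas f -> bmeas g -> bmeas (fun x => f x * g x).
Proof.
move=> [mf [M fM]] [mg [N gN]]; split; first exact: measurable_funM.
by exists (M * N) => x; rewrite normrM ler_pM.
Qed.

Lemma bmeasN f : bmeas f -> bmeas (fun x => - f x).
Proof.
move=> [mf [M fM]]; split; first exact: measurableT_comp.
by exists M => x; rewrite normrN.
Qed.

Lemma bmeasB f g : bmeas f -> bmeas g -> bmeas (fun x => f x - g x).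
Proof. by move=> bf bg; apply: bmeasD => //; exact: bmeasN. Qed.

Lemma bmeasZ c f : bmeas f -> bmeas (fun x => c * f x).
Proof. by move=> bf; apply: bmeasM => //; exact: bmeas_cst. Qed.

Lemma bmeas_norm f : bmeas f -> bmeas (fun x => `|f x|).
Proof.
move=> [mf [M fM]]; split; first exact: measurableT_comp.
by exists M => x; rewrite normr_id.
Qed.

Lemma bmeasX f n : bmeas f -> bmeas (fun x => f x ^+ n).
Proof.
move=> bf; elim: n => [|n IH]; first by under eq_fun do rewrite expr0; exact: bmeas_cst.
by under eq_fun do rewrite exprS; exact: bmeasM.
Qed.

Lemma bmeas_sum I (s : seq I) (Q : pred I) (h : I -> T -> R) :
  (forall i, Q i -> bmeas (h i)) -> bmeas (fun x => \sum_(i <- s | Q i) h i x).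
Proof.
move=> bh; elim: s => [|i s IH].
  by under eq_fun do rewrite big_nil; exact: bmeas_cst.
under eq_fun do rewrite big_cons.
by case Qi : (Q i) => //; apply: bmeasD => //; exact: bh.
Qed.

Lemma bmeas_prod I (s : seq I) (Q : pred I) (h : I -> T -> R) :
  (forall i, Q i -> bmeas (h i)) -> bmeas (fun x => \prod_(i <- s | Q i) h i x).
Proof.
move=> bh; elim: s => [|i s IH].
  by under eq_fun do rewrite big_nil; exact: bmeas_cst.
under eq_fun do rewrite big_cons.
by case Qi : (Q i) => //; apply: bmeasM => //; exact: bh.
Qed.

Lemma bmeas_comp (h : R -> R) (f : T -> R) : measurable_fun [set: R] h ->
  (exists M : R, forall y, `|h y| <= M) -> measurable_fun [set: T] f ->
  bmeas (fun x => h (f x)).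
Proof.
move=> mh [M hM] mf; split; last by exists M => x.
exact: measurableT_comp.
Qed.

Lemma bmeas01 f : measurable_fun [set: T] f -> (forall x, 0 <= f x <= 1) -> bmeas f.
Proof.
by move=> mf f01; split => //; exists 1 => x; have /andP[f0 f1] := f01 x;
  rewrite ger0_norm.
Qed.

Lemma bmeas_bool (b : T -> bool) : measurable_fun [set: T] b ->
  bmeas (fun x => (b x)%:R).
Proof.
move=> mb; apply: bmeas01; last by move=> x; rewrite ler0n lern1 leq_b1.
by apply: (@measurableT_comp _ _ _ _ _ _ (fun c : bool => c%:R : R)).
Qed.

Lemma bmeas_lt f g : measurable_fun [set: T] f -> measurable_fun [set: T] g ->
  bmeas (fun x => (f x < g x)%R%:R).
Proof. by move=> mf mg; apply: bmeas_bool; exact: measurable_fun_ltr. Qed.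

Lemma bmeas_le_bool f g : measurable_fun [set: T] f -> measurable_fun [set: T] g ->
  bmeas (fun x => (f x <= g x)%R%:R).
Proof. by move=> mf mg; apply: bmeas_bool; exact: measurable_fun_ler. Qed.

Lemma bmeas_cos f : measurable_fun [set: T] f -> bmeas (fun x => cos (f x)).
Proof.
move=> mf; apply: (bmeas_comp _ _ mf); last by exists 1 => y; rewrite ler_norml cos_geN1 cos_le1.
by apply: continuous_measurable_fun; exact: continuous_cos.
Qed.

Lemma bmeas_sin f : measurable_fun [set: T] f -> bmeas (fun x => sin (f x)).
Proof.
move=> mf; apply: (bmeas_comp _ _ mf); last by exists 1 => y; rewrite ler_norml sin_geN1 sin_le1.
by apply: continuous_measurable_fun; exact: continuous_sin.
Qed.

Variable P : probability T R.

Definition Ex f : R := \int[P]_x f x.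

Lemma eq_Ex f g : (forall x, f x = g x) -> Ex f = Ex g.
Proof. by move=> fg; congr Ex; apply/funext. Qed.

Lemma bmeas_integrable f : bmeas f -> P.-integrable [set: T] (EFin \o f).
Proof.
move=> [mf [M fM]]; apply: measurable_bounded_integrable => //.
  by rewrite (@le_lt_trans _ _ 1%E) ?ltry//; exact: probability_le1.
by exists M; split; [exact: num_real | move=> N /ltW MN x _ /=; exact: le_trans (fM x) MN].
Qed.

Lemma expectation_Ex f : bmeas f -> ('E_P[f])%E = (Ex f)%:E.
Proof.
move=> bf; rewrite unlock /Ex /Rintegral fineK//.
by apply: integrable_fin_num => //; exact: bmeas_integrable.
Qed.

Lemma Ex_cst c : Ex (fun=> c) = c.
Proof. by rewrite /Ex Rintegral_cst// [X in fine X]probability_setT mulr1. Qed.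

Lemma ExD f g : bmeas f -> bmeas g -> Ex (fun x => f x + g x) = Ex f + Ex g.
Proof. by move=> bf bg; apply: RintegralD => //; exact: bmeas_integrable. Qed.

Lemma ExB f g : bmeas f -> bmeas g -> Ex (fun x => f x - g x) = Ex f - Ex g.
Proof. by move=> bf bg; apply: RintegralB => //; exact: bmeas_integrable. Qed.

Lemma ExZ c f : bmeas f -> Ex (fun x => c * f x) = c * Ex f.
Proof. by move=> bf; apply: RintegralZl => //; exact: bmeas_integrable. Qed.

Lemma ExN f : bmeas f -> Ex (fun x => - f x) = - Ex f.
Proof.
move=> bf; under [in LHS]eq_fun do rewrite -mulN1r.
by rewrite ExZ// mulN1r.
Qed.

Lemma Ex_le f g : bmeas f -> bmeas g -> (forall x, f x <= g x) -> Ex f <= Ex g.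
Proof.
by move=> bf bg fg; apply: le_Rintegral => //; exact: bmeas_integrable.
Qed.

Lemma Ex_ge0 f : (forall x, 0 <= f x) -> 0 <= Ex f.
Proof. by move=> f0; apply: Rintegral_ge0. Qed.

Lemma Ex_le_cst f c : bmeas f -> (forall x, f x <= c) -> Ex f <= c.
Proof.
by move=> bf fc; rewrite -[leRHS]Ex_cst; apply: Ex_le => //; exact: bmeas_cst.
Qed.

Lemma Ex_norm f : bmeas f -> `|Ex f| <= Ex (fun x => `|f x|).
Proof. by move=> bf; apply: le_normr_Rintegral => //; exact: bmeas_integrable. Qed.

Lemma Ex_norm_le f c : bmeas f -> (forall x, `|f x| <= c) -> `|Ex f| <= c.
Proof.
move=> bf fc; apply: (le_trans (Ex_norm bf)); apply: Ex_le_cst => //.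
exact: bmeas_norm.
Qed.

Lemma Ex_dist_le f g h : bmeas f -> bmeas g -> bmeas h ->
  (forall x, `|f x - g x| <= h x) -> `|Ex f - Ex g| <= Ex h.
Proof.
move=> bf bg bh fgh; rewrite -ExB//; have bB := bmeasB bf bg.
by apply: (le_trans (Ex_norm bB)); apply: Ex_le => //; exact: bmeas_norm.
Qed.

Lemma Ex_sum I (s : seq I) (Q : pred I) (h : I -> T -> R) :
  (forall i, Q i -> bmeas (h i)) ->
  Ex (fun x => \sum_(i <- s | Q i) h i x) = \sum_(i <- s | Q i) Ex (h i).
Proof.
move=> bh; elim: s => [|i s IH].
  by under eq_fun do rewrite big_nil; rewrite big_nil Ex_cst.
under eq_fun do rewrite big_cons.
rewrite big_cons; case: ifP => // Qi.
by rewrite ExD ?IH//; [exact: bh|exact: bmeas_sum].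
Qed.

Lemma Ex_cvg (f_ : nat -> T -> R) f (M : R) : (forall n, measurable_fun [set: T] (f_ n)) ->
  (forall n x, `|f_ n x| <= M) -> measurable_fun [set: T] f ->
  (forall x, f_ n x @[n --> \oo] --> f x) -> Ex (f_ n) @[n --> \oo] --> Ex f.
Proof.
move=> mf_ fM mf f_f.
have fbM x : `|f x| <= M.
  apply: (cvgr_to_le (cvg_norm (f_f x))).
  by apply: nearW => n; exact: fM.
have bf : bmeas f by split => //; exists M.
have bf_ n : bmeas (f_ n) by split => //; exists M.
have [] := @dominated_convergence _ _ _ P _ measurableT (fun n => EFin \o f_ n)
   (EFin \o f) (cst M%:E).
- by move=> n; exact/measurable_EFinP.
- exact/measurable_EFinP.
- by apply: aeW => x _; apply/cvg_EFin; [apply: nearW|exact: f_f].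
- by have := bmeas_integrable (bmeas_cst M).
- by apply: aeW => x n _; rewrite lee_fin.
move=> _ _ h; apply: fine_cvg; rewrite fineK//.
by apply: integrable_fin_num => //; exact: bmeas_integrable.
Qed.

Lemma Ex_ae f g : bmeas f -> bmeas g -> {ae P, forall x, f x = g x} -> Ex f = Ex g.
Proof.
move=> [mf _] [mg _] fg; rewrite /Ex /Rintegral; congr fine.
apply: ae_eq_integral => //; [exact/measurable_EFinP|exact/measurable_EFinP|].
by apply: filterS fg => x fgx _; rewrite fgx.
Qed.

Lemma Ex_indic A : measurable A -> Ex (\1_A) = fine (P A).
Proof. by move=> mA; rewrite /Ex /Rintegral integral_indic// setIT. Qed.

End bounded_expectation.

(** * Independent and exchangeable sequences *)

Section law.
Context (R : realType).

(** Initial boxes are stable under intersection and generate the sigma-algebra of the coordinates,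
    so laws of sequences are determined on sets whose measure independence turns into a finite
    product. *)
Definition cylinders : set (set (nat -> R)) :=
  [set A | exists n B, (forall i, measurable (B i)) /\
     A = [set x : nat -> R | forall i, (i < n)%N -> B i (x i)]].

Definition seqR := g_sigma_algebraType cylinders.

Lemma setI_closed_cylinders : setI_closed cylinders.
Proof.
move=> _ _ [n [B [mB ->]]] [m [C [mC ->]]].
exists (maxn n m), (fun i => (if (i < n)%N then B i else setT) `&`
  (if (i < m)%N then C i else setT)); split.
  by move=> i; apply: measurableI; case: ifP.
apply/seteqP; split => [x /= [Bx Cx] i _|x /= h]; last split => i ij.
- by split; case: ifPn => // h; [exact: Bx|exact: Cx].
- by have := h i; rewrite leq_max ij => -[].
- by have := h i; rewrite leq_max ij orbT => -[].
Qed.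

Lemma cylindersT : cylinders setT.
Proof. by exists 0%N, (fun=> setT); split => //; apply/seteqP; split. Qed.

Lemma measurable_coord i : measurable_fun [set: seqR] (fun x : seqR => x i).
Proof.
move=> _ B mB; rewrite setTI; apply: sub_sigma_algebra.
exists i.+1, (fun j => if j == i then B else setT); split; first by move=> j; case: ifP.
apply/seteqP; split => [x /= Bx j _|x /= /(_ i (ltnSn _))]; last by rewrite eqxx.
by case: eqP => // ->.
Qed.

Context d (T : measurableType d).

Lemma measurable_toseq (X : nat -> T -> R) :
  (forall i, measurable_fun [set: T] (X i)) ->
  measurable_fun [set: T] (fun w => (fun i => X i w) : seqR).
Proof.
move=> mX; apply: (@measurability _ _ T seqR setT _ cylinders) => //.
move=> _ [_ [n [B [mB ->]] <-]].
rewrite (_ : _ `&` _ = \bigcap_(i < n) (X i @^-1` B i)).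
  apply: bigcap_measurableType => i _.
  by rewrite -[X in measurable X]setTI; exact: mX.
by apply/seteqP; split => [w /= [_ h] i /= /h|w /= h]; last split => // i /h.
Qed.

Variable P : probability T R.

Lemma mutual_indep_cyl (X : nat -> T -> R) n (B : nat -> set R) :
  mutual_indep P X -> (forall i, measurable (B i)) ->
  P [set w | forall i, (i < n)%N -> B i (X i w)] = (\prod_(i < n) P (X i @^-1` B i))%E.
Proof.
move=> iX mB; have := iX (iota 0 n) B (iota_uniq _ _) mB.
rewrite -(big_mkord xpredT (fun i => P (X i @^-1` B i))) /index_iota subn0 => <-.
congr (P _).
apply/seteqP; split => [w /= h i /=|w /= h i ni].
  by rewrite mem_iota add0n => /h.
by apply: h => /=; rewrite mem_iota add0n.
Qed.

Lemma pushforward_uniq (m1 m2 : {measure set seqR -> \bar R}) :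
  m1 setT = 1%E -> (forall A, cylinders A -> m1 A = m2 A) ->
  forall A, measurable A -> m1 A = m2 A.
Proof.
move=> m1T m12 A mA; apply: (@measure_unique _ R seqR cylinders (fun=> setT)) => //.
- exact: setI_closed_cylinders.
- by move=> _; exact: cylindersT.
- by rewrite bigcup_const.
- by move=> _; rewrite m1T ltry.
Qed.

End law.

(** * Product probabilities and resampling of one coordinate *)

Section product_probability.
Context (R : realType) d1 (T1 : measurableType d1) d2 (T2 : measurableType d2).
Variables (P1 : probability T1 R) (P2 : probability T2 R).

Definition product_prob := (P1 \x P2)%E.

HB.instance Definition _ := Measure.on product_prob.

Let product_prob_setT : product_prob setT = 1%E.
Proof.
rewrite -setXTT [LHS]product_measure1E// -[RHS]mule1.
by congr (_ * _)%E; exact: probability_setT.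
Qed.

HB.instance Definition _ :=
  Measure_isProbability.Build _ _ _ product_prob product_prob_setT.

Lemma product_probE A B : measurable A -> measurable B ->
  product_prob (A `*` B) = (P1 A * P2 B)%E.
Proof. by move=> mA mB; rewrite [LHS]product_measure1E. Qed.

Lemma Ex_product_prob (F : T1 * T2 -> R) : bmeas F ->
  Ex product_prob F = Ex P1 (fun x => Ex P2 (fun y => F (x, y))).
Proof.
move=> bF; have iF := bmeas_integrable product_prob bF.
rewrite /Ex {1}/Rintegral -(integral12_prod_meas1 iF)//.
rewrite /Rintegral; congr fine; apply: eq_integral => x _.
rewrite /fubini_F fineK//; apply: integrable_fin_num => //.
apply: bmeas_integrable; case: bF => mF [M FM]; split; last by exists M => y.
exact: measurableT_comp mF (pair1_measurable x).
Qed.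

End product_probability.

Section independence.
Context (R : realType).

Lemma Ex_distribution d (T : measurableType d) (P : probability T R)
    d' (S : measurableType d') (X : {RV P >-> S}) (F : S -> R) :
  bmeas F -> Ex (distribution P X) F = Ex P (fun w => F (X w)).
Proof.
move=> bF; rewrite /Ex /Rintegral integral_distribution//.
  by apply/measurable_EFinP; case: bF.
apply: bmeas_integrable; case: bF => mF [M FM]; split; last by exists M => w.
exact: measurableT_comp.
Qed.

Lemma Ex_eq_law d (T : measurableType d) (P : probability T R) (X : T -> seqR R)
    d' (T' : measurableType d') (P' : probability T' R) (X' : T' -> seqR R) F :
  measurable_fun [set: T] X -> measurable_fun [set: T'] X' ->
  (forall A, cylinders A -> P (X @^-1` A) = P' (X' @^-1` A)) -> bmeas F ->
  Ex P (fun w => F (X w)) = Ex P' (fun w => F (X' w)).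
Proof.
move=> mX mX' XX' bF.
pose X1 : {mfun T >-> seqR R} :=
  MeasurableFun.Pack (MeasurableFun.Class (isMeasurableFun.Build _ _ _ _ _ mX)).
pose X2 : {mfun T' >-> seqR R} :=
  MeasurableFun.Pack (MeasurableFun.Class (isMeasurableFun.Build _ _ _ _ _ mX')).
rewrite -(Ex_distribution X1 bF) -(Ex_distribution X2 bF).
rewrite /Ex /Rintegral; congr fine; apply: eq_measure_integral => A mA _.
apply: pushforward_uniq => //=; exact: probability_setT.
Qed.

Context d (T : measurableType d) (P : probability T R).

(** Replacing coordinate [n] by an independent copy keeps the law of the sequence, as a check on
    cylinders shows. It is the substitute for conditioning on the other coordinates. *)
Lemma indep_decouple (X : nat -> T -> R) (n : nat) (F : seqR R -> R) :
  mutual_indep P X -> (forall i, measurable_fun [set: T] (X i)) -> bmeas F ->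
  Ex P (fun w => F (fun i => X i w)) =
  Ex P (fun w => Ex P (fun w' => F (fun i => if i == n then X i w' else X i w))).
Proof.
move=> iX mX bF.
pose X' i (z : T * T) := if i == n then X i z.2 else X i z.1.
have mX' : forall i, measurable_fun [set: T * T] (X' i).
  move=> i; rewrite /X'; case: (i == n).
    exact: measurableT_comp (mX i) (@measurable_snd _ _ T T).
  exact: measurableT_comp (mX i) (@measurable_fst _ _ T T).
have bF' : bmeas (fun z : T * T => F (fun i => X' i z)).
  case: bF => mF [M FM]; split; last by exists M => z.
  exact: measurableT_comp mF (measurable_toseq mX').
transitivity (Ex (product_prob P P) (fun z => F (fun i => X' i z))); last first.
  by rewrite Ex_product_prob.
apply: (@Ex_eq_law _ _ P (fun w => (fun i => X i w)) _ _ (product_prob P P)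
  (fun z => (fun i => X' i z))) => //; [exact: measurable_toseq..|].
move=> _ [N [B [mB ->]]] /=.
rewrite [LHS](mutual_indep_cyl N iX mB).
have mXB i : measurable (X i @^-1` B i).
  by rewrite -[X in measurable X]setTI; exact: mX.
pose B' i := if i == n then setT else B i.
have mB' i : measurable (B' i) by rewrite /B'; case: ifP.
have mcyl : measurable [set w | forall i, (i < N)%N -> B' i (X i w)].
  have := measurable_toseq mX measurableT (Y := [set x | forall i, (i < N)%N -> B' i (x i)]).
  by rewrite setTI; apply; apply: sub_sigma_algebra; exists N, B'.
(* A cylinder of length [N <= n] does not see coordinate [n], so its second factor is the whole
   space; otherwise the copy carries the factor of index [n]. *)
have [Nn|nN] := leqP N n.
  rewrite (_ : _ @^-1` _ = [set w | forall i, (i < N)%N -> B' i (X i w)] `*` setT).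
    rewrite [RHS]product_probE// [X in (_ * X)%E]probability_setT mule1.
    rewrite (mutual_indep_cyl N iX mB'); apply: eq_bigr => i _.
    by rewrite /B' ltn_eqF// (leq_trans _ Nn).
  apply/seteqP; split => -[w w'] /= h; last case: h => h _ i iN.
    split => // i iN; have := h i iN; rewrite /X' /B'.
    by rewrite ltn_eqF// (leq_trans _ Nn).
  by have := h i iN; rewrite /X' /B' ltn_eqF// (leq_trans _ Nn).
rewrite (_ : _ @^-1` _ = [set w | forall i, (i < N)%N -> B' i (X i w)] `*` (X n @^-1` B n)).
  rewrite [RHS]product_probE// (mutual_indep_cyl N iX mB').
  rewrite (bigD1 (Ordinal nN))//= [in RHS](bigD1 (Ordinal nN))//= muleC.
  rewrite (_ : B' n = setT); last by rewrite /B' eqxx.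
  rewrite preimage_setT (_ : P setT = 1%E); last exact: probability_setT.
  rewrite mul1e.
  congr (_ * _)%E; apply: eq_bigr => i; rewrite -val_eqE/= => /negbTE ni.
  by rewrite /B' ni.
apply/seteqP; split => -[w w'] /= h; last case: h => h hn i iN.
  split; last by have := h n nN; rewrite /X' eqxx.
  by move=> i iN; have := h i iN; rewrite /X' /B'; case: eqP.
by have := h i iN; rewrite /X' /B'; case: eqP => // ->.
Qed.

Lemma mutual_indep_morph (X : nat -> T -> R) (h : nat -> R -> R) :
  mutual_indep P X -> (forall i, measurable_fun [set: R] (h i)) ->
  mutual_indep P (fun i w => h i (X i w)).
Proof.
move=> iX mh s B us mB.
have mhB i : measurable (h i @^-1` B i).
  by rewrite -[X in measurable X]setTI; exact: mh.
by have := iX s (fun i => h i @^-1` B i) us mhB.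
Qed.

Lemma mutual_indep_reindex (X : nat -> T -> R) (f g : nat -> nat) :
  cancel f g -> cancel g f ->
  mutual_indep P X -> mutual_indep P (fun i => X (f i)).
Proof.
move=> fK gK iX s B us mB.
have := iX [seq f i | i <- s] (fun i => B (g i)).
rewrite map_inj_uniq//; last exact: can_inj fK.
move=> /(_ us (fun i => mB _)); rewrite big_map.
under eq_bigr do rewrite fK.
move=> <-; congr (P _); apply/seteqP; split => w /= h i /=.
  by case/mapP => j js ->; rewrite fK; exact: h.
by move=> js; have /= := h (f i) (map_f _ js); rewrite fK.
Qed.

Lemma Ex_mutual_indep (X X' : nat -> T -> R) (F : seqR R -> R) :
  mutual_indep P X -> mutual_indep P X' ->
  (forall i, measurable_fun [set: T] (X i)) ->
  (forall i, measurable_fun [set: T] (X' i)) ->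
  (forall i A, measurable A -> P (X i @^-1` A) = P (X' i @^-1` A)) -> bmeas F ->
  Ex P (fun w => F (fun i => X i w)) = Ex P (fun w => F (fun i => X' i w)).
Proof.
move=> iX iX' mX mX' XX' bF.
apply: (@Ex_eq_law _ _ P (fun w => (fun i => X i w)) _ _ P
  (fun z => (fun i => X' i z))) => //; [exact: measurable_toseq..|].
move=> _ [N [B [mB ->]]] /=.
rewrite [LHS](mutual_indep_cyl N iX mB) [RHS](mutual_indep_cyl N iX' mB).
by apply: eq_bigr => i _; exact: XX'.
Qed.

End independence.

(** * Invariance of the law of the sample under sign changes and transpositions *)

Section symmetric_iid.
Context (R : realType) d (T : measurableType d) (P : probability T R).
Variable X : nat -> {RV P >-> R}.
Hypotheses (iidX : iid X) (symX : forall i, symmetric_RV (X i)).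
Implicit Types F : seqR R -> R.

Definition sampled F (w : T) : R := F (fun i => X i w).

Definition EX F : R := Ex P (sampled F).

Lemma bmeas_sampled F : bmeas F -> bmeas (sampled F).
Proof.
move=> [mF [M FM]]; split; last by exists M => w; exact: FM.
by apply: (measurableT_comp mF); exact: measurable_toseq.
Qed.

Definition flip i (x : nat -> R) : seqR R := fun j => if j == i then - x j else x j.

Lemma measurable_flip i : measurable_fun [set: seqR R] (flip i).
Proof.
apply: (@measurable_toseq _ _ (seqR R)) => j; case: (j == i); last exact: measurable_coord.
apply: measurableT_comp => //; exact: measurable_coord.
Qed.

Lemma EX_flip i F : bmeas F -> EX (fun x => F (flip i x)) = EX F.
Proof.
move=> bF; have [iX _] := iidX.
pose h j := if j == i then (-%R : R -> R) else id.
have mh j : measurable_fun setT (h j) by rewrite /h; case: ifP.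
have := Ex_mutual_indep (X := fun i => X i) (X' := fun i w => h i (X i w)) iX
  (mutual_indep_morph iX mh) _ _ _ bF.
rewrite /EX /sampled => -> //.
- congr Ex; apply/funext => w; congr F; apply/funext => j.
  by rewrite /flip /h; case: eqP.
- by move=> j; exact: measurableT_comp (mh j) _.
- by move=> j A mA; rewrite /h; case: eqP => // _; exact: symX.
Qed.

Definition swapn (a b i : nat) := if i == a then b else if i == b then a else i.

Lemma swapnK a b : involutive (swapn a b).
Proof.
move=> i; rewrite /swapn; case: (eqVneq i a) => [->|ia].
  by case: (eqVneq b a) => [->//|ba]; rewrite eqxx.
by case: (eqVneq i b) => [->|ib]; rewrite ?eqxx// (negbTE ia) (negbTE ib).
Qed.

Definition swap a b (x : nat -> R) : seqR R := fun i => x (swapn a b i).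

Lemma measurable_swap a b : measurable_fun [set: seqR R] (swap a b).
Proof. by apply: (@measurable_toseq _ _ (seqR R)) => j; exact: measurable_coord. Qed.

Lemma EX_swap a b F : bmeas F -> EX (fun x => F (swap a b x)) = EX F.
Proof.
move=> bF; have [iX idX] := iidX.
have := Ex_mutual_indep (X := fun i => X i) (X' := fun i w => X (swapn a b i) w) iX
  (mutual_indep_reindex (swapnK a b) (swapnK a b) iX) _ _ _ bF.
rewrite /EX /sampled => -> //.
by move=> j A mA; exact: etrans (idX j A mA) (esym (idX (swapn a b j) A mA)).
Qed.

(** The last coordinate is resampled by [indep_decouple], so that its mean factors out. *)
Lemma EX_prod n (f : R -> R) : bmeas f ->
  EX (fun x => \prod_(i < n) f (x i)) = (Ex P (fun w => f (X 0%N w))) ^+ n.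
Proof.
move=> bf; have [iX idX] := iidX.
have mf := bf.1.
have bfx i : bmeas (fun x : seqR R => f (x i)).
  by case: bf => _ [M fM]; split; [exact: measurableT_comp mf (measurable_coord i)|exists M => x].
elim: n => [|n IH].
  by rewrite expr0 /EX /sampled; under eq_fun do rewrite big_ord0; rewrite Ex_cst.
rewrite exprSr -IH.
have bp : bmeas (fun x : seqR R => \prod_(i < n) f (x i)) by exact: bmeas_prod.
rewrite /EX /sampled.
have := @indep_decouple _ _ _ P (fun i => X i) n (fun x => \prod_(i < n.+1) f (x i)) iX.
rewrite /= => -> //; last exact: bmeas_prod.
have bX i : bmeas (fun w => f (X i w)).
  by case: bf => _ [M fM]; split; [exact: measurableT_comp|exists M => x].
have EXn : Ex P (fun w => f (X n w)) = Ex P (fun w => f (X 0%N w)).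
  rewrite -[LHS](Ex_distribution (X n) bf) -[RHS](Ex_distribution (X 0%N) bf).
  rewrite /Ex /Rintegral; congr fine; apply: eq_measure_integral => A mA _.
  exact: idX.
rewrite -EXn; transitivity (Ex P (fun w => Ex P (fun w' => f (X n w')) * \prod_(i < n) f (X i w))).
  congr Ex; apply/funext => w; rewrite mulrC -ExZ//.
  congr Ex; apply/funext => w'; rewrite big_ord_recr/= eqxx; congr (_ * _).
  by apply: eq_bigr => i _; rewrite ltn_eqF.
by rewrite [RHS]mulrC; exact: ExZ (bmeas_sampled bp).
Qed.

End symmetric_iid.

(** * Rademacher averages *)

Section sign_average.
Context (R : realType).
Implicit Types (x y : nat -> R) (F G : (nat -> R) -> R) (f g : R -> R).

(* The average of [F] over all changes of sign of the coordinates
   [i, ..., i + n - 1] of [x]. *)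
Fixpoint savg n i F x : R :=
  if n is n'.+1 then (savg n' i.+1 F x + savg n' i.+1 F (flip i x)) / 2 else F x.

(** What [savg n i] can reach from [x]: signs change only at indices in [[i, i + n)]. Hypotheses on
    averaged functions are asked on this orbit only, where absolute values, hence [Vnorm], are
    constant. *)
Definition same_abs n i x y :=
  (forall j, `|y j| = `|x j|) /\ (forall j, (j < i)%N || (i + n <= j)%N -> y j = x j).

Lemma same_abs_flip n i x y : same_abs n i.+1 (flip i x) y -> same_abs n.+1 i x y.
Proof.
move=> [h1 h2]; split=> [j|j ij].
  by rewrite h1 /flip; case: eqP; rewrite ?normrN.
rewrite h2; last by rewrite addSnnS; case/orP: ij => [/ltnW|] ij; rewrite ?ltnS ?ij ?orbT.
by rewrite /flip; case: eqP ij => // ->; rewrite ltnn/= addnS ltnNge leq_addr.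
Qed.

Lemma same_absS n i x y : same_abs n i.+1 x y -> same_abs n.+1 i x y.
Proof.
move=> [h1 h2]; split=> // j ij; apply: h2.
by rewrite addSnnS; case/orP: ij => [/ltnW|] ij; rewrite ?ltnS ?ij ?orbT.
Qed.

Lemma savg_le n i F G x : (forall y, same_abs n i x y -> F y <= G y) ->
  savg n i F x <= savg n i G x.
Proof.
elim: n i x => [|n IH] i x FG /=; first by apply: FG; split.
rewrite ler_pM2r// lerD//; apply: IH => y h; apply: FG; first exact: same_absS.
exact: same_abs_flip.
Qed.

Lemma eq_savg n i F G x : (forall y, same_abs n i x y -> F y = G y) ->
  savg n i F x = savg n i G x.
Proof.
by move=> FG; apply/eqP; rewrite eq_le !savg_le// => y h; rewrite FG.
Qed.

Lemma savg_cst n i c x : savg n i (fun=> c) x = c.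
Proof. by elim: n i x => [//|n IH] i x /=; rewrite !IH; field. Qed.

Lemma savg_scale n i F (s : R) x :
  savg n i (fun y => F (fun j => s * y j)) x = savg n i F (fun j => s * x j).
Proof.
elim: n i x => [//|n IH] i x /=; rewrite !IH; congr ((_ + savg n i.+1 F _) / 2).
by apply/funext => j; rewrite /flip; case: eqP => // _; rewrite mulrN.
Qed.

Lemma savg_split m n i F x : savg (m + n) i F x = savg m i (savg n (i + m) F) x.
Proof.
elim: m i x => [|m IH] i x /=; first by rewrite add0n addn0.
by rewrite !IH addSnnS.
Qed.

(* The mean of [f] at [a + e_i * x i + ... + e_(i+n-1) * x (i+n-1)] for
   independent Rademacher signs [e_j]. *)
Fixpoint rad n i f x a : R :=
  if n is n'.+1 then (rad n' i.+1 f x (a + x i) + rad n' i.+1 f x (a - x i)) / 2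
  else f a.

Lemma rad_ext n i f x y a : (forall j, (i <= j < i + n)%N -> x j = y j) ->
  rad n i f x a = rad n i f y a.
Proof.
elim: n i a => [//|n IH] i a xy /=.
have h j : (i.+1 <= j < i.+1 + n)%N -> x j = y j.
  by move=> /andP[ij jn]; apply: xy; rewrite ltnW//= -addSnnS.
by rewrite !(IH _ _ h) xy// leqnn/= addnS ltnS leq_addr.
Qed.

(** Signs are averaged one after the other while the partial sum accumulates in [a]; in [rad] the
    weights stay fixed and only the position moves. *)
Lemma savg_rad n i f x a :
  savg n i (fun y => f (a + \sum_(i <= j < i + n) y j)) x = rad n i f x a.
Proof.
elim: n i x a => [|n IH] i x a /=; first by rewrite addn0 big_geq// addr0.
have E y : savg n i.+1 (fun y => f (a + \sum_(i <= j < i + n.+1) y j)) y =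
   rad n i.+1 f y (a + y i).
  rewrite -IH; apply: eq_savg => z [_ zy].
  by rewrite big_ltn ?addrA ?zy ?ltnSn ?addSnnS// addnS ltnS leq_addr.
rewrite !E /flip eqxx; congr ((_ + _) / 2); apply: rad_ext => j /andP[ij _].
by rewrite gtn_eqF.
Qed.

Lemma rad_le n i f g x a : (forall u, f u <= g u) -> rad n i f x a <= rad n i g x a.
Proof.
move=> fg; elim: n i a => [|n IH] i a /=; first exact: fg.
by rewrite ler_pM2r// lerD.
Qed.

Lemma rad_cst n i c x a : rad n i (fun=> c) x a = c.
Proof. by elim: n i a => [//|n IH] i a /=; rewrite !IH; field. Qed.

Lemma radD n i f g x a : rad n i (fun u => f u + g u) x a = rad n i f x a + rad n i g x a.
Proof. by elim: n i a => [//|n IH] i a /=; rewrite !IH; field. Qed.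

Lemma radZ n i c f x a : rad n i (fun u => c * f u) x a = c * rad n i f x a.
Proof. by elim: n i a => [//|n IH] i a /=; rewrite !IH; field. Qed.

(** A Rademacher sum [S] is symmetric: [a + b + S] may be replaced by [a + b - S], which is [2 * a]
    minus [a - b + S]. *)
Lemma rad_reflect n i f x a b :
  rad n i f x (a + b) = rad n i (fun u => f (2 * a - u)) x (a - b).
Proof.
elim: n i b => [|n IH] i b /=; first by congr f; ring.
have -> : a + b + x i = a + (b + x i) by ring.
have -> : a + b - x i = a + (b - x i) by ring.
by rewrite !IH addrC; congr ((rad _ _ _ _ _ + rad _ _ _ _ _) / 2); ring.
Qed.

Let big_window n i (h : nat -> R) :
  \sum_(i <= j < i + n.+1) h j = h i + \sum_(i.+1 <= j < i.+1 + n) h j.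
Proof. by rewrite big_ltn ?addSnnS// addnS ltnS leq_addr. Qed.

Lemma rad_cos n i t x a : rad n i (fun u => cos (t * u)) x a =
  cos (t * a) * \prod_(i <= j < i + n) cos (t * x j).
Proof.
elim: n i a => [|n IH] i a /=; first by rewrite addn0 big_geq// mulr1.
rewrite !IH [in RHS]big_ltn ?addnS ?ltnS ?leq_addr// mulrDr mulrBr cosD cosB addSn.
by field.
Qed.

Lemma rad_sqr n i x a : rad n i (fun u => u ^+ 2) x a =
  a ^+ 2 + \sum_(i <= j < i + n) x j ^+ 2.
Proof.
elim: n i a => [|n IH] i a; first by rewrite addn0 big_geq// addr0.
by rewrite big_window /= !IH; field.
Qed.

(** Odd moments of a Rademacher sum vanish and its fourth moment is at most [3 * s ^+ 2]; the
    starting point [a] is kept so that the bound reproduces itself when one sign is averaged. *)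
Lemma rad_pow4 n i x a (s := \sum_(i <= j < i + n) x j ^+ 2) :
  rad n i (fun u => u ^+ 4) x a <= a ^+ 4 + 6 * a ^+ 2 * s + 3 * s ^+ 2.
Proof.
rewrite {}/s; elim: n i a => [|n IH] i a; first by rewrite addn0 big_geq//=; lra.
rewrite big_window /=; set s := \sum_(_ <= _ < _) _ in IH *.
have := IH i.+1 (a + x i); have := IH i.+1 (a - x i); rewrite -/s.
move: (rad n i.+1 _ x (a + x i)) (rad n i.+1 _ x (a - x i)) => u v h1 h2.
have h0 : 0 <= x i ^+ 4 by rewrite exprn_even_ge0.
nra.
Qed.

(** The reflection about [a] preserves the law of the endpoint [u], and twice the modulus of [a] is
    at most the sum of the moduli of [u] and [2 * a - u]; so an endpoint or its reflection lies
    beyond [l]. *)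
Lemma rad_half n i x (a l : R) : l < `|a| ->
  1 / 2 <= rad n i (fun u => (l < `|u|)%R%:R) x a.
Proof.
move=> la; rewrite ler_pdivrMr//.
have := @rad_reflect n i (fun u => (l < `|u|)%R%:R) x a 0; rewrite addr0 subr0 => E.
rewrite mulr_natr mulr2n {2}E -radD -[leLHS](rad_cst n i 1 x a).
apply: rad_le => u; have [lu|ul] := boolP (l < `|u|); first by rewrite lerDl ler0n.
suff -> : l < `|2 * a - u| by rewrite add0r.
rewrite -leNgt in ul.
have := ler_normB (2 * a - u) (- u); rewrite opprK subrK normrN normrM ger0_norm//.
lra.
Qed.

Lemma has_iotaS (Q : pred nat) n :
  has Q (iota 0 n.+1) = Q 0%N || has (fun k => Q k.+1) (iota 0 n).
Proof. by rewrite /= -[1%N]/(1 + 0)%N iotaDl has_map. Qed.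

(** Levy's maximal inequality by induction on the number of signs. A path already beyond [l] at the
    start ends beyond [l] with probability at least 1/2 by [rad_half], which the factor 2 absorbs;
    otherwise the first sign is averaged and induction applies to both continuations. *)
Lemma savg_levy n i x (a l : R) :
  savg n i (fun y => (has (fun k => l < `|a + \sum_(i <= j < i + k) y j|) (iota 0 n.+1))%:R) x
  <= 2 * rad n i (fun u => (l < `|u|)%R%:R) x a.
Proof.
elim: n i x a => [|n IH] i x a.
  by rewrite /= addn0 big_geq// addr0 orbF; case: (_ < _) => /=; lra.
have [la|al] := boolP (l < `|a|).
  apply: (@le_trans _ _ 1); last first.
    by have := rad_half n.+1 i x la; lra.
  rewrite -[leRHS](savg_cst n.+1 i 1 x); apply: savg_le => y _.
  by rewrite lern1 leq_b1.
have E z : savg n i.+1 (fun y => (has (fun k => l < `|a + \sum_(i <= j < i + k) y j|)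
     (iota 0 n.+2))%:R) z =
   savg n i.+1 (fun y => (has (fun k => l < `|a + z i + \sum_(i.+1 <= j < i.+1 + k) y j|)
     (iota 0 n.+1))%:R) z.
  apply: eq_savg => y [_ yz]; congr (nat_of_bool _)%:R.
  rewrite (has_iotaS _ n.+1) addn0 big_geq// addr0 (negbTE al) orFb.
  by apply: eq_has => k; rewrite big_window addrA yz// ltnSn.
rewrite [leLHS]/= !E [X in _ <= 2 * X]/= mulrA [2 * _]mulrC -mulrA.
have := IH i.+1 x (a + x i); have := IH i.+1 (flip i x) (a - x i).
have -> : flip i x i = - x i by rewrite /flip eqxx.
rewrite (@rad_ext n i.+1 _ (flip i x) x) => [|j /andP[ij _]]; last first.
  by rewrite /flip gtn_eqF.
clear; move: (savg _ _ _ _) (savg _ _ _ _) (rad _ _ _ _ _) (rad _ _ _ _ _) => p q r s.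
lra.
Qed.

Lemma rad_anticoncentration n i x (s := \sum_(i <= j < i + n) x j ^+ 2) : 0 < s ->
  1 / 6 <= rad n i (fun u => (s / 4 <= u ^+ 2)%R%:R) x 0.
Proof.
move=> s0.
(* With [v = u ^+ 2] the integrand on the left is [- (v - s / 4) * (v - 5 * s)]: nonpositive for [v]
   below [s / 4] and never above [361 / 64 * s ^+ 2]. By [rad_pow4] its mean is at least
   [(21 / 4 - 5 / 4 - 3) * s ^+ 2 = s ^+ 2], whence 1/6. *)
have : rad n i (fun u => (21 / 4 * s * u ^+ 2 + (- (5 / 4 * s ^+ 2) + -1 * u ^+ 4))) x 0 <=
   rad n i (fun u => 6 * s ^+ 2 * (s / 4 <= u ^+ 2)%R%:R) x 0.
  apply: rad_le => u; rewrite (_ : u ^+ 4 = (u ^+ 2) ^+ 2); last by rewrite -exprM.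
  have := sqr_ge0 u; move: (u ^+ 2) => v v0; case: (lerP (s / 4) v) => sv /=.
    by rewrite mulr1; have := sqr_ge0 (v - 21 / 8 * s); nra.
  rewrite mulr0; nra.
rewrite !radD !radZ rad_cst rad_sqr expr0n/= add0r -/s.
have := rad_pow4 n i x 0; rewrite -/s !expr0n/= mulr0 mul0r !add0r.
move: (rad _ _ _ _ _) (rad _ _ _ _ _) => p q h1 h2.
have s20 : 0 < s ^+ 2 by rewrite exprn_gt0.
rewrite -(ler_pM2l s20); nra.
Qed.

End sign_average.

(** * Gaussian averages *)

Lemma eq_Ex_measure (R : realType) d (T : measurableType d) (P P' : probability T R)
    (f : T -> R) :
  (forall A, measurable A -> P A = P' A) -> Ex P f = Ex P' f.
Proof.
move=> PP'; rewrite /Ex /Rintegral; congr fine.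
by apply: eq_measure_integral => A mA _; exact: PP'.
Qed.

Section normal_facts.
Context (R : realType).
Implicit Types (m s r : R) (f : R -> R).
Local Notation leb := (@lebesgue_measure R).

Lemma lebesgue_measure_affine s m (A : set (measurableTypeR R)) : 0 < s -> measurable A ->
  leb A = (s%:E * leb ((fun z : R => m + s * z)%R @^-1` A))%E.
Proof.
move=> s0 mA.
pose phi (z : measurableTypeR R) : measurableTypeR R := m + s * z.
have mphi : measurable_fun [set: measurableTypeR R] phi.
  by apply: measurable_funD => //; exact: measurable_funM.
pose nu : {measure set (measurableTypeR R) -> \bar R} :=
  mscale (NngNum (ltW s0)) (pushforward leb phi).
apply: (@lebesgue_measure_unique R (nu mphi)) => // _ [[a b]] _ <-.
rewrite /nu /= /mscale/= /pushforward /phi.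
have -> : (fun z : measurableTypeR R => m + s * z) @^-1` `]a, b] =
    `](a - m) / s, (b - m) / s]%classic.
  apply/seteqP; split => z /=; rewrite !in_itv/= ltr_pdivrMr// ler_pdivlMr//.
    by rewrite ltrBlDl lerBrDl mulrC.
  by rewrite ltrBlDl lerBrDl mulrC.
rewrite !lebesgue_measure_itv/= !lte_fin ltr_pM2r ?invr_gt0// ltrD2r.
by case: ifPn => ab; rewrite ?mule0// -!EFinD -EFinM; congr EFin; field; rewrite gt_eqF.
Qed.

Lemma normal_prob_affine s m (A : set (measurableTypeR R)) : 0 < s -> measurable A ->
  normal_prob m s A = normal_prob 0 1 ((fun z : R => m + s * z)%R @^-1` A).
Proof.
move=> s0 mA.
pose phi (z : measurableTypeR R) : measurableTypeR R := m + s * z.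
have mphi : measurable_fun [set: measurableTypeR R] phi.
  by apply: measurable_funD => //; exact: measurable_funM.
have mB : measurable (phi @^-1` A) by rewrite -[X in measurable X]setTI; exact: mphi.
pose nu : {measure set (measurableTypeR R) -> \bar R} :=
  mscale (NngNum (ltW s0)) (pushforward leb phi).
rewrite /normal_prob.
rewrite (@eq_measure_integral _ _ _ _ (nu mphi)) => [|B mB' _]; last first.
  exact: lebesgue_measure_affine.
rewrite ge0_integral_mscale//=; first last.
- by move=> x _; rewrite lee_fin normal_pdf_ge0.
- by apply/measurable_funTS/measurable_EFinP; exact: measurable_normal_pdf.
rewrite ge0_integral_pushforward//; first last.
- by move=> x _; rewrite lee_fin normal_pdf_ge0.
- by apply/measurable_funTS/measurable_EFinP; exact: measurable_normal_pdf.
rewrite -ge0_integralZl//; first last.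
- by rewrite lee_fin ltW.
- by move=> x _; rewrite lee_fin normal_pdf_ge0.
- apply/measurable_funTS/measurable_EFinP.
  by apply: (measurableT_comp _ mphi); exact: measurable_normal_pdf.
apply: eq_integral => z _; rewrite -EFinM; congr EFin.
rewrite /phi !normal_pdfE ?gt_eqF ?oner_eq0//= /normal_peak /normal_fun.
rewrite subr0 addrC addKr expr1n mul1r mulrA; congr (_ * expR _).
  rewrite -mulrnAr sqrtrM ?sqr_ge0// sqrtr_sqr gtr0_norm// invfM mulrA divff ?mul1r//.
  by rewrite gt_eqF.
by field; rewrite gt_eqF.
Qed.

Lemma normal_prob_opp (A : set (measurableTypeR R)) : measurable A ->
  normal_prob 0 1 A = normal_prob 0 1 ((-%R : R -> R) @^-1` A).
Proof.
move=> mA; rewrite /normal_prob.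
have mN : measurable_fun [set: measurableTypeR R] (-%R : measurableTypeR R -> measurableTypeR R).
  by apply: (@measurable_funN _ _ _ setT id).
rewrite (@eq_measure_integral _ _ _ _ (pushforward leb (-%R : _ -> measurableTypeR R)))
  => [|B mB _]; last exact/esym/lebesgue_measureN.
rewrite ge0_integral_pushforward//; first last.
- by move=> x _; rewrite lee_fin normal_pdf_ge0.
- by apply/measurable_funTS/measurable_EFinP; exact: measurable_normal_pdf.
by apply: eq_integral => z _; rewrite /= /normal_pdf oner_eq0 /normal_fun !subr0 sqrrN.
Qed.

(** The explicit density is identified almost everywhere with the Radon-Nikodym derivative, for
    which a change of variables is available. *)
Lemma ge0_integral_normal m s (f : R -> \bar R) : measurable_fun [set: R] f ->
  (forall x, (0 <= f x)%E) ->
  (\int[normal_prob m s]_x f x = \int[leb]_x (f x * (normal_pdf m s x)%:E))%E.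
Proof.
move=> mf f0.
have dom : normal_prob m s `<< leb by exact: normal_prob_dominates.
have mg := measurable_int _ (Radon_Nikodym_SigmaFinite.f_integrable dom).
rewrite -(Radon_Nikodym_SigmaFinite.change_of_variables dom)//.
apply: ae_eq_integral => //.
- exact: emeasurable_funM.
- by apply: emeasurable_funM => //; apply/measurable_EFinP; exact: measurable_normal_pdf.
apply: ae_eqe_mul2l; apply: integral_ae_eq => //.
- exact: Radon_Nikodym_SigmaFinite.f_integrable.
- by apply/measurable_EFinP; exact: measurable_normal_pdf.
- by move=> A _ mA; rewrite -Radon_Nikodym_SigmaFinite.f_integral.
Qed.

Definition gauss : probability (measurableTypeR R) R := normal_prob 0 1.

Lemma Ex_normal m s (f : measurableTypeR R -> R) : 0 < s -> bmeas f ->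
  Ex (normal_prob m s) f = Ex gauss (fun z => f (m + s * z)).
Proof.
move=> s0 bf.
pose phi (z : measurableTypeR R) : measurableTypeR R := m + s * z.
have mphi : measurable_fun [set: measurableTypeR R] phi.
  by apply: measurable_funD => //; exact: measurable_funM.
pose Phi : {RV gauss >-> measurableTypeR R} :=
  MeasurableFun.Pack (MeasurableFun.Class (isMeasurableFun.Build _ _ _ _ _ mphi)).
transitivity (Ex (distribution gauss Phi) f); last exact: Ex_distribution.
by apply: eq_Ex_measure => A mA; exact: normal_prob_affine.
Qed.

Lemma Ex_gauss_opp (f : measurableTypeR R -> R) : bmeas f ->
  Ex gauss (fun z => f (- z)) = Ex gauss f.
Proof.
move=> bf.
have mN : measurable_fun [set: measurableTypeR R] (-%R : measurableTypeR R -> measurableTypeR R).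
  by apply: (@measurable_funN _ _ _ setT id).
pose Phi : {RV gauss >-> measurableTypeR R} :=
  MeasurableFun.Pack (MeasurableFun.Class (isMeasurableFun.Build _ _ _ _ _ mN)).
transitivity (Ex (distribution gauss Phi) f); first exact/esym/Ex_distribution.
by apply: eq_Ex_measure => A mA; exact/esym/normal_prob_opp.
Qed.

(** The standard density times this exponential is [r^-1] times the centred density of standard
    deviation [r^-1]. Varying [r] gives a generating function of [z ^+ 2], the source of the
    Gaussian moments. *)
Lemma integral_gauss_exp r : 0 < r ->
  (\int[gauss]_z (expR ((1 - r ^+ 2) * z ^+ 2 / 2))%:E = (r^-1)%:E)%E.
Proof.
move=> r0.
rewrite ge0_integral_normal; first last.
- by move=> x; rewrite lee_fin expR_ge0.
- apply/measurable_EFinP; apply: measurableT_comp => //.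
  by apply: measurable_funM => //; apply: measurable_funM => //; exact: measurable_funX.
transitivity (\int[leb]_x ((r^-1)%:E * (normal_pdf 0 r^-1 x)%:E))%E.
  apply: eq_integral => z _; rewrite -!EFinM; congr EFin.
  rewrite !normal_pdfE ?gt_eqF ?invr_gt0//= /normal_peak /normal_fun subr0 expr1n mul1r.
  rewrite mulrCA -expRD [RHS]mulrA; congr (_ * expR _).
    rewrite -[in RHS]mulrnAr sqrtrM ?sqr_ge0// sqrtr_sqr gtr0_norm ?invr_gt0// invfM invrK.
    by rewrite mulrA mulVf ?mul1r// gt_eqF.
  by field; rewrite gt_eqF.
rewrite ge0_integralZl//; first last.
- by rewrite lee_fin invr_ge0 ltW.
- by move=> x _; rewrite lee_fin normal_pdf_ge0.
- by apply/measurable_EFinP; exact: measurable_normal_pdf.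
by rewrite integral_normal_pdf mule1.
Qed.

End normal_facts.

Section gauss_moments.
Context (R : realType).
Local Notation gauss := (@gauss R).
Implicit Types r : R.

Let measurable_gexp r :
  measurable_fun [set: measurableTypeR R] (fun z : R => expR ((1 - r ^+ 2) * z ^+ 2 / 2)).
Proof.
by apply: measurableT_comp => //; apply: measurable_funM => //;
  apply: measurable_funM => //; exact: measurable_funX.
Qed.

Let integrable_gexp r : 0 < r ->
  gauss.-integrable setT (EFin \o (fun z : R => expR ((1 - r ^+ 2) * z ^+ 2 / 2))).
Proof.
move=> r0; apply/integrableP; split; first by apply/measurable_EFinP; exact: measurable_gexp.
rewrite [X in (X < _)%E](_ : _ = (r^-1)%:E) ?ltry//.
rewrite -(integral_gauss_exp r0); apply: eq_integral => z _ /=.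
by rewrite ger0_norm// expR_ge0.
Qed.

Let Rintegral_gexp r : 0 < r ->
  \int[gauss]_z (expR ((1 - r ^+ 2) * z ^+ 2 / 2)) = r^-1.
Proof. by move=> r0; rewrite /Rintegral integral_gauss_exp. Qed.

Lemma integrable_gauss_pow n : (n <= 4)%N ->
  gauss.-integrable setT (EFin \o (fun z : R => z ^+ n)).
Proof.
(* [r ^+ 2 = 1 / 2] makes the exponent [w = z ^+ 2 / 4], and [32 * expR w >= 32 * (1 + w ^+ 2 / 2) =
   32 + z ^+ 4] dominates every power up to 4. *)
move=> n4; pose r : R := Num.sqrt (1 / 2).
have r0 : 0 < r by rewrite sqrtr_gt0; lra.
have r2 : r ^+ 2 = 1 / 2 by rewrite sqr_sqrtr//; lra.
apply: (@le_integrable _ _ _ gauss setT measurableT _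
  (EFin \o (fun z : R => 32 * expR ((1 - r ^+ 2) * z ^+ 2 / 2)))) => //.
- by apply/measurable_EFinP; exact: measurable_funX.
- move=> z _ /=; rewrite lee_fin r2.
  have e0 : 0 <= 32 * expR ((1 - 1 / 2) * z ^+ 2 / 2) by rewrite mulr_ge0 ?expR_ge0.
  rewrite (ger0_norm e0) normrX.
  have w0 : 0 <= (1 - 1 / 2) * z ^+ 2 / 2 by have := sqr_ge0 z; lra.
  have := expR_ge1Dxn 1 w0; rewrite (_ : 2`! = 2%N :> nat)//.
  have zn : `|z| ^+ n <= 1 + (z ^+ 2) ^+ 2.
    rewrite -(real_normK (num_real (z : R))) -exprM.
    case: (lerP `|z| 1) => z1.
      by rewrite (le_trans (exprn_ile1 _ _ _))// lerDl exprn_ge0.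
    by rewrite (le_trans (ler_weXn2l _ n4)) ?(ltW z1)// lerDr.
  have := sqr_ge0 (z ^+ 2); move: (z ^+ 2) (expR _) (`|z| ^+ n) zn => v e q.
  nra.
- have := integrableZl measurableT 32 (integrable_gexp r0).
  by apply: eq_integrable => // z _ /=; rewrite EFinM.
Qed.

(** Since [expR w >= 1 + w], the function [r^-1] dominates [1 + (1 - r ^+ 2) / 2 * v], with equality
    at [r = 1]; the slopes there, [-1] and [- v], must agree. *)
Lemma gauss_second_moment : \int[gauss]_z (z ^+ 2) = 1.
Proof.
have i2 := integrable_gauss_pow (isT : (2 <= 4)%N).
set v := Rintegral _ _ _.
have H r : 0 < r -> 1 + (1 - r ^+ 2) / 2 * v <= r^-1.
  move=> r0.
  have i1 : gauss.-integrable setT (EFin \o (fun=> 1 : R)).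
    by apply: bmeas_integrable; exact: bmeas_cst.
  have iz : gauss.-integrable setT (EFin \o (fun z : R => (1 - r ^+ 2) / 2 * z ^+ 2)).
    have := integrableZl measurableT ((1 - r ^+ 2) / 2) i2.
    by apply: eq_integrable => // z _ /=; rewrite EFinM.
  have <- : \int[gauss]_z (1 + (1 - r ^+ 2) / 2 * z ^+ 2) = 1 + (1 - r ^+ 2) / 2 * v.
    rewrite (RintegralD measurableT i1 iz) RintegralZl//.
    by congr (_ + _); exact: (Ex_cst gauss).
  rewrite -(Rintegral_gexp r0); apply: (@le_Rintegral _ _ _ gauss) => //.
  - have := integrableD measurableT i1 iz.
    by apply: eq_integrable => // z _ /=.
  - exact: integrable_gexp.
  - by move=> z _; rewrite mulrAC expR_ge1Dx.
have H' r : 0 < r -> (r - 1) * (2 - r * (1 + r) * v) <= 0.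
  move=> r0; have := H r r0; rewrite -(ler_pM2l r0) divff ?gt_eqF//; nra.
(* [H'] asks [r * (1 + r) * v] to be at least 2 above 1 and at most 2 below 1. For [v < 1] it fails
   at [1 + (1 - v) / 4] (at 2 if [v <= 0]), for [v > 1] at [1 - (1 - v^-1) / 4]. *)
have [v1|v1|//] := ltgtP v 1.
  case: (lerP v 0) => v0.
    by have := H' 2 ltac:(lra); nra.
  have e0 : 0 < (1 - v) / 4 by lra.
  have := H' (1 + (1 - v) / 4) ltac:(lra); rewrite addrAC subrr add0r pmulr_rle0//.
  nra.
have w0 : 0 < v^-1 < 1 by rewrite invr_gt0 invf_lt1//; lra.
have vw : v * v^-1 = 1 by rewrite divff//; lra.
move: w0 vw (H' (1 - (1 - v^-1) / 4)) => /andP[]; move: v^-1 => w w0 w1 vw.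
have e0 : 0 < (1 - w) / 4 by lra.
move=> /(_ ltac:(lra)); rewrite addrAC subrr add0r mulNr oppr_le0 pmulr_rge0//.
nra.
Qed.

End gauss_moments.

(** * Smoothing of Lipschitz functions by iterated primitives *)

Section primitive.
Context (R : realType).
Implicit Types (f : R -> R) (x y a b : R).
Local Notation leb := (@lebesgue_measure R).

Let cont_integrable f a b : continuous f -> leb.-integrable `[a, b] (EFin \o f).
Proof.
move=> cf; apply: continuous_compact_integrable; first exact: segment_compact.
exact: continuous_subspaceT.
Qed.

Let base_change f a b x : continuous f -> a <= b -> b <= x ->
  \int[leb]_(t in `[a, x]) f t = \int[leb]_(t in `[a, b]) f t + \int[leb]_(t in `[b, x]) f t.
Proof.
move=> cf ab bx; have i1 := cont_integrable a x cf.
have := @Rintegral_itvB R f (BLeft a) (BRight x) b i1.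
rewrite !bnd_simp => /(_ ab bx) h; rewrite -(@Rintegral_itv_obnd_cbnd R b (BRight x)).
  by rewrite -h addrC subrK.
by apply: integrableS (cont_integrable b x cf) => //; exact: subset_itv_oc_cc.
Qed.

Lemma primitive_exists f : continuous f ->
  exists F : R -> R, forall x, is_derive x 1 F (f x).
Proof.
move=> cf.
(* Integrals run over intervals with ordered ends, so in [F] the base point moves with [x] to stay
   left of both [x] and 0. [G a x] does not depend on such a base point, hence near [x] the function
   [F] coincides with [G] at one fixed base, far enough to the left. *)
pose G a x := \int[leb]_(t in `[a, x]) f t - \int[leb]_(t in `[a, 0]) f t.
pose F x := G (- (`|x| + 1)) x.
exists F => x.
pose a := - (`|x| + 3).
have ax : a < x.
  by rewrite /a; have := ler_norm (- x); rewrite normrN; lra.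
have /(_ ax (cf x)) [dG G'] := @continuous_FTC1_closed R f a x (x + 1) ltac:(lra)
  (cont_integrable _ _ cf).
apply: (@near_eq_is_derive _ _ _ (G a)); last first.
  rewrite /G; apply: is_derive_eq.
  apply: is_deriveB; apply: DeriveDef; [exact: dG|].
  by rewrite -derive1E G'.
  by rewrite subr0.
near=> y.
have xy : `|x - y| < 1 by near: y; exact: (@cvgr_dist_lt _ _ _ _ _ _ x).
have yx : `|y| <= `|x| + 1.
  rewrite -[y](subrK x) (le_trans (ler_normD _ _))// addrC lerD2l distrC; exact: ltW.
have := ler_norm (- y); have := normr_ge0 y; rewrite normrN => y0 yy.
rewrite /F /G; have ab : a <= - (`|y| + 1) by rewrite /a; lra.
rewrite (base_change (b := - (`|y| + 1)) cf ab); last lra.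
rewrite (base_change (x := 0) (b := - (`|y| + 1)) cf ab); last lra.
ring.
Unshelve. all: by end_near. Qed.

End primitive.

Section smoothing.
Context (R : realType).
Implicit Types (f g : R -> R) (x y u : R).

Definition lip (L : R) f := forall x y, `|f x - f y| <= L * `|x - y|.

Lemma lip_continuous L f : lip L f -> continuous f.
Proof.
move=> fL x; apply/cvgrPdist_lt => e e0.
have L0 : 0 < `|L| + 1 by have := normr_ge0 L; lra.
near=> y.
have xy : `|x - y| < e / (`|L| + 1).
  by near: y; apply: (@cvgr_dist_lt _ _ _ _ _ _ x) => //; exact: divr_gt0.
apply: (le_lt_trans (fL x y)).
have LL : L <= `|L| := ler_norm L.
rewrite ltr_pdivlMr// in xy.
have := normr_ge0 (x - y); move: (`|x - y|) xy => v xy v0; nra.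
Unshelve. all: by end_near. Qed.

(* A second-order Taylor estimate that only involves the even part of
   [u |-> f (x + u)], so that no first derivative is needed. *)
Definition even_taylor f (C : R) := exists D : R -> R, forall x u,
  `|f (x + u) + f (x - u) - 2 * f x - D x * u ^+ 2| <= C * `|u| ^+ 3.

Let is_derive_shift (F dF : R -> R) (c x : R) : (forall x, is_derive x 1 F (dF x)) ->
  is_derive x 1 (fun y => F (y + c)) (dF (x + c)).
Proof.
move=> dFF; have h := dFF (x + c).
have h2 : is_derive x 1 (fun y : R => y + c) 1.
  by apply: is_derive_eq; rewrite addr0.
have := @is_derive1_comp _ F (fun y => y + c) x _ _ h h2.
by move=> /is_derive_eq; apply; rewrite mulr1.
Qed.

Let mvt (F dF : R -> R) (a b : R) : a <= b -> (forall x, is_derive x 1 F (dF x)) ->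
  exists2 c, a <= c <= b & F b - F a = dF c * (b - a).
Proof.
move=> ab dFF; have cF : {within `[a, b], continuous F}.
  by apply: derivable_within_continuous => x _; case: (dFF x).
by have [c cab E] := MVT_segment ab (fun x _ => dFF x) cF; exists c.
Qed.

(** [g] is the second difference quotient, with step [h], of a second primitive of [f]: the mean of
    [f (x + u + v)] for [u], [v] uniform in [[0, h]]. Its second derivative is the second difference
    quotient of [f], Lipschitz with constant [4 * L / h ^+ 2]. *)
Lemma smooth_approx L f (h : R) : 0 < h -> lip L f ->
  exists g, [/\ lip (2 * L) g, forall x, `|g x - f x| <= 2 * L * h &
    even_taylor g (8 * L / h ^+ 2)].
Proof.
move=> h0 fL.
have cf := lip_continuous fL.
have [G1 dG1] := primitive_exists cf.
have cG1 : continuous G1.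
  by move=> x; apply: differentiable_continuous; apply/derivable1_diffP; case: (dG1 x).
have [G2 dG2] := primitive_exists cG1.
have cG2 : continuous G2.
  by move=> x; apply: differentiable_continuous; apply/derivable1_diffP; case: (dG2 x).
have h2 : 0 < h ^+ 2 by rewrite exprn_gt0.
have L0 : 0 <= L by have := fL 1 0; rewrite subr0 normr1 mulr1; apply: le_trans.
pose dd (F : R -> R) x := (F (x + 2 * h) - 2 * F (x + h) + F x) / h ^+ 2 : R.
have is_derive_dd (F dF : R -> R) x : (forall x, is_derive x 1 F (dF x)) ->
    is_derive x 1 (dd F) (dd dF x).
  move=> dFF; have d1 := is_derive_shift (2 * h) x dFF.
  have d2 := is_derive_shift h x dFF; have d3 := dFF x.
  apply: is_derive_eq.
  by rewrite /dd /GRing.scale/= mulr0; ring.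
pose g := dd G2; pose D := dd f.
have DL x y : `|D x - D y| <= 4 * L / h ^+ 2 * `|x - y|.
  rewrite /D /dd -mulrBl normrM normfV (ger0_norm (ltW h2)) mulrAC.
  rewrite ler_pM2r ?invr_gt0//.
  have := fL (x + 2 * h) (y + 2 * h); have := fL (x + h) (y + h); have := fL x y.
  have e c : x + c - (y + c) = x - y by ring.
  rewrite !e => l1 l2 l3.
  rewrite (_ : _ - _ = (f (x + 2 * h) - f (y + 2 * h)) +
     (- 2 * (f (x + h) - f (y + h)) + (f x - f y))); last by ring.
  rewrite (le_trans (ler_normD _ _))// (_ : 4 * L * _ = L * `|x - y| + 
    (2 * (L * `|x - y|) + L * `|x - y|)); last by ring.
  rewrite lerD// (le_trans (ler_normD _ _))// lerD// normrM normrN normr_nat.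
  by rewrite ler_pM2l.
exists g; split.
- have g1L y : `|dd G1 y| <= 2 * L.
    have [c1 /andP[yc1 c1y] E1] := mvt (a := y + h) (b := y + 2 * h) ltac:(lra) dG1.
    have [c2 /andP[yc2 c2y] E2] := mvt (a := y) (b := y + h) ltac:(lra) dG1.
    rewrite (_ : dd G1 y = (f c1 - f c2) / h).
      rewrite normrM normfV (gtr0_norm h0) ler_pdivrMr// (le_trans (fL _ _))//.
      by rewrite -mulrA mulrCA ler_wpM2l// ler_norml; lra.
    rewrite /dd (_ : _ - _ + _ = (G1 (y + 2 * h) - G1 (y + h)) - (G1 (y + h) - G1 y)).
      rewrite E1 E2; field; lra.
    by ring.
  have glip x y : x <= y -> `|g x - g y| <= 2 * L * `|x - y|.
    move=> xy; have [c _] := mvt xy (fun x => is_derive_dd _ _ x dG2).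
    by rewrite distrC => ->; rewrite normrM (distrC y) ler_wpM2r.
  move=> x y; case: (leP x y) => [|/ltW]; first exact: glip.
  by rewrite distrC (distrC x); exact: glip.
- move=> y.
  have [c1 /andP[yc1 c1y] E1] := mvt (F := fun t => G2 (t + h) - G2 t)
     (dF := fun t => G1 (t + h) - G1 t) (a := y) (b := y + h) ltac:(lra)
     (fun x => is_deriveB (is_derive_shift h x dG2) (dG2 x)).
  have [c2 /andP[yc2 c2y] E2] := mvt (a := c1) (b := c1 + h) ltac:(lra) dG1.
  rewrite (_ : g y = f c2); last first.
    rewrite /g /dd (_ : _ - _ + _ = (G2 (y + h + h) - G2 (y + h)) - (G2 (y + h) - G2 y)).
      rewrite E1 E2; field; lra.
    by rewrite (_ : y + 2 * h = y + h + h); ring.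
  apply: (le_trans (fL _ _)); rewrite -mulrA mulrCA ler_wpM2l// ger0_norm; lra.
- exists D => x u.
  wlog u0 : u / 0 <= u.
    move=> H; case: (lerP 0 u) => [|u0]; first exact: H.
    have := H (- u) ltac:(lra); rewrite opprK sqrrN normrN.
    by rewrite (_ : g (x - u) + g (x + u) = g (x + u) + g (x - u)) // addrC.
  pose g1 := dd G1.
  have dg y : is_derive y 1 g (g1 y) by exact: is_derive_dd.
  have dg1 y : is_derive y 1 g1 (D y) by exact: is_derive_dd.
  have dneg (F dF : R -> R) y : (forall y, is_derive y 1 F (dF y)) ->
      is_derive y 1 (fun t : R => F (x - t)) (- dF (x - y)).
    move=> dFF.
    have e2 : is_derive y 1 (fun t : R => x - t) (-1).
      by apply: is_derive_eq; rewrite add0r mul1r.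
    have := @is_derive1_comp _ F (fun t => x - t) y _ _ (dFF (x - y)) e2.
    by move=> /is_derive_eq; apply; rewrite mulrN1.
  have dpos (F dF : R -> R) y : (forall y, is_derive y 1 F (dF y)) ->
      is_derive y 1 (fun t : R => F (x + t)) (dF (x + y)).
    move=> dFF; under eq_fun do rewrite addrC.
    by rewrite [x + y]addrC; exact: is_derive_shift.
  (* [psi] and [psi1] vanish at 0, and [psi2] is bounded by [8 * L / h ^+ 2 * t] for [t >= 0]; two
     mean value steps give the cubic bound. *)
  pose psi (t : R) := g (x + t) + g (x - t) - 2 * g x - D x * t ^+ 2.
  pose psi1 (t : R) := g1 (x + t) - g1 (x - t) - D x * (2 * t).
  pose psi2 (t : R) := D (x + t) + D (x - t) - 2 * D x.
  have dpsi (t : R) : is_derive t 1 psi (psi1 t).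
    have p1 := dpos _ _ t dg; have p2 := dneg _ _ t dg.
    by apply: is_derive_eq; rewrite /psi1 /GRing.scale/=; ring.
  have dpsi1 (t : R) : is_derive t 1 psi1 (psi2 t).
    have p1 := dpos _ _ t dg1; have p2 := dneg _ _ t dg1.
    by apply: is_derive_eq; rewrite /psi2 /GRing.scale/=; ring.
  have [c /andP[c0 cu]] := mvt u0 dpsi.
  rewrite {2}/psi addr0 subr0 expr0n/= mulr0 !subr0 => E.
  have [e /andP[e0 ec]] := mvt c0 dpsi1.
  rewrite {2}/psi1 addr0 subr0 mulr0 mulr0 !subr0 subrr subr0 => E'.
  rewrite -[X in `|X|]/(psi u).
  have -> : psi u = psi2 e * c * u.
    by rewrite -E' -E /psi; ring.
  have p2 : `|psi2 e| <= 8 * L / h ^+ 2 * e.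
    have := DL (x + e) x; have := DL (x - e) x.
    have -> : x + e - x = e by ring.
    have -> : x - e - x = - e by ring.
    rewrite normrN (ger0_norm e0) /psi2 => l1 l2.
    rewrite (_ : _ - _ = (D (x + e) - D x) + (D (x - e) - D x)); last by ring.
    rewrite (le_trans (ler_normD _ _))//.
    rewrite (_ : 8 * L / h ^+ 2 * e = 4 * L / h ^+ 2 * e + 4 * L / h ^+ 2 * e); last by ring.
    exact: lerD.
  have K0 : 0 <= 8 * L / h ^+ 2 by rewrite divr_ge0 ?mulr_ge0// ltW.
  move: (8 * L / h ^+ 2) K0 p2 => K K0 p2.
  rewrite !normrM (ger0_norm c0) (ger0_norm u0) exprS expr2 !mulrA.
  apply: ler_wpM2r => //; apply: ler_pM => //.
  by apply: (le_trans p2); rewrite ler_wpM2l// (le_trans ec).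
Qed.

End smoothing.

(** * Gaussian averaging operators and one step of the exchange *)

Section gaussian_operator.
Context (R : realType).
Local Notation gauss := (@gauss R).
Implicit Types (f g : R -> R) (c a x : R).

Definition blip f := (exists L, lip L f) /\ (exists M : R, forall x, `|f x| <= M).

Lemma blip_continuous f : blip f -> continuous f.
Proof. by move=> [[L fL] _]; exact: lip_continuous fL. Qed.

Lemma bmeas_blip d (T : measurableType d) f (h : T -> R) : blip f ->
  measurable_fun [set: T] h -> bmeas (fun w => f (h w)).
Proof.
move=> bf mh; apply: bmeas_comp => //; last exact: bf.2.
by apply: continuous_measurable_fun; exact: blip_continuous.
Qed.

Definition gavg c f a := Ex gauss (fun z : R => f (a + c * z)).

Lemma bmeas_gavg_arg f c a : blip f -> bmeas (fun z : measurableTypeR R => f (a + c * z)).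
Proof.
move=> bf; apply: bmeas_blip => //.
by apply: measurable_funD => //; exact: measurable_funM.
Qed.

Lemma blip_gavg c f : blip f -> blip (gavg c f).
Proof.
move=> bf; have [[L fL] [M fM]] := bf; split; last first.
  by exists M => a; apply: Ex_norm_le => //; exact: bmeas_gavg_arg.
exists L => a b; rewrite -(Ex_cst gauss (L * `|a - b|)).
apply: Ex_dist_le; [exact: bmeas_gavg_arg..|exact: bmeas_cst|move=> z].
by rewrite (le_trans (fL _ _))// opprD addrACA subrr addr0.
Qed.

Definition gauss_m4 : R := \int[gauss]_z (z ^+ 4).

Lemma gauss_m4_ge0 : 0 <= gauss_m4.
Proof. by apply: Rintegral_ge0 => z _; rewrite exprn_even_ge0. Qed.

(** The comparison function [B * z ^+ 2] has mean [B] by [gauss_second_moment], and the error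
    integrates to the fourth moment. With [B = 0] this is a plain moment bound. *)
Lemma Ex_gauss_approx (h : measurableTypeR R -> R) (B D : R) : bmeas h ->
  (forall z : R, `|h z - B * z ^+ 2| <= D * (1 + z ^+ 4)) ->
  `|Ex gauss h - B| <= D * (1 + gauss_m4).
Proof.
move=> bh hBD.
have ih := bmeas_integrable gauss bh.
have i1 := bmeas_integrable gauss (bmeas_cst _ D).
have iB : gauss.-integrable setT (EFin \o (fun z : R => B * z ^+ 2)).
  have := integrableZl measurableT B (integrable_gauss_pow R (isT : (2 <= 4)%N)).
  by apply: eq_integrable => // z _ /=; rewrite EFinM.
have iD : gauss.-integrable setT (EFin \o (fun z : R => D * z ^+ 4)).
  have := integrableZl measurableT D (integrable_gauss_pow R (isT : (4 <= 4)%N)).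
  by apply: eq_integrable => // z _ /=; rewrite EFinM.
have iDD : gauss.-integrable setT (EFin \o (fun z : R => D + D * z ^+ 4)).
  by have := integrableD measurableT i1 iD; apply: eq_integrable.
have iB' : gauss.-integrable setT (EFin \o (fun z : R => h z - B * z ^+ 2)).
  by have := integrableB measurableT ih iB; apply: eq_integrable.
have iB2 : gauss.-integrable setT (EFin \o (fun z : R => `|h z - B * z ^+ 2|)).
  exact: integrable_norm.
have EB : B = \int[gauss]_z (B * z ^+ 2).
  rewrite RintegralZl// ?gauss_second_moment ?mulr1//.
  exact: (integrable_gauss_pow R (isT : (2 <= 4)%N)).
rewrite [X in _ - X]EB /Ex -(RintegralB measurableT ih iB).
apply: (le_trans (le_normr_Rintegral measurableT iB')).
have -> : D * (1 + gauss_m4) = \int[gauss]_z (D + D * z ^+ 4).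
  rewrite (RintegralD measurableT i1 iD) RintegralZl//.
    by rewrite mulrDr mulr1; congr (_ + _); exact/esym/(Ex_cst gauss).
  exact: (integrable_gauss_pow R (isT : (4 <= 4)%N)).
apply: (@le_Rintegral _ _ _ gauss) => // z _.
by rewrite (le_trans (hBD z))// mulrDr mulr1.
Qed.

Lemma gavg_dist L f c c' a : 0 <= L -> lip L f -> blip f ->
  `|gavg c f a - gavg c' f a| <= L * `|c - c'| * (1 + gauss_m4).
Proof.
move=> L0 fL bf; rewrite /gavg -ExB; [|exact: bmeas_gavg_arg..].
rewrite -[X in `|X|]subr0; apply: Ex_gauss_approx.
  by apply: bmeasB; exact: bmeas_gavg_arg.
move=> z; rewrite mul0r subr0 (le_trans (fL _ _))// -mulrA ler_wpM2l//.
rewrite opprD addrACA subrr add0r -mulrBl normrM ler_wpM2l//.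
rewrite -[4%N]/(2 * 2)%N exprM; have := sqr_ge0 (`|z| - 1).
have -> : z ^+ 2 = `|z| ^+ 2 by rewrite real_normK// num_real.
have := sqr_ge0 (`|z| ^+ 2 - 1).
have := normr_ge0 z; move: (`|z|) => v; nra.
Qed.

(** One exchange of Lindeberg's method. The sign and the Gaussian step are both symmetric, so only
    the even part of [g] around [a] enters; its second-order term is the same in both means because
    the variances agree, and cubic terms remain. *)
Lemma gavg_step C g c a : blip g -> even_taylor g C -> 0 <= C ->
  `|(g (a + c) + g (a - c)) / 2 - gavg c g a| <= C * `|c| ^+ 3 * (1 + gauss_m4).
Proof.
move=> bg [D gD] C0.
have sym : gavg c g a = Ex gauss (fun z : R => g (a - c * z)).
  rewrite /gavg -(Ex_gauss_opp (bmeas_gavg_arg c a bg)).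
  by congr Ex; apply/funext => z; rewrite mulrN.
pose h (z : measurableTypeR R) := g (a + c * z) + g (a - c * z) - 2 * g a.
have bh1 : bmeas (fun z : measurableTypeR R => g (a + c * z)) by exact: bmeas_gavg_arg.
have bh2 : bmeas (fun z : measurableTypeR R => g (a - c * z)).
  by under eq_fun do rewrite -mulNr; exact: bmeas_gavg_arg.
have bh : bmeas h.
  by apply: bmeasB; [exact: bmeasD|exact: bmeas_cst].
have Eh : Ex gauss h = 2 * gavg c g a - 2 * g a.
  rewrite /h ExB; [|exact: bmeasD|exact: bmeas_cst].
  rewrite Ex_cst ExD// -/(gavg c g a) -sym; ring.
have c3 : 0 <= `|c| ^+ 3 by rewrite exprn_ge0.
have key (z : R) : `|h z - D a * c ^+ 2 * z ^+ 2| <= C * `|c| ^+ 3 * (1 + z ^+ 4).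
  have := gD a (c * z); rewrite -/(h z) exprMn mulrA => H.
  apply: (le_trans H); rewrite normrM exprMn mulrA ler_wpM2l ?mulr_ge0//.
  rewrite -[4%N]/(2 * 2)%N exprM.
  have -> : z ^+ 2 = `|z| ^+ 2 by rewrite real_normK// num_real.
  have := normr_ge0 z; move: (`|z|) => v v0.
  have := sqr_ge0 (v ^+ 2 - v); have := sqr_ge0 (v - 1); have := sqr_ge0 (v ^+ 2 - 1).
  have := sqr_ge0 (v ^+ 2 - v / 2); nra.
have := Ex_gauss_approx bh key; rewrite Eh.
have := gD a c; have := gauss_m4_ge0.
move: (gavg c g a) gauss_m4 (D a * c ^+ 2) (C * `|c| ^+ 3) (mulr_ge0 C0 c3) => G m B E E0 m0.
rewrite !ler_norml => /andP[h1 h2] /andP[h3 h4]; nra.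
Qed.

End gaussian_operator.

(** * Increments of Brownian motion *)

Section unit_interval.
Context (R : realType).

Lemma clamp_itv (x : R) : (`[0, 1]%classic : set R) (Num.max 0 (Num.min 1 x)).
Proof. by rewrite /= in_itv/= le_max lexx/= ge_max ler01 ge_min lexx. Qed.

Definition toI (x : R) : I01 R := SigSub (mem_set (clamp_itv x)).

Lemma toIE x : 0 <= x <= 1 -> I01_val (toI x) = x.
Proof. by move=> /andP[x0 x1]; rewrite /I01_val/= /set_val/= min_r// max_r. Qed.

Lemma I01_itv (t : I01 R) : 0 <= I01_val t <= 1.
Proof. by have := set_valP t; rewrite /= in_itv. Qed.

Lemma I01_val_inj (s t : I01 R) : I01_val s = I01_val t -> s = t.
Proof. by move=> h; apply: val_inj. Qed.

Lemma toIK (t : I01 R) : toI (I01_val t) = t.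
Proof. by apply: I01_val_inj; rewrite toIE// I01_itv. Qed.

End unit_interval.

Section brownian.
Context (R : realType) d' (T' : measurableType d') (Q : probability T' R).
Variables (W : T' -> C01 R).
Hypothesis bmW : standard_BM Q W.
Implicit Types (f g : R -> R).

Definition incr (t : nat -> R) (i : nat) (w : T') : R :=
  W w (toI (t i.+1)) - W w (toI (t i)).

Lemma measurable_incr t i : measurable_fun [set: T'] (incr t i).
Proof. by case: bmW => mW _ _ _; apply: measurable_funB; exact: mW. Qed.

Lemma incr_indep (t : nat -> R) : (forall i, 0 <= t i <= 1) -> (forall i, t i <= t i.+1) ->
  mutual_indep Q (incr t).
Proof.
by case: bmW => _ _ iW _ t01 tn; apply: (iW (fun i => toI (t i))) => i; rewrite !toIE.
Qed.

Lemma Ex_incr (t : nat -> R) i f : (forall i, 0 <= t i <= 1) -> t i < t i.+1 -> blip f ->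
  Ex Q (fun w => f (incr t i w)) = gavg (Num.sqrt (t i.+1 - t i)) f 0.
Proof.
move=> t01 ti bf; case: bmW => _ _ _ nW.
have bf' : bmeas (f : measurableTypeR R -> R) by exact: (bmeas_blip bf (@measurable_id _ _ _)).
have mI : measurable_fun [set: T'] (incr t i : T' -> measurableTypeR R).
  exact: measurable_incr.
pose Phi : {RV Q >-> measurableTypeR R} :=
  MeasurableFun.Pack (MeasurableFun.Class (isMeasurableFun.Build _ _ _ _ _ mI)).
transitivity (Ex (distribution Q Phi) f); first exact/esym/Ex_distribution.
have s0 : 0 < Num.sqrt (t i.+1 - t i) by rewrite sqrtr_gt0 subr_gt0.
transitivity (Ex (normal_prob 0 (Num.sqrt (t i.+1 - t i))) f).
  apply: eq_Ex_measure => A mA.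
  have := nW (toI (t i)) (toI (t i.+1)); rewrite !toIE// => /(_ ti A mA).
  by apply: etrans.
rewrite Ex_normal//.
Qed.

Lemma gavg_comp0 s c f a : blip f -> s = 0 -> gavg s (gavg c f) a = gavg c f a.
Proof.
move=> bf ->; rewrite {1}/gavg; under eq_fun do rewrite mul0r addr0.
by rewrite Ex_cst.
Qed.

Lemma gavg_affine c f r a : gavg c (fun u => f (a + r * u)) 0 = gavg (r * c) f a.
Proof. by rewrite /gavg; congr Ex; apply/funext => z; rewrite add0r mulrA. Qed.

Lemma blip_affine f r a : blip f -> blip (fun u => f (a + r * u)).
Proof.
move=> [[L fL] [M fM]]; split; last by exists M => u.
exists (L * `|r|) => x y; rewrite (le_trans (fL _ _))// -mulrA.
by rewrite opprD addrACA subrr add0r -mulrBr normrM.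
Qed.

(* The convolution of two centred Gaussians, read off two consecutive
   increments of the Brownian motion. *)
Lemma gavg_comp s c f a : blip f -> 0 <= s -> 0 <= c ->
  gavg s (gavg c f) a = gavg (Num.sqrt (s ^+ 2 + c ^+ 2)) f a.
Proof.
move=> bf; rewrite le_eqVlt => /predU1P[<-|s0] c0.
  by rewrite gavg_comp0// expr0n/= add0r sqrtr_sqr ger0_norm.
move: c0; rewrite le_eqVlt => /predU1P[<-|c0].
  rewrite expr0n/= addr0 sqrtr_sqr gtr0_norm//; congr (gavg s _ a).
  by apply/funext => x; rewrite /gavg; under eq_fun do rewrite mul0r addr0; rewrite Ex_cst.
set r := Num.sqrt _.
have r2 : r ^+ 2 = s ^+ 2 + c ^+ 2 by rewrite sqr_sqrtr// addr_ge0 ?sqr_ge0.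
have s20 : 0 < s ^+ 2 by rewrite exprn_gt0.
have c20 : 0 < c ^+ 2 by rewrite exprn_gt0.
have r0 : 0 < r by rewrite sqrtr_gt0 addr_gt0.
have r20 : 0 < r ^+ 2 by rewrite exprn_gt0.
(* The unit interval is cut at [u] so that the increments of [r * W] over [[0, u]] and [[u, 1]] have
   deviations [s] and [c]; their sum is the increment over [[0, 1]], of deviation [r]. *)
pose u := s ^+ 2 / r ^+ 2.
have u0 : 0 < u by rewrite divr_gt0.
have u1 : u < 1 by rewrite ltr_pdivrMr// mul1r r2 ltrDl.
pose t (i : nat) : R := if i is 0%N then 0 else if i is 1%N then u else 1.
have t01 i : 0 <= t i <= 1 by case: i => [|[|i]] /=; rewrite ?lexx ?ler01// !ltW.
have tn i : t i <= t i.+1 by case: i => [|[|i]] /=; rewrite ?lexx// ltW.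
have mi := measurable_incr t.
have E0 : r * Num.sqrt (u - 0) = s.
  rewrite subr0 /u -exprVn -exprMn sqrtr_sqr ger0_norm ?divr_ge0// ?ltW//.
  by rewrite mulrC divfK// gt_eqF.
have E1 : r * Num.sqrt (1 - u) = c.
  have -> : 1 - u = (c / r) ^+ 2.
    by rewrite /u exprMn exprVn -[1](divff (lt0r_neq0 r20)) -mulrBl r2 addrAC subrr add0r.
  by rewrite sqrtr_sqr ger0_norm ?divr_ge0 ?ltW// mulrC divfK// gt_eqF.
pose F (x : seqR R) := f (a + r * (x 0%N + x 1%N)).
have bF : bmeas F.
  apply: bmeas_blip => //; apply: measurable_funD => //; apply: measurable_funM => //.
  by apply: measurable_funD; exact: measurable_coord.
pose t' (i : nat) : R := if i is 0%N then 0 else 1.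
have t'01 i : 0 <= t' i <= 1 by case: i => [|i] /=; rewrite ?lexx ?ler01.
have := @Ex_incr t' 0 (fun x => f (a + r * x)) t'01 ltr01 (blip_affine r a bf).
rewrite /t' subr0 sqrtr1 gavg_affine mulr1 => <-.
have -> : (fun w => f (a + r * incr t' 0 w)) = (fun w => F (fun i => incr t i w)).
  apply/funext => w; rewrite /F; congr (f (_ + _ * _)).
  by rewrite /incr /= [RHS]addrC addrA subrK.
rewrite (indep_decouple 1 (incr_indep t01 tn) mi bF).
have inner w : Ex Q (fun w' => F (fun i => if i == 1%N then incr t i w' else incr t i w)) =
    gavg c f (a + r * incr t 0 w).
  rewrite -E1 -gavg_affine -(@Ex_incr t 1 _ t01 u1); last exact: blip_affine.
  by congr Ex; apply/funext => w'; rewrite /F/= mulrDr addrA.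
rewrite (funext inner).
rewrite (@Ex_incr t 0 (fun x => gavg c f (a + r * x)) t01 u0); last first.
  by apply: blip_affine; exact: blip_gavg.
by rewrite gavg_affine E0.
Qed.

(** Each sign costs one [gavg_step], averaged against the Gaussian already formed; [gavg_comp]
    merges the new Gaussian into it, so variances add and only cubic errors accumulate. *)
Lemma rad_gavg C g n i x a : blip g -> even_taylor g C -> 0 <= C ->
  `|rad n i g x a - gavg (Num.sqrt (\sum_(i <= j < i + n) x j ^+ 2)) g a| <=
  C * (1 + gauss_m4 R) * \sum_(i <= j < i + n) `|x j| ^+ 3.
Proof.
move=> bg gC C0; elim: n i a => [|n IH] i a.
  rewrite /= addn0 !big_geq// sqrtr0 mulr0 /gavg.
  by under eq_fun do rewrite mul0r addr0; rewrite Ex_cst subrr normr0.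
rewrite big_ltn ?addnS ?ltnS ?leq_addr// [in leRHS]big_ltn ?ltnS ?leq_addr// -addSn /=.
set S := \sum_(_ <= _ < _) _ ^+ 2; set S3 := \sum_(_ <= _ < _) _ ^+ 3.
have S0 : 0 <= S by apply: sumr_ge0 => j _; exact: sqr_ge0.
have := IH i.+1 (a + x i); have := IH i.+1 (a - x i); rewrite -/S -/S3.
set r1 := rad _ _ _ _ _; set r2 := rad _ _ _ _ _ => h1 h2.
have -> : Num.sqrt (x i ^+ 2 + S) = Num.sqrt (Num.sqrt S ^+ 2 + `|x i| ^+ 2).
  by rewrite sqr_sqrtr// addrC real_normK// num_real.
rewrite -gavg_comp ?sqrtr_ge0//.
pose e (z : R) := (g (z + x i) + g (z - x i)) / 2 - gavg `|x i| g z.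
have be z : `|e z| <= C * (1 + gauss_m4 R) * `|x i| ^+ 3.
  have := gavg_step `|x i| z bg gC C0; rewrite normr_id.
  have -> : g (z + `|x i|) + g (z - `|x i|) = g (z + x i) + g (z - x i).
    by have [x0|x0] := ger0P (x i); rewrite // opprK addrC.
  by rewrite /e mulrAC.
have mz c : measurable_fun setT (fun z : measurableTypeR R => a + Num.sqrt S * z + c).
  by apply: measurable_funD => //; apply: measurable_funD => //; exact: measurable_funM.
have b1 : bmeas (fun z : measurableTypeR R => g (a + Num.sqrt S * z + x i)).
  exact: bmeas_blip.
have b2 : bmeas (fun z : measurableTypeR R => g (a + Num.sqrt S * z - x i)).
  exact: bmeas_blip.
have b3 : bmeas (fun z : measurableTypeR R => gavg `|x i| g (a + Num.sqrt S * z)).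
  by apply: bmeas_gavg_arg; exact: blip_gavg.
have b12 : bmeas (fun z : measurableTypeR R => 2^-1 * (g (a + Num.sqrt S * z + x i) +
    g (a + Num.sqrt S * z - x i))) by apply: bmeasZ; exact: bmeasD.
have Ee : Ex (@gauss R) (fun z : R => e (a + Num.sqrt S * z)) =
    (gavg (Num.sqrt S) g (a + x i) + gavg (Num.sqrt S) g (a - x i)) / 2 -
    gavg (Num.sqrt S) (gavg `|x i| g) a.
  rewrite /e; under eq_fun do rewrite mulrC.
  rewrite ExB// ExZ; last exact: bmeasD.
  rewrite ExD// mulrC; congr ((_ + _) / 2 - _); rewrite /gavg; congr Ex; apply/funext => z.
    by rewrite addrAC.
  by rewrite addrAC.
have : `|Ex (@gauss R) (fun z : R => e (a + Num.sqrt S * z))| <= C * (1 + gauss_m4 R) * `|x i| ^+ 3.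
  apply: Ex_norm_le => //; rewrite /e; under eq_fun do rewrite mulrC.
  exact: bmeasB.
rewrite Ee mulrDr.
move: h1 h2; rewrite !ler_norml => /andP[? ?] /andP[? ?] /andP[? ?]; lra.
Qed.

Lemma rad_dist n i f g x a (e : R) : (forall u, `|f u - g u| <= e) ->
  `|rad n i f x a - rad n i g x a| <= e.
Proof.
move=> fg; elim: n i a => [|n IH] i a /=; first exact: fg.
have := IH i.+1 (a + x i); have := IH i.+1 (a - x i).
by rewrite !ler_norml => /andP[? ?] /andP[? ?]; lra.
Qed.

Lemma sqrt_dist (u v : R) : 0 <= u -> 0 <= v ->
  `|Num.sqrt u - Num.sqrt v| <= Num.sqrt `|u - v|.
Proof.
wlog vu : u v / v <= u.
  move=> H u0 v0; case: (leP v u) => [vu|/ltW]; first exact: H.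
  by move=> uv; rewrite distrC [in leRHS]distrC H.
move=> u0 v0; rewrite ger0_norm ?subr_ge0 ?ler_sqrt// ger0_norm ?subr_ge0//.
have := sqr_sqrtr u0; have := sqr_sqrtr v0.
have uv0 : 0 <= u - v by rewrite subr_ge0.
have := sqr_sqrtr uv0.
have := sqrtr_ge0 u; have := sqrtr_ge0 v; have := sqrtr_ge0 (u - v).
move: (Num.sqrt u) (Num.sqrt v) (Num.sqrt (u - v)) => p q r r0 q0 p0 er eq ep.
have : (p - q) ^+ 2 <= r ^+ 2.
  have : q <= p by rewrite -(@ler_pXn2r _ 2)// ep eq.
  rewrite er -ep -eq; nra.
have pq : q <= p by rewrite -(@ler_pXn2r _ 2)// ep eq.
by rewrite ler_pXn2r// nnegrE subr_ge0.
Qed.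

(* Lindeberg: [f] is smoothed at scale [h], then the signs are exchanged for
   Gaussian variables one coordinate at a time. *)
Lemma rad_clt L f n i x (a h w : R) : lip L f -> blip f -> 0 < h -> 0 <= w ->
  `|rad n i f x a - gavg (Num.sqrt w) f a| <=
  4 * L * h + (1 + gauss_m4 R) * (8 * L / h ^+ 2 * \sum_(i <= j < i + n) `|x j| ^+ 3 +
     L * Num.sqrt `|\sum_(i <= j < i + n) x j ^+ 2 - w|).
Proof.
move=> fL bf h0 w0.
have L0 : 0 <= L by have := fL 1 0; rewrite subr0 normr1 mulr1; apply: le_trans.
have [g [gL gf gC]] := smooth_approx h0 fL.
have bg : blip g.
  split; first by exists (2 * L).
  have [M fM] := bf.2; exists (2 * L * h + M) => z.
  by rewrite -[g z](subrK (f z)) (le_trans (ler_normD _ _))// lerD.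
have C0 : 0 <= 8 * L / h ^+ 2 by rewrite divr_ge0 ?mulr_ge0 ?exprn_ge0 ?(ltW h0).
have h1 := rad_gavg n i x a bg gC C0.
have S0 : 0 <= \sum_(i <= j < i + n) x j ^+ 2 by apply: sumr_ge0 => j _; exact: sqr_ge0.
set S := \sum_(_ <= _ < _) _ ^+ 2 in h1 S0 *.
have h2 : `|rad n i f x a - rad n i g x a| <= 2 * L * h.
  by apply: rad_dist => u; rewrite distrC.
have h3 : `|gavg (Num.sqrt S) f a - gavg (Num.sqrt S) g a| <= 2 * L * h.
  rewrite -(Ex_cst (@gauss R) (2 * L * h)).
  by apply: Ex_dist_le; [exact: bmeas_gavg_arg..|exact: bmeas_cst|move=> z; rewrite distrC].
have h4 := gavg_dist (Num.sqrt S) (Num.sqrt w) a L0 fL bf.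
have h5 : L * `|Num.sqrt S - Num.sqrt w| * (1 + gauss_m4 R) <=
    (1 + gauss_m4 R) * (L * Num.sqrt `|S - w|).
  rewrite mulrC ler_wpM2l ?addr_ge0 ?gauss_m4_ge0// ler_wpM2l//.
  exact: sqrt_dist.
rewrite mulrDr.
move: h1; rewrite mulrAC -mulrA (mulrC _ (1 + _)) mulrCA.
move: h5 (le_trans h4 h5) h2 h3; rewrite mulrA => _.
rewrite !ler_norml => /andP[? ?] /andP[? ?] /andP[? ?] /andP[? ?]; lra.
Qed.

End brownian.

Lemma savg_dist (R : realType) n i (F G : (nat -> R) -> R) x (e : R) :
  (forall y, same_abs n i x y -> `|F y - G y| <= e) ->
  `|savg n i F x - savg n i G x| <= e.
Proof.
elim: n i x => [|n IH] i x FG /=; first by apply: FG; split.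
have := IH i.+1 x (fun y h => FG y (same_absS h)).
have := IH i.+1 (flip i x) (fun y h => FG y (same_abs_flip h)).
by rewrite !ler_norml => /andP[? ?] /andP[? ?]; lra.
Qed.

Section fubini_decouple.
Context (R : realType).

Lemma Ex_exchange d1 (T1 : measurableType d1) d2 (T2 : measurableType d2)
    (P1 : probability T1 R) (P2 : probability T2 R) (F : T1 * T2 -> R) : bmeas F ->
  Ex P1 (fun x => Ex P2 (fun y => F (x, y))) = Ex P2 (fun y => Ex P1 (fun x => F (x, y))).
Proof.
move=> bF; have iF := bmeas_integrable (product_prob P1 P2) bF.
rewrite -(Ex_product_prob P1 P2 bF).
rewrite /Ex {1}/Rintegral -(integral21_prod_meas1 iF)//.
rewrite /Rintegral; congr fine; apply: eq_integral => y _.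
rewrite /fubini_G fineK//; apply: integrable_fin_num => //.
apply: bmeas_integrable; case: bF => mF [M FM]; split; last by exists M => x.
exact: measurableT_comp mF (pair2_measurable y).
Qed.

(** The resampled coordinate becomes the outer variable, so that the inner mean is a function of its
    value alone. *)
Lemma indep_decouple_sym d (T : measurableType d) (P : probability T R)
    (X : nat -> T -> R) (n : nat) (F : seqR R -> R) :
  mutual_indep P X -> (forall i, measurable_fun [set: T] (X i)) -> bmeas F ->
  Ex P (fun w => F (fun i => X i w)) =
  Ex P (fun w' => Ex P (fun w => F (fun i => if i == n then X i w' else X i w))).
Proof.
move=> iX mX bF; rewrite (indep_decouple n iX mX bF).
have := @Ex_exchange _ _ _ _ P P (fun z : T * T => F
  (fun i => if i == n then X i z.2 else X i z.1)).
apply; case: bF => mF [M FM]; split; last by exists M => z.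
apply: (measurableT_comp mF).
apply: (measurable_toseq (X := fun i (z : T * T) => if i == n then X i z.2 else X i z.1)) => i.
case: (i == n).
  exact: measurableT_comp (mX i) (@measurable_snd _ _ T T).
exact: measurableT_comp (mX i) (@measurable_fst _ _ T T).
Qed.

End fubini_decouple.

(** * Replacement of block sums by Brownian increments *)

Section block_clt.
Context (R : realType) d' (T' : measurableType d') (Q : probability T' R).
Variables (W : T' -> C01 R).
Hypothesis bmW : standard_BM Q W.

(** Capping at 1 keeps the infinite sequence of times in the unit interval, as [incr_indep]
    requires; increments of index at least [m] vanish. *)
Definition grid m (l : nat) : R := Num.min 1 (l%:R / m%:R).

Lemma grid01 m l : 0 <= grid m l <= 1.
Proof. by rewrite /grid le_min ler01 divr_ge0//= ge_min lexx. Qed.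

Lemma gridS_le m l : grid m l <= grid m l.+1.
Proof.
rewrite /grid le_min !ge_min lexx/=; apply/orP; right.
by rewrite ler_wpM2r ?invr_ge0// ler_nat.
Qed.

Lemma gridE m l : (l <= m)%N -> (0 < m)%N -> grid m l = l%:R / m%:R.
Proof.
by move=> lm m0; rewrite /grid min_r// ler_pdivrMr ?ltr0n// mul1r ler_nat.
Qed.

Lemma gridB m l : (l < m)%N -> grid m l.+1 - grid m l = 1 / m%:R.
Proof.
move=> lm; have m0 : (0 < m)%N by exact: leq_ltn_trans lm.
by rewrite !gridE ?(ltnW lm)// -mulrBl -natr1 addrAC subrr add0r.
Qed.

Definition bsum (k : nat -> nat) (y : nat -> R) (j : nat) : R :=
  \sum_(k j <= i < k j.+1) y i.

Definition mix j (u v : nat -> R) : seqR R := fun l => if (l < j)%N then u l else v l.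

Definition sum_lip (L : R) m (psi : seqR R -> R) :=
  forall u v, `|psi u - psi v| <= L * \sum_(j < m) `|u j - v j|.

(** The bound of [rad_clt] for block [l], with target variance [1 / m], the length of a cell of the
    grid; [h] is the smoothing scale. *)
Definition block_err (L h : R) m (k : nat -> nat) (x : nat -> R) l :=
  4 * L * h + (1 + gauss_m4 R) * (8 * L / h ^+ 2 * \sum_(k l <= i < k l.+1) `|x i| ^+ 3 +
     L * Num.sqrt `|\sum_(k l <= i < k l.+1) x i ^+ 2 - 1 / m%:R|).

Lemma eq_block_err L h m k x y l : (forall i, `|y i| = `|x i|) ->
  block_err L h m k y l = block_err L h m k x l.
Proof.
move=> xy; rewrite /block_err.
rewrite (eq_bigr (fun i => `|x i| ^+ 3)) => [|i _]; last by rewrite xy.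
rewrite [in X in L * X](eq_bigr (fun i => x i ^+ 2))// => i _.
by rewrite -[LHS]real_normK ?num_real// xy real_normK// num_real.
Qed.

(** Blocks are replaced starting from the last one. Once the later blocks are Brownian increments
    and are integrated out, the current block sum enters through a bounded Lipschitz function of one
    real variable, to which [rad_clt] applies. *)
Lemma block_clt (L h : R) m k n (psi : seqR R -> R) x : (0 < m)%N -> 0 < h -> 0 <= L ->
  (forall j, k j <= k j.+1)%N -> k m = n ->
  bmeas psi -> sum_lip L m psi ->
  `|savg (n - k 0%N) (k 0%N) (fun y => psi (bsum k y)) x -
    Ex Q (fun w => psi (fun j => incr W (grid m) j w))| <=
  \sum_(j < m) block_err L h m k x j.
Proof.
move=> m0 h0 L0 kS kmn bpsi psiL.
have kn j r : (j + r = m)%N -> (k j <= n)%N.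
  elim: r j => [|r IH] j; first by rewrite addn0 => ->; rewrite kmn.
  by rewrite addnS -addSn => /IH; exact: leq_trans.
have mI := measurable_incr bmW (grid m).
have iI := incr_indep bmW (@grid01 m) (@gridS_le m).
have bmix j u : bmeas (fun w => psi (mix j u (fun j => incr W (grid m) j w))).
  case: bpsi => mp [M pM]; split; last by exists M => w.
  apply: (measurableT_comp mp).
  apply: (measurable_toseq (X := fun l w => if (l < j)%N then u l else incr W (grid m) l w)).
  by move=> l; case: (l < j)%N.
(* Induction on the number [r] of remaining blocks, with the first [j] sums frozen to the values
   [u]. *)
suff main r j u y : (j + r = m)%N ->
   `|savg (n - k j) (k j) (fun y => psi (mix j u (bsum k y))) y -
    Ex Q (fun w => psi (mix j u (fun j => incr W (grid m) j w)))| <=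
  \sum_(j <= l < j + r) block_err L h m k y l.
  have := main m 0%N (fun=> 0) x (add0n m).
  by rewrite add0n big_mkord.
elim: r j u y => [|r IH] j u y.
  rewrite addn0 => ->; rewrite kmn subnn /= big_geq//.
  have psiE v : psi (mix m u v) = psi u.
    apply/eqP; rewrite -subr_eq0 -normr_le0 (le_trans (psiL _ _))//.
    by rewrite big1 ?mulr0// => i _; rewrite /mix ltn_ord subrr normr0.
  rewrite psiE (_ : (fun _ => _) = fun=> psi u) ?Ex_cst ?subrr ?normr0//.
  by apply/funext => w; rewrite psiE.
rewrite addnS -addSn => jrm.
have jm : (j < m)%N by rewrite -jrm ltnS leq_addr.
pose upd (z : R) l := if l == j then z else u l.
have mixE z v : mix j.+1 (upd z) v = mix j u (fun l => if l == j then z else v l).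
  apply/funext => l; rewrite /mix /upd ltnS leq_eqVlt.
  by case: (eqVneq l j) => [->|//]; rewrite ltnn.
pose f z := Ex Q (fun w => psi (mix j.+1 (upd z) (fun j => incr W (grid m) j w))).
have fL : lip L f.
  move=> a b; rewrite -(Ex_cst Q (L * `|a - b|)).
  apply: Ex_dist_le; [exact: bmix..|exact: bmeas_cst|move=> w].
  rewrite (le_trans (psiL _ _))// ler_wpM2l// (bigD1 (Ordinal jm))//= big1 ?addr0.
    by rewrite /mix /upd ltnSn eqxx.
  move=> i; rewrite -val_eqE/= => ij; rewrite /mix /upd (negbTE ij).
  by case: ifP; rewrite subrr normr0.
have bf : blip f.
  split; first by exists L.
  have [_ [M pM]] := bpsi; exists M => z; apply: Ex_norm_le => // w.
have split_n : (n - k j = (k j.+1 - k j) + (n - k j.+1))%N.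
  by rewrite addnC addnBA ?subnK// (kn _ r).
have kj : (k j + (k j.+1 - k j) = k j.+1)%N by rewrite subnKC.
rewrite split_n savg_split kj.
have EB : Ex Q (fun w => psi (mix j u (fun j => incr W (grid m) j w))) =
    gavg (Num.sqrt (1 / m%:R)) f 0.
  rewrite -(gridB jm) -(Ex_incr bmW (@grid01 m) _ bf); last first.
    by rewrite -subr_gt0 gridB// divr_gt0// ltr0n.
  pose F (v : seqR R) := psi (mix j u v).
  have bF : bmeas F.
    case: bpsi => mp [M pM]; split; last by exists M => w; exact: pM.
    apply: (measurableT_comp mp).
    apply: (measurable_toseq (X := fun l (v : seqR R) => if (l < j)%N then u l else v l)).
    by move=> l; case: (l < j)%N => //; exact: measurable_coord.
  rewrite -[LHS]/(Ex Q (fun w => F (fun j => incr W (grid m) j w))).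
  rewrite (indep_decouple_sym j iI mI bF); congr Ex; apply/funext => w'.
  rewrite /f; congr Ex; apply/funext => w; rewrite mixE /F; congr (psi (mix j u _)).
  by apply/funext => l; case: eqP => // ->.
have ES : \sum_(j <= l < j.+1 + r) block_err L h m k y l =
    block_err L h m k y j + \sum_(j.+1 <= l < j.+1 + r) block_err L h m k y l.
  by rewrite big_ltn// ltn_addr.
rewrite ES EB.
set S := \sum_(j.+1 <= l < _) _.
pose g z := savg (n - k j.+1) (k j.+1) (fun y => psi (mix j u (bsum k y))) z.
have gf z : same_abs (k j.+1 - k j) (k j) y z -> `|g z - f (bsum k z j)| <= S.
  move=> [yz _]; have := IH j.+1 (upd (bsum k z j)) z jrm.
  rewrite (eq_bigr (block_err L h m k y)) => [|l _]; last exact: eq_block_err.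
  rewrite -/S; apply: le_trans; rewrite le_eqVlt; apply/orP; left; apply/eqP.
  congr `|_ - _|; apply: eq_savg => v [_ vz]; rewrite mixE; congr (psi (mix j u _)).
  apply/funext => l; case: eqP => // ->; apply: eq_big_nat => i /andP[_ ik].
  by rewrite vz// ik.
have h1 : `|savg (k j.+1 - k j) (k j) g y -
   savg (k j.+1 - k j) (k j) (fun z => f (bsum k z j)) y| <= S.
  exact: savg_dist.
have E2 : savg (k j.+1 - k j) (k j) (fun z => f (bsum k z j)) y =
   rad (k j.+1 - k j) (k j) f y 0.
  by rewrite -savg_rad; apply: eq_savg => z _; rewrite add0r kj.
have m1 : 0 <= 1 / m%:R :> R by rewrite divr_ge0.
have := rad_clt bmW (k j.+1 - k j) (k j) y 0 fL bf h0 m1; rewrite kj -/(block_err L h m k y j).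
move: h1; rewrite E2 -/g.
rewrite !ler_norml => /andP[? ?] /andP[? ?]; lra.
Qed.

End block_clt.

(** * Convergence in law on C[0,1] *)

Section separately_continuous.
Context (R : realType) d (T : measurableType d).

Lemma cvg_floor_approx (x : R) :
  (Num.floor (x * n.+1%:R))%:~R / n.+1%:R @[n --> \oo] --> x.
Proof.
apply/cvgrPdist_le => e e0; near=> n.
have n0 : 0 < n.+1%:R :> R by rewrite ltr0n.
have /andP[h1 h2] : (Num.floor (x * n.+1%:R))%:~R <=
  x * n.+1%:R < (Num.floor (x * n.+1%:R) + 1)%:~R.
  exact: floor_itv.
have en : n.+1%:R^-1 <= e.
  by apply/ltW; near: n; exact: (near_infty_natSinv_lt (PosNum e0)).
rewrite intrD in h2.
rewrite -[X in X - _](mulfK (lt0r_neq0 n0)) -mulrBl normrM normfV (gtr0_norm n0).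
rewrite (le_trans _ en)// -[leRHS]mul1r ler_wpM2r ?invr_ge0// ler_norml.
move: h1 h2; rewrite mulr1z => h1 h2; lra.
Unshelve. all: by end_near. Qed.

(** [g] is approximated by multiples of [1 / n.+1]; for such a countably valued argument a preimage
    is a countable union of measurable pieces, and continuity in the first variable gives the
    limit. *)
Lemma measurable_caratheodory (F : R -> T -> R) (g : T -> R) :
  (forall w, continuous (F ^~ w)) -> (forall a, measurable_fun [set: T] (F a)) ->
  measurable_fun [set: T] g -> measurable_fun [set: T] (fun w => F (g w) w).
Proof.
move=> cF mF mg.
pose gn n w : int := Num.floor (g w * n.+1%:R).
apply: (@measurable_fun_cvg _ _ _ setT (fun n w => F ((gn n w)%:~R / n.+1%:R) w)).
  move=> n _ B mB; rewrite setTI.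
  rewrite (_ : _ @^-1` _ = \bigcup_(z : int)
      ([set w | gn n w = z] `&` (F (z%:~R / n.+1%:R) @^-1` B))); last first.
    apply/seteqP; split => [w /= Bw|w [z _ [/= <- //]]].
    by exists (gn n w).
  apply: countable_bigcupT_measurable => [|z]; first exact: countableP.
  apply: measurableI.
    rewrite (_ : [set w | _] = (fun w => g w * n.+1%:R) @^-1` `[z%:~R, (z + 1)%:~R[).
      rewrite -[X in measurable X]setTI.
      exact: (measurable_funM mg (measurable_cst (n.+1%:R : R))).
    apply/seteqP; split => w /=; rewrite in_itv/= -floor_eq => /eqP//.
  by rewrite -[X in measurable X]setTI; exact: mF.
move=> w _; apply: (@continuous_cvg _ _ _ _ _ _ (F ^~ w)); first exact: cF.
exact: cvg_floor_approx.
Qed.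

(** [C01] carries no sigma-algebra here, so a continuous functional of a polygon is shown to be
    measurable by inserting its finitely many random increments one at a time. *)
Lemma measurable_coordwise m (F : (nat -> R) -> R) (g : nat -> T -> R) :
  (forall u v, (forall i, (i < m)%N -> u i = v i) -> F u = F v) ->
  (forall k (u : nat -> R), continuous (fun z : R => F (fun i => if i == k then z else u i))) ->
  (forall i, measurable_fun [set: T] (g i)) ->
  measurable_fun [set: T] (fun w => F (fun i => g i w)).
Proof.
move=> Fm cF mg.
suff main k a : measurable_fun [set: T] (fun w => F (fun i => if (i < k)%N then g i w else a i)).
  rewrite (_ : (fun w => _) = fun w => F (fun i => if (i < m)%N then g i w else 0)).
    exact: main.
  by apply/funext => w; apply: Fm => i ->.
elim: k a => [|k IH] a.
  by rewrite (_ : (fun w => _) = fun=> F a).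
pose G z w := F (fun i => if i == k then z else if (i < k)%N then g i w else a i).
have := @measurable_caratheodory G (g k) _ _ (mg k).
rewrite (_ : (fun w => G (g k w) w) = fun w => F (fun i => if (i < k.+1)%N then g i w else a i)).
  apply => [w|z]; first exact: cF.
  have := IH (fun i => if i == k then z else a i).
  congr measurable_fun; apply/funext => w; congr F; apply/funext => i.
  by case: eqP => // ->; rewrite ltnn.
apply/funext => w; congr F; apply/funext => i; rewrite ltnS [in RHS]leq_eqVlt.
by case: eqP => [->|].
Qed.

End separately_continuous.

Lemma near_infty_invn_lt (R : realType) (e : R) : 0 < e -> \forall n \near \oo, n%:R^-1 < e.
Proof.
move=> e0; near=> n.
have n0 : 0 < n%:R :> R by rewrite ltr0n; near: n; exact: nbhs_infty_gt.
rewrite invf_plt ?posrE//; near: n; exact: nbhs_infty_gtr.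
Unshelve. all: by end_near. Qed.

(** * Polygonal paths and continuous functionals *)

Section path_space.
Context (R : realType).
Local Notation C01 := (C01 R).
Local Notation I01 := (I01 R).
Implicit Types (f g : C01) (Phi : C01 -> R).

Lemma C01_continuousP Phi : continuous Phi <-> forall f (e : R), 0 < e ->
  exists2 r : R, 0 < r & forall g, (forall t, `|f t - g t| < r) -> `|Phi f - Phi g| < e.
Proof.
split=> [cP f e e0|H f].
  have /cvgrPdist_lt /(_ e e0) := cP f.
  by rewrite near_simpl => /C01_nbhsP.
apply/(@cvgrPdist_lt _ _ _ (nbhs f) (nbhs_filter f)) => e e0.
by apply/C01_nbhsP; exact: H.
Qed.

(** Avoids equality of bundled paths: pointwise equal paths lie in each other's neighbourhoods, so
    no continuous functional separates them. *)
Lemma C01_ext Phi f g : continuous Phi -> (forall t, f t = g t) -> Phi f = Phi g.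
Proof.
move=> /C01_continuousP cP fg; apply/eqP; rewrite -subr_eq0 -normr_le0.
apply/ler_addgt0Pl => e e0; have [r r0 h] := cP f e e0.
by rewrite addr0 ltW// h// => t; rewrite fg subrr normr0.
Qed.

Lemma continuous_I01_val : continuous (@I01_val R).
Proof. exact: initial_continuous. Qed.

Lemma continuous_on_I01 (F : R -> R) : continuous F ->
  continuous (fun t : I01 => F (I01_val t)).
Proof.
move=> cF t; apply: (@continuous_comp _ _ _ (@I01_val R) F); last exact: cF.
exact: continuous_I01_val.
Qed.

Definition mk_path (F : R -> R) (cF : continuous F) : C01 :=
  (mkcts (continuous_on_I01 cF) : continuousType I01 R).

Definition clamp01 (x : R) := Num.max 0 (Num.min 1 x).

Lemma clamp01E x : clamp01 x = if x <= 0 then 0 else if 1 <= x then 1 else x.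
Proof.
rewrite /clamp01; case: (leP x 0) => x0.
  by rewrite min_r ?max_l//; lra.
by case: (leP 1 x) => x1; rewrite ?min_l// ?(min_r (ltW x1)) max_r// ltW.
Qed.

Lemma clamp01_itv x : 0 <= clamp01 x <= 1.
Proof. by rewrite clamp01E; case: (leP x 0) => x0; [|case: (leP 1 x) => x1]; lra. Qed.

Lemma clamp01_lip : lip 1 clamp01.
Proof.
move=> x y; rewrite mul1r.
wlog xy : x y / x <= y.
  move=> H; case: (leP x y) => [xy|/ltW xy]; first exact: H.
  by rewrite distrC [leRHS]distrC; exact: H.
rewrite distrC [leRHS]distrC [leRHS]ger0_norm ?subr_ge0// ler_norml !clamp01E.
by case: (leP x 0) => x0; case: (leP y 0) => y0; try (case: (leP 1 x) => x1);
  try (case: (leP 1 y) => y1); lra.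
Qed.

Lemma continuous_toI : continuous (@toI R).
Proof.
apply: (@continuous_comp_initial _ _ _ set_val).
exact: lip_continuous clamp01_lip.
Qed.

(** Heine's theorem, from the near-covering form of compactness applied to the extension of [f] by
    clamping. *)
Lemma C01_unif f (e : R) : 0 < e -> exists2 r : R, 0 < r &
  forall s t : I01, `|I01_val s - I01_val t| < r -> `|f s - f t| < e.
Proof.
move=> e0.
pose F (x : R) := f (toI x).
have cF : continuous F.
  move=> x; apply: (@continuous_comp _ _ _ (@toI R) (f : I01 -> R)).
    exact: continuous_toI.
  exact: (@cts_fun _ _ (f : continuousType I01 R)).
have := @segment_compact R 0 1 => /compact_near_coveringP.
move=> /(_ _ (0:R)^'+ (fun r x => forall y, `|x - y| < r -> `|F x - F y| < e)) [].
  move=> x _.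
  have /cvgrPdist_lt /(_ (e / 2) ltac:(lra)) := cF x.
  move=> [r /= r0 rF].
  exists (ball x (r / 2), [set z : R | z < r / 2]) => /=.
    split; first by apply: nbhsx_ballx; lra.
    by apply: nbhs_right_lt; lra.
  move=> [x' r'] /= [xx' rr'] y x'y.
  have h1 : `|F x - F x'| < e / 2.
    apply: rF => /=; rewrite /ball/= in xx'; apply: (lt_trans xx'); lra.
  have h2 : `|F x - F y| < e / 2.
    apply: rF => /=; rewrite /ball/= in xx'.
    rewrite -(subrK x' x) -addrA (le_lt_trans (ler_normD _ _))//; lra.
  rewrite -(subrK (F x) (F x')) -addrA (le_lt_trans (ler_normD _ _))// distrC; lra.
move=> r /= r0 rF.
exists (r / 2); first lra.
move=> s t st.
have r2 : 0 < r / 2 by lra.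
have br : ball_ Num.norm 0 r (r / 2).
  by rewrite /= sub0r normrN gtr0_norm//; lra.
have Is : `[0, 1]%classic (I01_val s) by rewrite /= in_itv /= I01_itv.
by have := rF _ br r2 _ Is (I01_val t) st; rewrite /F !toIK.
Qed.

Lemma continuous_clamp_sum a m (u : nat -> R) :
  continuous (fun x : R => a + \sum_(j < m) clamp01 (m%:R * x - j%:R) * u j).
Proof.
apply: (@lip_continuous _ (\sum_(j < m) m%:R * `|u j|)) => x y.
rewrite opprD addrACA subrr add0r -sumrB (le_trans (ler_norm_sum _ _ _))// mulr_suml.
apply: ler_sum => j _; rewrite -mulrBl normrM mulrAC ler_wpM2r//.
rewrite (le_trans (clamp01_lip _ _))// mul1r.
rewrite (_ : _ - _ = m%:R * (x - y)); last by ring.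
by rewrite normrM normr_nat.
Qed.

(** The polygon starting at [a] with increment [u j] over the cell from [j / m] to [j.+1 / m]. The
    clamped form is that of [selfnorm_funE], so the process and the discretized Brownian motion are
    values of one map. *)
Definition interp a m (u : nat -> R) : C01 := mk_path (@continuous_clamp_sum a m u).

Lemma interpE a m u t :
  interp a m u t = a + \sum_(j < m) clamp01 (m%:R * I01_val t - j%:R) * u j.
Proof. by []. Qed.

Lemma interp_dist a b m (u v : nat -> R) t :
  `|interp a m u t - interp b m v t| <= `|a - b| + \sum_(j < m) `|u j - v j|.
Proof.
rewrite !interpE opprD addrACA (le_trans (ler_normD _ _))// lerD2l -sumrB.
rewrite (le_trans (ler_norm_sum _ _ _))//; apply: ler_sum => j _.
have /andP[c0 c1] := clamp01_itv (m%:R * I01_val t - j%:R).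
by rewrite -mulrBr normrM (ger0_norm c0) ler_piMl.
Qed.

Lemma clamp_sum n (x : nat -> R) (s : R) k : (k < n)%N -> k%:R <= s <= k.+1%:R ->
  \sum_(i < n) clamp01 (s - i%:R) * x i = \sum_(i < k) x i + (s - k%:R) * x k.
Proof.
move=> kn /andP[ks sk].
rewrite -(big_mkord xpredT (fun i => clamp01 (s - i%:R) * x i)).
rewrite (@big_cat_nat _ _ _ k)//= ?(ltnW kn)// [X in _ + X](big_ltn kn) addrA.
have -> : \sum_(k.+1 <= i < n) clamp01 (s - i%:R) * x i = 0.
  rewrite big_nat_cond big1// => i /andP[/andP[ki _] _].
  by rewrite clamp01E ifT ?mul0r// subr_le0 (le_trans sk)// ler_nat.
rewrite addr0.
rewrite big_mkord; congr (_ + _ * _).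
  apply: eq_bigr => i _; rewrite clamp01E.
  have h : 1 <= s - i%:R.
    by rewrite lerBrDr addrC natr1 (le_trans _ ks)// ler_nat.
  by rewrite h ifF ?mul1r//; apply/negP; lra.
rewrite clamp01E; case: (leP _ 0) => h; first lra.
by case: (leP 1 _) => h1 //; move: sk; rewrite -natr1; lra.
Qed.

Lemma cell_exists m (t : I01) : (0 < m)%N ->
  exists k, (k < m)%N && (k%:R <= m%:R * I01_val t <= k.+1%:R).
Proof.
move=> m0; have /andP[t0 t1] := I01_itv t.
have mt0 : 0 <= m%:R * I01_val t by rewrite mulr_ge0.
have /andP[h1 h2] := truncn_itv mt0.
have mtm : m%:R * I01_val t <= m%:R by rewrite ler_piMr.
have [km|mk] := ltnP (Num.truncn (m%:R * I01_val t)) m.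
  by exists (Num.truncn (m%:R * I01_val t)); rewrite km h1 ltW.
exists m.-1; rewrite prednK// leqnn mtm andbT/= (le_trans _ h1)// ler_nat.
by rewrite (leq_trans _ mk)// leq_pred.
Qed.

Definition pathincr m f (j : nat) := f (toI (grid R m j.+1)) - f (toI (grid R m j)).

Lemma interp_pathincr_cvg Phi f : continuous Phi ->
  Phi (interp (f (toI 0)) m (pathincr m f)) @[m --> \oo] --> Phi f.
Proof.
move=> /C01_continuousP cP; apply/cvgrPdist_lt => e e0.
have [r r0 rP] := cP f e e0.
have [s s0 sf] := C01_unif f (ltac:(lra) : 0 < r / 2).
near=> m; apply: rP => t.
have m0 : (0 < m)%N by near: m; exact: nbhs_infty_gt.
have m0' : 0 < m%:R :> R by rewrite ltr0n.
have ms : m%:R^-1 < s.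
  by near: m; exact: near_infty_invn_lt.
have [k /andP[km /andP[kt tk]]] := cell_exists t m0.
have gE j : (j <= m)%N -> I01_val (toI (grid R m j)) = j%:R / m%:R.
  by move=> jm; rewrite toIE ?grid01// gridE.
rewrite interpE (@clamp_sum m _ _ k km) ?kt//.
have tele j : (j <= m)%N -> f (toI 0) + \sum_(i < j) pathincr m f i = f (toI (grid R m j)).
  elim: j => [_|j IH jm]; first by rewrite big_ord0 addr0 /grid mul0r min_r.
  by rewrite big_ord_recr/= addrA IH ?(ltnW jm)// /pathincr addrC subrK.
rewrite addrA (tele k (ltnW km)).
have c01 : 0 <= m%:R * I01_val t - k%:R <= 1 by rewrite -natr1 in tk; lra.
have d1 : `|f t - f (toI (grid R m k))| < r / 2.
  apply: sf; rewrite gE ?(ltnW km)//.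
  rewrite (_ : _ - _ = (m%:R * I01_val t - k%:R) / m%:R); last first.
    by field; rewrite gt_eqF.
  rewrite normrM normfV (gtr0_norm m0') (le_lt_trans _ ms)// ger0_norm; last by lra.
  by rewrite ler_piMl ?invr_ge0//; lra.
have d2 : `|pathincr m f k| < r / 2.
  apply: sf; rewrite !gE ?(ltnW km)// -mulrBl -natr1 addrAC subrr add0r mul1r.
  by rewrite normfV (gtr0_norm m0').
rewrite opprD addrA (le_lt_trans (ler_normB _ _))// normrM (ger0_norm (proj1 (andP c01))).
have := normr_ge0 (pathincr m f k).
move: d1 d2 c01; move: (`|pathincr m f k|) (`|f t - _|) (m%:R * _ - _) => p q c.
move=> ? ? /andP[? ?] ?; nra.
Unshelve. all: by end_near. Qed.

Lemma measurable_interp d (T : measurableType d) Phi m (a : T -> R) (u : nat -> T -> R) :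
  continuous Phi -> measurable_fun [set: T] a -> (forall j, measurable_fun [set: T] (u j)) ->
  measurable_fun [set: T] (fun w => Phi (interp (a w) m (fun j => u j w))).
Proof.
move=> cP ma mu.
pose F (v : nat -> R) := Phi (interp (v 0%N) m (fun j => v j.+1)).
pose g j w := if j is j'.+1 then u j' w else a w.
have := @measurable_coordwise R _ T m.+1 F g; apply.
- move=> v v' vv'; apply: C01_ext => // t; rewrite !interpE vv'//; congr (_ + _).
  by apply: eq_bigr => i _; rewrite vv'// ltnS.
- move=> k v z; apply/cvgrPdist_lt => e e0.
  move/C01_continuousP : cP => cP.
  have [r r0 rP] := cP (interp (if 0%N == k then z else v 0%N) m
     (fun j => if j.+1 == k then z else v j.+1)) e e0.
  near=> z'; apply: rP => t; rewrite (le_lt_trans (interp_dist _ _ _ _ _ _))//.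
  have zz' : `|z - z'| < r by near: z'; exact: (@cvgr_dist_lt _ _ _ _ _ _ z).
  case: k => [|k] /=.
    by rewrite big1 ?addr0// => i _; rewrite subrr normr0.
  rewrite subrr normr0 add0r; have [km|mk] := ltnP k m.
    rewrite (bigD1 (Ordinal km))//= eqxx big1 ?addr0// => i.
    by rewrite -val_eqE/= => /negbTE; rewrite eqSS => ->; rewrite subrr normr0.
  rewrite big1// => i _; rewrite eqSS ltn_eqF ?subrr ?normr0//.
  exact: leq_trans (ltn_ord i) mk.
- by case=> [|j]; [exact: ma|exact: mu].
Unshelve. all: by end_near. Qed.

Definition Phi_interp Phi m (u : seqR R) := Phi (interp 0 m u).

Lemma measurable_Phi_interp Phi m : continuous Phi ->
  measurable_fun [set: seqR R] (Phi_interp Phi m).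
Proof.
move=> cP; apply: (@measurable_interp _ (seqR R) Phi m (fun=> 0) (fun j x => x j)) => //.
exact: measurable_coord.
Qed.

(** Lipschitz for the uniform distance; a common bound [e] replaces the supremum of the
    difference. *)
Definition lipC (L : R) Phi := forall f g (e : R),
  (forall t, `|f t - g t| <= e) -> `|Phi f - Phi g| <= L * e.

Lemma lipC_continuous L Phi : 0 <= L -> lipC L Phi -> continuous Phi.
Proof.
move=> L0 PL; apply/C01_continuousP => f e e0.
exists (e / (L + 1)); first by rewrite divr_gt0//; lra.
move=> g fg; apply: (@le_lt_trans _ _ (L * (e / (L + 1)))).
  by apply: PL => t; exact: ltW.
by rewrite mulrCA gtr_pMr// ltr_pdivrMr//; lra.
Qed.

Lemma lipC_interp L Phi m : 0 <= L -> lipC L Phi -> sum_lip L m (Phi_interp Phi m).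
Proof.
move=> L0 PL u v; apply: PL => t.
by have := interp_dist 0 0 m u v t; rewrite subrr normr0 add0r.
Qed.

End path_space.

(** * Reduction of convergence in law to Lipschitz functionals *)

Section lipschitz_portmanteau.
Context (R : realType).
Local Notation C01 := (C01 R).
Implicit Types (f g : C01) (Phi : C01 -> R).

Let env_set (k : R) Phi f : set R := [set x | exists g (e : R),
  [/\ 0 <= e, forall t, `|f t - g t| <= e & x = Phi g + k * e]].

(* The largest [k]-Lipschitz functional below [Phi]. *)
Definition envelope (k : R) Phi f : R := inf (env_set k Phi f).

Let env_nonempty k Phi f : env_set k Phi f (Phi f).
Proof. by exists f, 0; split => // [t|]; rewrite ?subrr ?normr0 ?mulr0 ?addr0. Qed.

Let env_lb k Phi f (M : R) : 0 <= k -> (forall g, `|Phi g| <= M) -> lbound (env_set k Phi f) (- M).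
Proof.
move=> k0 PM _ [g [e [e0 _ ->]]]; have := PM g; rewrite ler_norml => /andP[h _].
by rewrite (le_trans h)// lerDl mulr_ge0.
Qed.

Lemma envelope_le k Phi f (M : R) : 0 <= k -> (forall g, `|Phi g| <= M) ->
  envelope k Phi f <= Phi f.
Proof. by move=> k0 PM; apply: ge_inf; [exists (- M); exact: env_lb|exact: env_nonempty]. Qed.

Lemma envelope_bounded k Phi f (M : R) : 0 <= k -> (forall g, `|Phi g| <= M) ->
  `|envelope k Phi f| <= M.
Proof.
move=> k0 PM; rewrite ler_norml; apply/andP; split; last first.
  by rewrite (le_trans (envelope_le f k0 PM))// (le_trans (ler_norm _)).
by apply: lb_le_inf; [exists (Phi f); exact: env_nonempty|exact: env_lb].
Qed.

Lemma envelope_lip k Phi (M : R) : 0 <= k -> (forall g, `|Phi g| <= M) -> lipC k (envelope k Phi).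
Proof.
move=> k0 PM.
have H f g (e : R) : (forall t, `|f t - g t| <= e) -> envelope k Phi g <= envelope k Phi f + k * e.
  move=> fg; rewrite -lerBlDr; apply: lb_le_inf; first by exists (Phi f); exact: env_nonempty.
  have e0 : 0 <= e by rewrite (le_trans _ (fg (toI 0))).
  move=> _ [g' [e' [e'0 fg' ->]]]; rewrite lerBlDr -addrA -mulrDr.
  apply: ge_inf; first by exists (- M); exact: env_lb.
  exists g', (e' + e); split => [|t|//]; first exact: addr_ge0.
  rewrite -(subrK (f t) (g t)) -addrA (le_trans (ler_normD _ _))//.
  by rewrite [leRHS]addrC lerD// distrC.
move=> f g e fg; rewrite ler_norml; apply/andP; split.
  by rewrite lerBrDr addrC lerBlDr; exact: H fg.
rewrite lerBlDr addrC; apply: H => t; rewrite distrC; exact: fg.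
Qed.

Lemma envelope_cvg Phi f (M : R) : continuous Phi -> (forall g, `|Phi g| <= M) ->
  envelope k%:R Phi f @[k --> \oo] --> Phi f.
Proof.
move=> /C01_continuousP cP PM; apply/cvgrPdist_le => e e0.
have [r r0 rP] := cP f e e0.
near=> k.
have k0 : 0 <= k%:R :> R by [].
rewrite ger0_norm ?subr_ge0 ?(envelope_le f k0 PM)// lerBlDr addrC -lerBlDr.
apply: lb_le_inf; first by exists (Phi f); exact: env_nonempty.
(* Paths closer than [r] lose at most [e] by continuity; for the others the penalty [k%:R * e'] is
   at least [2 * M], which covers the oscillation of [Phi]. *)
move=> _ [g [e' [e'0 fg ->]]]; have [e'r|re'] := ltP e' r.
  have /rP : forall t, `|f t - g t| < r by move=> t; exact: le_lt_trans (fg t) e'r.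
  rewrite ltr_norml => /andP[_ h]; have : 0 <= k%:R * e' by rewrite mulr_ge0.
  lra.
have := PM f; have := PM g; rewrite !ler_norml => /andP[? _] /andP[_ ?].
have : 2 * M <= k%:R * r.
  rewrite -ler_pdivrMr//; near: k; exact: nbhs_infty_ger.
have : k%:R * r <= k%:R * e' by rewrite ler_wpM2l.
lra.
Unshelve. all: by end_near. Qed.

(** Lipschitz minorants approximate a bounded continuous functional pointwise from below, which
    bounds its means from below asymptotically; [Phi] and [- Phi] together give both sides. *)
Lemma cvg_in_law_lipC d (T : measurableType d) (P : probability T R) (Z : nat -> T -> C01)
    d' (T' : measurableType d') (Q : probability T' R) (W : T' -> C01) :
  (forall Phi n, continuous Phi -> measurable_fun [set: T] (Phi \o Z n)) ->
  (forall Phi, continuous Phi -> measurable_fun [set: T'] (Phi \o W)) ->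
  (forall L Phi, 0 <= L -> lipC L Phi -> (exists M : R, forall f, `|Phi f| <= M) ->
    Ex P (Phi \o Z n) @[n --> \oo] --> Ex Q (Phi \o W)) ->
  cvg_in_law P Z Q W.
Proof.
move=> mZ mW H Phi cP [M PM].
have bZ (F : C01 -> R) n : continuous F -> (exists M : R, forall f, `|F f| <= M) ->
  bmeas (F \o Z n).
  by move=> cF [N FN]; split; [exact: mZ|exists N => w; exact: FN].
have bW (F : C01 -> R) : continuous F -> (exists M : R, forall f, `|F f| <= M) -> bmeas (F \o W).
  by move=> cF [N FN]; split; [exact: mW|exists N => w; exact: FN].
have lower (F : C01 -> R) (e : R) : continuous F -> (forall f, `|F f| <= M) -> 0 < e ->
    \forall n \near \oo, Ex Q (F \o W) - e <= Ex P (F \o Z n).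
  move=> cF FM e0.
  have kc k : continuous (envelope k%:R F).
    exact: lipC_continuous (envelope_lip _ FM).
  have kM k : exists M : R, forall f, `|envelope k%:R F f| <= M.
    by exists M => f; exact: envelope_bounded.
  have := @Ex_cvg _ _ _ Q (fun k => envelope k%:R F \o W) (F \o W) M.
  move=> /(_ (fun k => mW _ (kc k)) _ (mW _ cF) (fun w => envelope_cvg (f := W w) cF FM)).
  move=> /(_ (fun k w => envelope_bounded (W w) (ler0n _ k) FM)) h.
  have [k hk] : exists k, Ex Q (F \o W) - e / 2 <= Ex Q (envelope k%:R F \o W).
    have /cvgrPdist_lt /(_ (e / 2) ltac:(lra)) [N _ HN] := h.
    exists N; have := HN N (leqnn N); rewrite ltr_norml => /andP[_]; lra.
  have := H k%:R _ (ler0n _ k) (envelope_lip (ler0n _ k) FM) (kM k).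
  move=> /cvgrPdist_lt /(_ (e / 2) ltac:(lra)); apply: filterS => n.
  rewrite ltr_norml => /andP[_ h1].
  have h2 : Ex P (envelope k%:R F \o Z n) <= Ex P (F \o Z n).
    apply: Ex_le; [exact: bZ|by apply: bZ => //; exists M|].
    by move=> w; exact: (envelope_le _ (ler0n _ k) FM).
  lra.
have cNP : continuous (fun f => - Phi f).
  apply/C01_continuousP => f e e0.
  have [r r0 h] := (C01_continuousP _).1 cP f e e0.
  by exists r => // g fg; rewrite -opprD normrN h.
have NPM f : `|- Phi f| <= M by rewrite normrN.
have b1 n := bZ _ n cP (ex_intro _ M PM); have b2 := bW _ cP (ex_intro _ M PM).
rewrite (expectation_Ex Q b2).
under eq_fun do rewrite (expectation_Ex P (b1 _)).
apply: cvg_EFin; first exact: nearW.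
apply/cvgrPdist_le => e e0.
have h1 := lower _ _ cP PM e0; have h2 := lower _ _ cNP NPM e0.
near=> n; have : Ex Q (Phi \o W) - e <= Ex P (Phi \o Z n) by near: n.
have : Ex Q ((fun f => - Phi f) \o W) - e <= Ex P ((fun f => - Phi f) \o Z n) by near: n.
have -> : Ex Q ((fun f => - Phi f) \o W) = - Ex Q (Phi \o W) by exact: (ExN Q b2).
have -> : Ex P ((fun f => - Phi f) \o Z n) = - Ex P (Phi \o Z n) by exact: (ExN P (b1 n)).
by rewrite ler_norml /= => *; apply/andP; split; lra.
Unshelve. all: by end_near. Qed.

End lipschitz_portmanteau.

Section path_measurability.
Context (R : realType).
Implicit Types (Phi : C01 R -> R).

Lemma measurable_inv d (T : measurableType d) (h : T -> R) :
  measurable_fun [set: T] h -> measurable_fun [set: T] (fun w => (h w)^-1).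
Proof.
move=> mh; rewrite (_ : (fun w => _) = fun w => h w * ((h w) ^+ 2) `^ (-1)).
  apply: measurable_funM => //; apply: (measurableT_comp (measurable_powR (-1))).
  exact: measurable_funX.
apply/funext => w; rewrite powR_inv1 ?sqr_ge0// expr2 invfM mulrA.
by have [->|h0] := eqVneq (h w) 0; rewrite ?invr0 ?mulr0// divff// mul1r.
Qed.

Lemma measurable_Vnorm d (T : measurableType d) (p : R) n (x : nat -> T -> R) :
  (forall i, measurable_fun [set: T] (x i)) ->
  measurable_fun [set: T] (fun w => Vnorm p n (fun i => x i w)).
Proof.
move=> mx; apply: (measurableT_comp (measurable_powR p^-1)).
apply: (@measurable_sum _ T _ setT _ (index_enum 'I_n) (fun i w => `|x i w| `^ p)) => i.
by apply: (measurableT_comp (measurable_powR p)); exact: measurableT_comp.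
Qed.

Lemma selfnorm_interp Phi (p : R) n (x : nat -> R) : continuous Phi ->
  Phi (selfnorm_path p n x) = Phi (interp 0 n (fun i => x i / Vnorm p n x)).
Proof.
move=> cP; apply: C01_ext => // t; rewrite interpE add0r.
rewrite -[LHS]/(selfnorm_fun p n x t) selfnorm_funE mulr_sumr.
by apply: eq_bigr => i _; rewrite mulrC -mulrA.
Qed.

Lemma measurable_selfnorm d (T : measurableType d) (P : probability T R) p
    (X : nat -> {RV P >-> R}) Phi n : continuous Phi ->
  measurable_fun [set: T] (Phi \o selfnorm_process p X n).
Proof.
move=> cP; rewrite (_ : _ \o _ = fun w => Phi (interp 0 n
    (fun i => X i w / Vnorm p n (fun i => X i w)))).
  apply: (@measurable_interp _ _ T Phi n (fun=> 0)
     (fun i w => X i w / Vnorm p n (fun i => X i w))) => // j.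
  apply: measurable_funM => //; apply: measurable_inv.
  exact: (@measurable_Vnorm _ T p n (fun i => X i)).
by apply/funext => w; exact: selfnorm_interp.
Qed.

Context d' (T' : measurableType d') (Q : probability T' R) (W : T' -> C01 R).
Hypothesis bmW : standard_BM Q W.

(** Only the coordinates of [W] are assumed measurable; the composite is a pointwise limit of
    functionals of finitely many of them. *)
Lemma measurable_BM Phi : continuous Phi -> measurable_fun [set: T'] (Phi \o W).
Proof.
move=> cP; apply: (@measurable_fun_cvg _ _ _ setT
  (fun m w => Phi (interp (W w (toI 0)) m (fun j => incr W (grid R m) j w)))).
  move=> m; apply: (@measurable_interp _ _ T' Phi m (fun w => W w (toI 0))
    (fun j w => incr W (grid R m) j w)) => //; last exact: (measurable_incr bmW).
  by case: bmW => + _ _ _; apply.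
by move=> w _; have := interp_pathincr_cvg (f := W w) cP.
Qed.

(** [Phi_interp] starts polygons at 0 while [W] starts there only almost surely, hence the passage
    through [Ex_ae]. *)
Lemma Ex_BM_approx Phi : continuous Phi -> (exists M : R, forall f, `|Phi f| <= M) ->
  Ex Q (fun w => Phi_interp Phi m (fun j => incr W (grid R m) j w)) @[m --> \oo]
  --> Ex Q (Phi \o W).
Proof.
move=> cP [M PM].
have mW0 : measurable_fun [set: T'] (fun w => W w (toI 0)) by case: bmW.
have m1 m : measurable_fun [set: T']
    (fun w => Phi (interp (W w (toI 0)) m (fun j => incr W (grid R m) j w))).
  apply: (@measurable_interp _ _ T' Phi m (fun w => W w (toI 0))
    (fun j w => incr W (grid R m) j w)) => //; exact: (measurable_incr bmW).
have m2 m : measurable_fun [set: T']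
    (fun w => Phi_interp Phi m (fun j => incr W (grid R m) j w)).
  apply: (@measurable_interp _ _ T' Phi m (fun=> 0)
    (fun j w => incr W (grid R m) j w)) => //; exact: (measurable_incr bmW).
rewrite (_ : (fun m => _) =
  (fun m => Ex Q (fun w => Phi (interp (W w (toI 0)) m (fun j => incr W (grid R m) j w))))).
  apply: (Ex_cvg (M := M)) => //; first exact: measurable_BM.
  by move=> w; exact: (interp_pathincr_cvg (f := W w) cP).
apply/funext => m; apply: Ex_ae.
- by split => //; exists M => w; exact: PM.
- by split => //; exists M => w; exact: PM.
case: bmW => _ W0 _ _; have := W0 (toI 0); rewrite toIE ?lexx ?ler01// => /(_ erefl).
by apply: filterS => w Ww0; rewrite /Phi_interp Ww0.
Qed.

End path_measurability.

(** * Self-normalized weights *)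

Lemma measurable_bigmax (R : realType) d (T : measurableType d) I (s : seq I)
    (h : I -> T -> R) : (forall i, measurable_fun [set: T] (h i)) ->
  measurable_fun [set: T] (fun x => \big[Num.max/0]_(i <- s) h i x).
Proof.
move=> mh; elim: s => [|i s IH].
  by rewrite (_ : (fun x => _) = fun=> 0) //; apply/funext => x; rewrite big_nil.
rewrite (_ : (fun x => _) = fun x => Num.max (h i x) (\big[Num.max/0]_(i <- s) h i x)).
  exact: measurable_maxr.
by apply/funext => x; rewrite big_cons.
Qed.

Section self_normalized_weights.
Context (R : realType).
Implicit Types (p : R) (n : nat) (x y : seqR R).

Definition weight p n (x : nat -> R) : seqR R := fun i => x i / Vnorm p n x.

Definition max_weight p n (x : nat -> R) : R := \big[Num.max/0]_(i < n) `|weight p n x i|.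

Lemma Vnorm_ge0 p n (x : nat -> R) : 0 <= Vnorm p n x.
Proof. exact: powR_ge0. Qed.

Lemma Vnorm2E n (x : nat -> R) : Vnorm 2 n x = Num.sqrt (\sum_(i < n) x i ^+ 2).
Proof.
rewrite /Vnorm -powR12_sqrt ?sumr_ge0//; last by move=> i _; exact: sqr_ge0.
rewrite (_ : 2^-1 = 1 / 2) ?mul1r//; congr (_ `^ _).
by apply: eq_bigr => i _; rewrite powR_mulrn// real_normK// num_real.
Qed.

Lemma eq_Vnorm p n (x y : nat -> R) : (forall i, `|y i| = `|x i|) -> Vnorm p n y = Vnorm p n x.
Proof. by move=> xy; rewrite /Vnorm; congr (_ `^ _); apply: eq_bigr => i _; rewrite xy. Qed.

Lemma Vnorm_swap p n (x : nat -> R) a b : (a < n)%N -> (b < n)%N ->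
  Vnorm p n (swap a b x) = Vnorm p n x.
Proof.
move=> an bn; rewrite /Vnorm; congr (_ `^ _).
pose s (i : 'I_n) := if i == Ordinal an then Ordinal bn
  else if i == Ordinal bn then Ordinal an else i.
have sE i : s i = swapn a b i :> nat.
  by rewrite /s /swapn -!val_eqE/=; case: eqP => // _; case: eqP.
have sK : involutive s by move=> i; apply: ord_inj; rewrite !sE swapnK.
rewrite [RHS](reindex_inj (inv_inj sK))/=.
by apply: eq_bigr => i _; rewrite sE.
Qed.

Lemma weight_swap p n x a b i : (a < n)%N -> (b < n)%N ->
  weight p n (swap a b x) i = weight p n x (swapn a b i).
Proof. by move=> an bn; rewrite /weight Vnorm_swap. Qed.

Lemma measurable_V p n : measurable_fun [set: seqR R] (fun x : seqR R => Vnorm p n x).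
Proof.
by apply: (@measurable_Vnorm _ _ (seqR R) p n (fun i x => x i)) => i; exact: measurable_coord.
Qed.

Lemma measurable_weight p n i : measurable_fun [set: seqR R] (fun x : seqR R => weight p n x i).
Proof.
apply: measurable_funM; first exact: measurable_coord.
by apply: measurable_inv; exact: measurable_V.
Qed.

Lemma measurable_weightseq p n : measurable_fun [set: seqR R] (weight p n : seqR R -> seqR R).
Proof. by apply: (measurable_toseq (X := fun i x => weight p n x i)) => i; exact: measurable_weight. Qed.

Lemma Vnorm_gt0 p n (x : nat -> R) i : (i < n)%N -> x i != 0 -> 0 < Vnorm p n x.
Proof.
move=> iN xi; apply: powR_gt0; rewrite (bigD1 (Ordinal iN))//=.
by rewrite ltr_pwDl ?powR_gt0 ?normr_gt0// sumr_ge0// => j _; exact: powR_ge0.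
Qed.

Lemma le_Vnorm p n (x : nat -> R) i : 0 < p -> (i < n)%N -> `|x i| <= Vnorm p n x.
Proof.
move=> p0 iN; have {1}-> : `|x i| = (`|x i| `^ p) `^ p^-1.
  by rewrite -powRrM divff ?gt_eqF// powRr1.
rewrite /Vnorm; apply: ge0_ler_powR; rewrite ?nnegrE ?invr_ge0 ?powR_ge0 ?(ltW p0)//.
  by rewrite sumr_ge0// => j _; exact: powR_ge0.
rewrite (bigD1 (Ordinal iN))//= lerDl sumr_ge0// => j _; exact: powR_ge0.
Qed.

Lemma weight_le1 p n (x : nat -> R) i : 0 < p -> (i < n)%N -> `|weight p n x i| <= 1.
Proof.
move=> p0 iN; rewrite /weight normrM normfV (ger0_norm (Vnorm_ge0 _ _ _)).
have := Vnorm_ge0 p n x; rewrite le_eqVlt => /predU1P[<-|V0]; first by rewrite invr0 mulr0.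
by rewrite ler_pdivrMr// mul1r le_Vnorm.
Qed.

Lemma max_weight_ge p n (x : nat -> R) i : (i < n)%N -> `|weight p n x i| <= max_weight p n x.
Proof. by move=> iN; exact: (@le_bigmax _ _ _ 0 (fun i : 'I_n => `|weight p n x i|) (Ordinal iN)). Qed.

Lemma max_weight_itv p n (x : nat -> R) : 0 < p -> 0 <= max_weight p n x <= 1.
Proof.
move=> p0; apply/andP; split; first exact: bigmax_ge_id.
by apply: bigmax_le => // i _; exact: weight_le1.
Qed.

Lemma bmeas_max_weight p n : 0 < p -> bmeas (fun x : seqR R => max_weight p n x).
Proof.
move=> p0; apply: bmeas01; last by move=> x; exact: max_weight_itv.
apply: (@measurable_bigmax _ _ (seqR R) _ _ (fun (i : 'I_n) x => `|weight p n x i|)) => i.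
by apply: measurableT_comp => //; exact: measurable_weight.
Qed.

(** With [0^-1 = 0] all weights vanish when the norm does; only then do the squares fail to sum to
    1. *)
Lemma weight2_sum n (x : nat -> R) :
  \sum_(i < n) weight 2 n x i ^+ 2 = (Vnorm 2 n x != 0)%:R.
Proof.
rewrite /weight; under eq_bigr do rewrite exprMn exprVn.
rewrite -mulr_suml; have [->|V0] := eqVneq (Vnorm 2 n x) 0.
  by rewrite expr0n/= invr0 mulr0.
have S0 : 0 <= \sum_(i < n) x i ^+ 2 by rewrite sumr_ge0// => i _; exact: sqr_ge0.
rewrite -[X in X / _](sqr_sqrtr S0) -Vnorm2E divff//.
by rewrite expf_neq0.
Qed.

Lemma weight2_sum_le n (x : nat -> R) (k l : nat) : (l <= n)%N ->
  \sum_(k <= i < l) weight 2 n x i ^+ 2 <= 1.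
Proof.
move=> ln; apply: (@le_trans _ _ (\sum_(i < n) weight 2 n x i ^+ 2)); last first.
  by rewrite weight2_sum lern1 leq_b1.
rewrite -(big_mkord xpredT (fun i => weight 2 n x i ^+ 2)).
have [kl|lk] := leqP k l; last first.
  by rewrite (big_geq (ltnW lk)) sumr_ge0// => i _; exact: sqr_ge0.
rewrite (@big_cat_nat _ _ _ k 0 n)//= ?(leq_trans kl)// (@big_cat_nat _ _ _ l k n)//=.
rewrite addrCA lerDl addr_ge0// sumr_ge0// => i _; exact: sqr_ge0.
Qed.

(** The Lyapunov term of the central limit theorem: one factor is bounded by the largest weight, the
    remaining squares sum to at most 1. *)
Lemma weight3_sum_le n (x : nat -> R) (k l : nat) : (l <= n)%N ->
  \sum_(k <= i < l) `|weight 2 n x i| ^+ 3 <= max_weight 2 n x.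
Proof.
move=> ln; have /andP[m1 _] := @max_weight_itv 2 n x ltac:(lra).
apply: (@le_trans _ _ (max_weight 2 n x * \sum_(k <= i < l) weight 2 n x i ^+ 2)); last first.
  by rewrite ler_piMr// weight2_sum_le.
rewrite mulr_sumr !big_nat; apply: ler_sum => i /andP[_ il].
rewrite -[weight 2 n x i ^+ 2]real_normK ?num_real// exprS ler_wpM2r ?sqr_ge0//.
by rewrite max_weight_ge// (leq_trans il).
Qed.

End self_normalized_weights.

Section sample_law.
Context (R : realType) d (T : measurableType d) (P : probability T R).
Variable X : nat -> {RV P >-> R}.
Hypotheses (iidX : iid X) (symX : forall i, symmetric_RV (X i)).
Implicit Types (F : seqR R -> R).

Let mX : measurable_fun [set: T] (fun w => (fun i => X i w) : seqR R).
Proof. exact: measurable_toseq. Qed.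

Definition sampleRV : {RV P >-> seqR R} :=
  MeasurableFun.Pack (MeasurableFun.Class (isMeasurableFun.Build _ _ _ _ _ mX)).

Definition law : probability (seqR R) R := distribution P sampleRV.

Lemma Ex_sample F : bmeas F -> Ex P (fun w => F (fun i => X i w)) = Ex law F.
Proof. by move=> bF; exact/esym/(Ex_distribution sampleRV bF). Qed.

Lemma bmeas_flip i F : bmeas F -> bmeas (fun x : seqR R => F (flip i x)).
Proof.
move=> [mF [M FM]]; split; last by exists M => x; exact: FM.
exact: measurableT_comp mF (@measurable_flip R i).
Qed.

Lemma bmeas_swap a b F : bmeas F -> bmeas (fun x : seqR R => F (swap a b x)).
Proof.
move=> [mF [M FM]]; split; last by exists M => x; exact: FM.
exact: measurableT_comp mF (@measurable_swap R a b).
Qed.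

Lemma law_flip i F : bmeas F -> Ex law (fun x => F (flip i x)) = Ex law F.
Proof.
move=> bF; rewrite -!Ex_sample//; last exact: bmeas_flip.
exact: (EX_flip iidX symX i bF).
Qed.

Lemma law_swap a b F : bmeas F -> Ex law (fun x => F (swap a b x)) = Ex law F.
Proof.
move=> bF; rewrite -!Ex_sample//; last exact: bmeas_swap.
exact: (EX_swap iidX a b bF).
Qed.

(** Each flip preserves the law of the sample, so averaging over signs keeps the mean. This plays
    the part of conditioning on the absolute values. *)
Lemma law_savg n i F : bmeas F ->
  bmeas (savg n i F : seqR R -> R) /\ Ex law (savg n i F) = Ex law F.
Proof.
move=> bF; elim: n i => [//|n IH] i.
have [b1 E1] := IH i.+1; have b2 := bmeas_flip i b1.
have bD : bmeas (fun x : seqR R => 2^-1 * (savg n i.+1 F x + savg n i.+1 F (flip i x))).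
  by apply: bmeasZ; exact: bmeasD.
rewrite (_ : savg n.+1 i F = fun x => 2^-1 * (savg n i.+1 F x + savg n i.+1 F (flip i x))).
  split => //; rewrite ExZ; last exact: bmeasD.
  by rewrite ExD// (law_flip i b1) E1; field.
by apply/funext => x /=; rewrite mulrC.
Qed.

End sample_law.

(** * Second moments of the squared weights under exchangeability *)

Section exchangeability.
Context (R : realType) d (T : measurableType d) (P : probability T R).
Variable X : nat -> {RV P >-> R}.
Hypotheses (iidX : iid X) (symX : forall i, symmetric_RV (X i)).
Local Notation E := (Ex (law X)).

(** For [0 < p], [max_weight] lies in [[0, 1]], so convergence to 0 of its mean expresses
    convergence in probability. *)
Definition mean_max p n := E (fun x => max_weight p n x).
Definition null_prob p n := E (fun x => (Vnorm p n x == 0)%:R).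

Let q n i (x : seqR R) : R := weight 2 n x i ^+ 2.

Lemma bmeas_null_prob p n : bmeas (fun x : seqR R => (Vnorm p n x == 0)%:R : R).
Proof.
apply: bmeas_bool; apply: measurable_fun_eqr => //; exact: measurable_V.
Qed.

Lemma bmeas_weight p n i : 0 < p -> (i < n)%N -> bmeas (fun x : seqR R => weight p n x i).
Proof.
move=> p0 iN; split; first exact: measurable_weight.
by exists 1 => x; exact: weight_le1.
Qed.

Let bq n i : (i < n)%N -> bmeas (q n i).
Proof. by move=> iN; apply: bmeasX; exact: bmeas_weight. Qed.

Let q_swap n a b i (x : seqR R) : (a < n)%N -> (b < n)%N ->
  q n i (swap a b x) = q n (swapn a b i) x.
Proof. by move=> an bn; rewrite /q weight_swap. Qed.

Let Eq2 n i : (i < n)%N -> E (fun x => q n i x ^+ 2) = E (fun x => q n 0 x ^+ 2).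
Proof.
move=> iN; have n0 : (0 < n)%N by exact: leq_ltn_trans iN.
apply: etrans (esym (law_swap iidX 0 i (bmeasX 2 (bq iN)))) _.
apply: eq_Ex => x.
by rewrite q_swap// /swapn eqxx; case: eqP => // ->.
Qed.

Let Eq1 n i : (i < n)%N -> E (q n i) = E (q n 0).
Proof.
move=> iN; have n0 : (0 < n)%N by exact: leq_ltn_trans iN.
apply: etrans (esym (law_swap iidX 0 i (bq iN))) _; apply: eq_Ex => x.
by rewrite q_swap// /swapn eqxx; case: eqP => // ->.
Qed.

Let Eqq n i j : (i < n)%N -> (j < n)%N -> i != j ->
  E (fun x => q n i x * q n j x) = E (fun x => q n 0 x * q n 1 x).
Proof.
have step a b i' j' : (a < n)%N -> (b < n)%N -> (i' < n)%N -> (j' < n)%N ->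
    E (fun x => q n i' x * q n j' x) =
    E (fun x => q n (swapn a b i') x * q n (swapn a b j') x).
  move=> an bn i'n j'n.
  apply: etrans (esym (law_swap iidX a b (bmeasM (bq i'n) (bq j'n)))) _.
  by apply: eq_Ex => x; rewrite !q_swap.
have swn a b i' : (a < n)%N -> (b < n)%N -> (i' < n)%N -> (swapn a b i' < n)%N.
  by rewrite /swapn; case: eqP => // _; case: eqP.
move=> iN jN ij; have n0 : (0 < n)%N by exact: leq_ltn_trans iN.
have n1 : (1 < n)%N.
  rewrite ltnNge; apply: contra ij => n1.
  have z l : (l < n)%N -> l = 0%N.
    by move=> ln; apply/eqP; rewrite -leqn0 -ltnS (leq_trans ln n1).
  by rewrite (z i)// (z j).
rewrite (step 0%N i i j)//.
have -> : swapn 0 i i = 0%N by rewrite /swapn eqxx; case: eqP.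
have j0 : swapn 0 i j != 0%N.
  rewrite /swapn; case: (eqVneq j 0%N) => [j0|j0]; first by rewrite -j0.
  by rewrite [j == i]eq_sym (negbTE ij).
rewrite (step 1%N (swapn 0 i j) 0%N (swapn 0 i j)) ?swn//.
have -> : swapn 1 (swapn 0 i j) 0 = 0%N by rewrite /swapn /= eq_sym (negbTE j0).
by have -> : swapn 1 (swapn 0 i j) (swapn 0 i j) = 1%N by rewrite {1}/swapn eqxx; case: eqP.
Qed.

Lemma mean_max_ge0 p n : 0 <= mean_max p n.
Proof. by apply: Ex_ge0 => x; exact: bigmax_ge_id. Qed.

Lemma null_prob_ge0 p n : 0 <= null_prob p n.
Proof. by apply: Ex_ge0 => x. Qed.

(* By exchangeability the squared weights, which sum to 1, are equidistributed
   up to an error controlled by the largest of them. *)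
Lemma partial_weight_variance n k : (0 < n)%N -> (k <= n)%N ->
  E (fun x => (\sum_(i < k) weight 2 n x i ^+ 2 - k%:R / n%:R) ^+ 2) <=
  mean_max 2 n + 2 * null_prob 2 n.
Proof.
move=> n0 kn.
have n0' : 0 < n%:R :> R by rewrite ltr0n.
(* By exchangeability the squared weights have only two second moments, [al] on the diagonal and
   [be] off it; since their total is 0 or 1, [H2] relates the two. *)
pose al := E (fun x => q n 0 x ^+ 2); pose be := E (fun x => q n 0 x * q n 1 x).
have iN (i : 'I_k) : (i < n)%N by exact: leq_trans (ltn_ord i) kn.
have iNn (i : 'I_n) : (i < n)%N by exact: ltn_ord.
have bsum l : (l <= n)%N -> bmeas (fun x => \sum_(i < l) q n i x).
  by move=> ln; apply: bmeas_sum => i _; apply: bq; exact: leq_trans (ltn_ord i) ln.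
have Esum l : (l <= n)%N -> E (fun x => \sum_(i < l) q n i x) = l%:R * E (q n 0).
  move=> ln; rewrite Ex_sum; last by move=> i _; apply: bq; exact: leq_trans (ltn_ord i) ln.
  rewrite (eq_bigr (fun=> E (q n 0))) => [|i _]; last by apply: Eq1;
    exact: leq_trans (ltn_ord i) ln.
  by rewrite sumr_const card_ord mulr_natl.
have Esum2 l : (l <= n)%N -> E (fun x => (\sum_(i < l) q n i x) ^+ 2) =
    l%:R * al + (l * l.-1)%:R * be.
  move=> ln.
  have lN (i : 'I_l) : (i < n)%N by exact: leq_trans (ltn_ord i) ln.
  rewrite (_ : (fun x => _) = fun x => \sum_(i < l) \sum_(j < l) (q n i x * q n j x)); last first.
    by apply/funext => x; rewrite expr2 mulr_suml; apply: eq_bigr => i _; rewrite mulr_sumr.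
  rewrite Ex_sum; last by move=> i _; apply: bmeas_sum => j _; apply: bmeasM; exact: bq.
  rewrite (eq_bigr (fun=> al + (l.-1)%:R * be)); last first.
    move=> i _; rewrite Ex_sum; last by move=> j _; apply: bmeasM; exact: bq.
    rewrite (bigD1 i)//=; congr (_ + _).
      by apply: etrans (Eq2 (lN i)); apply: eq_Ex => x; rewrite expr2.
    rewrite (eq_bigr (fun=> be)) => [|j ji]; last by apply: Eqq => //; rewrite eq_sym.
    rewrite sumr_const -(@eq_card _ (predC1 i)) ?cardC1 ?card_ord ?mulr_natl//.
  by rewrite sumr_const card_ord natrM -mulrA -mulrDr [RHS]mulr_natl.
have total x : \sum_(i < n) q n i x = 1 - (Vnorm 2 n x == 0)%:R.
  by rewrite weight2_sum; case: eqP => _ /=; rewrite ?subr0 ?subrr.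
have bv := bmeas_null_prob 2 n.
have E1v : E (fun x => 1 - (Vnorm 2 n x == 0)%:R) = 1 - null_prob 2 n.
  by rewrite (ExB _ (bmeas_cst _ 1) bv) Ex_cst.
have H1 : n%:R * E (q n 0) = 1 - null_prob 2 n.
  by rewrite -Esum// -E1v; apply: eq_Ex => x; rewrite total.
have H2 : n%:R * al + (n * n.-1)%:R * be = 1 - null_prob 2 n.
  rewrite -Esum2// -E1v; apply: eq_Ex => x; rewrite total; case: eqP => _ /=;
    rewrite ?subrr ?subr0 ?expr1n//.
  by rewrite expr0n.
have al0 : 0 <= al by apply: Ex_ge0 => x; exact: sqr_ge0.
have be0 : 0 <= be by apply: Ex_ge0 => x; rewrite mulr_ge0// sqr_ge0.
(* Weights are at most 1 in modulus, so a squared weight is at most the largest weight and the sum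
   of fourth powers is at most [max_weight]. *)
have nal : n%:R * al <= mean_max 2 n.
  have -> : n%:R * al = E (fun x => \sum_(i < n) q n i x ^+ 2).
    rewrite Ex_sum; last by move=> i _; apply: bmeasX; exact: bq.
    by rewrite (eq_bigr (fun=> al)) ?sumr_const ?card_ord ?mulr_natl// => i _; exact: Eq2.
  apply: Ex_le; [|exact: bmeas_max_weight|].
    by apply: bmeas_sum => i _; apply: bmeasX; exact: bq.
  move=> x; apply: (@le_trans _ _ (\sum_(i < n) max_weight 2 n x * q n i x)).
    apply: ler_sum => i _; rewrite expr2 ler_wpM2r ?sqr_ge0//.
    have c1 := @weight_le1 R 2 n x i ltac:(lra) (iNn i); have c2 := @max_weight_ge R 2 n x i (iNn i).
    rewrite /q -(real_normK (num_real (weight 2 n x i))) expr2 (le_trans _ c2)//.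
    by rewrite ler_piMl.
  rewrite -mulr_sumr total ler_piMr//; by have /andP[] := @max_weight_itv R 2 n x ltac:(lra).
have rho0 := null_prob_ge0 2 n.
have bS := bsum k kn.
rewrite (_ : (fun x => _) = fun x => (\sum_(i < k) q n i x) ^+ 2 +
   (- (2 * (k%:R / n%:R)) * (\sum_(i < k) q n i x) + (k%:R / n%:R) ^+ 2)); last first.
  by apply/funext => x; rewrite /q; ring.
rewrite ExD; [|exact: bmeasX|by apply: bmeasD; [exact: bmeasZ|exact: bmeas_cst]].
rewrite ExD; [|exact: bmeasZ|exact: bmeas_cst].
rewrite ExZ// Ex_cst Esum2// Esum//.
have EQ : E (q n 0) = (1 - null_prob 2 n) / n%:R by rewrite -H1 mulrC mulKf// gt_eqF.
rewrite EQ.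
set t := k%:R / n%:R.
have t01 : 0 <= t <= 1 by rewrite divr_ge0//= ler_pdivrMr// mul1r ler_nat.
have -> : k%:R * ((1 - null_prob 2 n) / n%:R) = t * (1 - null_prob 2 n) by rewrite /t; ring.
have kt : k%:R = t * n%:R :> R by rewrite /t divfK// gt_eqF.
have hal : k%:R * al <= mean_max 2 n.
  by apply: le_trans nal; rewrite ler_wpM2r// ler_nat.
(* The off-diagonal part of the full sum is at most 1 by [H2], and
   [k * (k - 1) <= t ^+ 2 * n * (n - 1)] because the difference is [t * n * (1 - t)]. *)
have hbe : (k * k.-1)%:R * be <= t ^+ 2.
  have nb : (n * n.-1)%:R * be <= 1.
    have h : 0 <= n%:R * al by rewrite mulr_ge0.
    by move: H2 h rho0; move: (_ * al) (_ * be) (null_prob 2 n) => A B V; lra.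
  apply: (@le_trans _ _ (t ^+ 2 * ((n * n.-1)%:R * be))); last first.
    by rewrite ler_piMr// sqr_ge0.
  rewrite mulrA ler_wpM2r//.
  have [k0|k0] := posnP k; first by rewrite k0 mulr_ge0// sqr_ge0.
  rewrite !natrM -!subn1 !natrB// kt; case/andP: t01 => t0 t1.
  have : 0 <= t * n%:R * (1 - t) by rewrite !mulr_ge0 ?subr_ge0// ltW.
  clear; move=> h; rewrite -subr_ge0 (_ : _ - _ = t * n%:R * (1 - t))//; ring.
move: hal hbe t01; move: (_ * al) (_ * be) (mean_max 2 n) rho0 => A B K.
move=> v0 h1 h2 /andP[t0 t1].
have t2 : t ^+ 2 <= 1 by rewrite expr_le1.
have : t ^+ 2 * null_prob 2 n <= null_prob 2 n by rewrite ler_piMl.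
have -> : - (2 * t) * (t * (1 - null_prob 2 n)) + t ^+ 2 =
   2 * (t ^+ 2 * null_prob 2 n) - t ^+ 2 by ring.
by move: v0; move: (t ^+ 2 * null_prob 2 n) (t ^+ 2) h1 h2 (null_prob 2 n) => C D ? ? V; lra.
Qed.

End exchangeability.

(** * The invariance principle for self-normalized sums *)

Section block_approximation.
Context (R : realType).
Implicit Types (c : nat -> R).

(** The event of Levy's inequality on one window; the summand 0 matches the starting point in
    [savg_levy]. *)
Definition osc (e : R) n i (y : nat -> R) : bool :=
  has (fun l => e < `|0 + \sum_(i <= j < i + l) y j|) (iota 0 n.+1).

Lemma osc_le (e : R) n i y l : ~~ osc e n i y -> (l <= n)%N ->
  `|\sum_(i <= j < i + l) y j| <= e.
Proof.
move=> /hasPn h ln; have := h l; rewrite mem_iota/= add0n ltnS ln -leNgt add0r; exact.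
Qed.

Definition blocks n m j : nat := (n * j %/ m)%N.

Lemma blocks_le n m j : (blocks n m j <= blocks n m j.+1)%N.
Proof. by rewrite leq_div2r// leq_mul2l leqnSn orbT. Qed.

Lemma blocks_max n m : (0 < m)%N -> blocks n m m = n.
Proof. by move=> m0; rewrite /blocks mulnK. Qed.

Lemma blocks_bound n m j : (0 < m)%N -> (j <= m)%N -> (blocks n m j <= n)%N.
Proof. by move=> m0 jm; rewrite -[leqRHS](@blocks_max n m)// leq_div2r// leq_mul2l jm orbT. Qed.

Lemma blocks_itv n m j : (0 < m)%N ->
  (blocks n m j)%:R <= n%:R * (j%:R / m%:R : R) < (blocks n m j)%:R + 1.
Proof.
move=> m0; have m0' : 0 < m%:R :> R by rewrite ltr0n.
rewrite natr1 mulrA ler_pdivlMr// ltr_pdivrMr// -!natrM ler_nat ltr_nat.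
by rewrite leq_divM ltn_ceil.
Qed.

Lemma bsum_telescope (k : nat -> nat) c j : (forall j, k j <= k j.+1)%N -> k 0%N = 0%N ->
  \sum_(i < j) bsum k c i = \sum_(i < k j) c i.
Proof.
move=> kS k0; elim: j => [|j IH]; first by rewrite k0 !big_ord0.
rewrite big_ord_recr/= IH /bsum -!(big_mkord xpredT).
by rewrite -big_cat_nat.
Qed.

(** Within a coarse cell the coarse polygon moves by at most [e], the partial sums by at most [e],
    and the unfinished fine step by at most [mu]. *)
Lemma interp_blocks n m c (e mu : R) t : (0 < n)%N -> (0 < m)%N ->
  (forall j, (j < m)%N -> ~~ osc e (blocks n m j.+1 - blocks n m j) (blocks n m j) c) ->
  (forall i, (i < n)%N -> `|c i| <= mu) ->
  `|interp 0 n c t - interp 0 m (bsum (blocks n m) c) t| <= 2 * e + mu.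
Proof.
move=> n0 m0 oc cmu; set k := blocks n m in oc *.
have [j /andP[jm /andP[j1 j2]]] := cell_exists t m0.
have [l /andP[ln /andP[l1 l2]]] := cell_exists t n0.
rewrite !interpE !add0r (clamp_sum _ ln) ?l1// (clamp_sum _ jm) ?j1//.
have kS j' : (k j' <= k j'.+1)%N by exact: blocks_le.
rewrite bsum_telescope//; last by rewrite /k /blocks muln0 div0n.
have n0' : 0 < n%:R :> R by rewrite ltr0n.
have m0' : 0 < m%:R :> R by rewrite ltr0n.
set s := I01_val t in j1 j2 l1 l2 *.
have js : j%:R / m%:R <= s by rewrite ler_pdivrMr// mulrC.
have sj : s <= j.+1%:R / m%:R by rewrite ler_pdivlMr// mulrC.
have /andP[a1 _] := @blocks_itv n m j m0; have /andP[_ a2] := @blocks_itv n m j.+1 m0.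
rewrite -/k in a1 a2.
have b1 : (k j)%:R <= n%:R * s by rewrite (le_trans a1)// ler_wpM2l.
have b2 : n%:R * s < (k j.+1)%:R + 1.
  by apply: le_lt_trans a2; rewrite ler_wpM2l.
have th : `|(m%:R * s - j%:R) * bsum k c j| <= e.
  rewrite normrM; apply: (@le_trans _ _ `|bsum k c j|).
    rewrite ler_piMl// ger0_norm ?subr_ge0//.
    by move: j2; rewrite -natr1; move: (m%:R * s) j%:R => a b; lra.
  rewrite /bsum -[in X in index_iota _ X](subnKC (kS j)); exact: osc_le (oc j jm) (leqnn _).
suff : `|\sum_(i < l) c i + (n%:R * s - l%:R) * c l - \sum_(i < k j) c i| <= e + mu.
  move: th; move: ((m%:R * s - j%:R) * bsum k c j) (\sum_(i < l) _ + _) (\sum_(i < k j) _) => A B C.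
  by rewrite !ler_norml => /andP[? ?] /andP[? ?]; lra.
have e0 : 0 <= e by apply: le_trans th.
have mu0 : 0 <= mu by apply: le_trans (cmu l ln).
(* Cells are closed at both ends, so the fine cell found may be the last one before the block; then
   [n%:R * s] is exactly [k j] and the two sums agree. *)
have [lk|kl] := ltnP l (k j).
  have El : l.+1 = k j.
    apply/eqP; rewrite eqn_leq lk/= -(ler_nat R); exact: le_trans b1 l2.
  have -> : n%:R * s - l%:R = 1.
    have : n%:R * s = l.+1%:R by apply/eqP; rewrite eq_le l2/= El.
    by rewrite -natr1 => ->; ring.
  by rewrite mul1r -El big_ord_recr/= subrr normr0 addr_ge0.
have lk1 : (l <= k j.+1)%N.
  by rewrite -ltnS -(ltr_nat R) -natr1; apply: le_lt_trans b2.
rewrite addrAC (le_trans (ler_normD _ _))// lerD//; last first.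
  rewrite normrM (le_trans _ (cmu l ln))// ler_piMl// ger0_norm ?subr_ge0//.
  by move: l2; rewrite -natr1; move: (n%:R * s) l%:R => a b; lra.
rewrite -!(big_mkord xpredT) (@big_cat_nat _ _ _ (k j))//= addrAC subrr add0r.
rewrite -{1}(subnKC kl); apply: osc_le (oc j jm) _.
by rewrite leq_sub2r.
Qed.

(** [Vnorm] depends on absolute values only, so flipping signs in the sample is flipping signs of
    the weights. *)
Lemma savg_weight (p : R) n l i (F : (nat -> R) -> R) (x : nat -> R) :
  savg l i (fun y => F (weight p n y)) x = savg l i F (weight p n x).
Proof.
have -> : weight p n x = fun j => (Vnorm p n x)^-1 * x j by apply/funext => j; rewrite /weight mulrC.
rewrite -savg_scale; apply: eq_savg => y [xy _]; congr F.
by apply/funext => j; rewrite /weight (eq_Vnorm _ _ xy) mulrC.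
Qed.

(** Levy's inequality, then Markov with the fourth moment, whence [6 = 2 * 3]. The squared variance
    is what lets the total over [m] blocks of variance about [1 / m] vanish as [m] grows. *)
Lemma savg_osc (e : R) n i (x : nat -> R) : 0 < e ->
  savg n i (fun y => (osc e n i y)%:R) x <= 6 / e ^+ 4 * (\sum_(i <= j < i + n) x j ^+ 2) ^+ 2.
Proof.
move=> e0; apply: le_trans (savg_levy n i x 0 e) _.
set s := \sum_(_ <= _ < _) _.
have e4 : 0 < e ^+ 4 by exact: exprn_gt0.
have h : rad n i (fun u => (e < `|u|)%R%:R) x 0 <= e ^- 4 * rad n i (fun u => u ^+ 4) x 0.
  rewrite -radZ; apply: rad_le => u.
  have u4 : 0 <= u ^+ 4 by exact: exprn_even_ge0.
  case: (ltP e `|u|) => eu /=; last by rewrite mulr_ge0// invr_ge0 ltW.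
  rewrite mulrC ler_pdivlMr// mul1r.
  have -> : u ^+ 4 = `|u| ^+ 4 by rewrite -normrX ger0_norm.
  by rewrite lerXn2r ?nnegrE ?normr_ge0 ?(ltW e0)// ltW.
have := rad_pow4 n i x 0; rewrite -/s expr0n/= add0r expr0n/= mulr0 mul0r add0r => h2.
have : e ^- 4 * rad n i (fun u => u ^+ 4) x 0 <= e ^- 4 * (3 * s ^+ 2).
  by rewrite ler_wpM2l// invr_ge0 ltW.
rewrite (_ : 6 / e ^+ 4 * s ^+ 2 = 2 * (e ^- 4 * (3 * s ^+ 2))); last by ring.
by move=> h3; rewrite ler_pM2l// (le_trans h).
Qed.

(** The variance defect is known in mean square, while [block_err] contains its square root [r];
    beyond [dl], [r] is at most [r ^+ 4 / dl ^+ 3]. *)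
Lemma sqrt_le_sqr (a dl : R) : 0 < dl -> 0 <= a -> Num.sqrt a <= dl + a ^+ 2 / dl ^+ 3.
Proof.
move=> d0 a0; rewrite -{2}(sqr_sqrtr a0); have := sqrtr_ge0 a; move: (Num.sqrt a) => r r0.
have d3 : 0 < dl ^+ 3 by exact: exprn_gt0.
case: (leP r dl) => rd.
  by rewrite ler_wpDr// divr_ge0 ?sqr_ge0 ?(ltW d3).
rewrite ler_wpDl ?(ltW d0)// ler_pdivlMr// -exprM (exprS r 3) ler_wpM2l//.
by rewrite lerXn2r ?nnegrE// ltW.
Qed.

End block_approximation.

Section self_normalized_donsker.
Context (R : realType) d (T : measurableType d) (P : probability T R).
Variable X : nat -> {RV P >-> R}.
Hypotheses (iidX : iid X) (symX : forall i, symmetric_RV (X i)).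
Context d' (T' : measurableType d') (Q : probability T' R) (W : T' -> C01 R).
Hypothesis bmW : standard_BM Q W.
Local Notation E := (Ex (law X)).
Implicit Types (x : seqR R).

Definition blockvar n m j (x : nat -> R) : R :=
  \sum_(blocks n m j <= i < blocks n m j.+1) weight 2 n x i ^+ 2.

(** A block is a difference of two partial sums up to a rounding error at most [1 / n]; squaring
    three terms costs a factor 3. *)
Definition vardefect n : R := 6 * (mean_max X 2 n + 2 * null_prob X 2 n) + 3 / n%:R ^+ 2.

Lemma bmeas_blockvar n m j : (0 < m)%N -> (j < m)%N ->
  bmeas (fun x : seqR R => blockvar n m j x).
Proof.
move=> m0 jm; split.
  by apply: measurable_sum => i; apply: measurable_funX; exact: measurable_weight.
exists 1 => x; rewrite ger0_norm; last by rewrite sumr_ge0// => i _; exact: sqr_ge0.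
by apply: weight2_sum_le; exact: blocks_bound.
Qed.

Lemma blockvar_defect n m j : (0 < n)%N -> (0 < m)%N -> (j < m)%N ->
  E (fun x => (blockvar n m j x - 1 / m%:R) ^+ 2) <= vardefect n.
Proof.
move=> n0 m0 jm.
have n0' : 0 < n%:R :> R by rewrite ltr0n.
pose D k (x : seqR R) := \sum_(i < k) weight 2 n x i ^+ 2 - k%:R / n%:R.
have kj : (blocks n m j <= n)%N by apply: blocks_bound => //; exact: ltnW.
have kj1 : (blocks n m j.+1 <= n)%N by exact: blocks_bound.
have bD k : (k <= n)%N -> bmeas (D k).
  move=> kn; apply: bmeasB; last exact: bmeas_cst.
  apply: bmeas_sum => i _; apply: bmeasX; apply: bmeas_weight => //.
  exact: leq_trans (ltn_ord i) kn.
have v1 := partial_weight_variance iidX n0 kj; have v2 := partial_weight_variance iidX n0 kj1.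
pose dl := (blocks n m j.+1)%:R / n%:R - (blocks n m j)%:R / n%:R - 1 / m%:R : R.
have dl2 : dl ^+ 2 <= 1 / n%:R ^+ 2.
  have /andP[a1 a2] := @blocks_itv R n m j m0; have /andP[a3 a4] := @blocks_itv R n m j.+1 m0.
  have nd : `|n%:R * dl| <= 1.
    have -> : n%:R * dl = (blocks n m j.+1)%:R - (blocks n m j)%:R - n%:R / m%:R.
      by rewrite /dl; field; rewrite !pnatr_eq0 -!lt0n n0 m0.
    move: a3 a4; rewrite -natr1 mulrDl mulrDr div1r.
    move: a1 a2; move: (n%:R * (j%:R / m%:R) : R) (n%:R / m%:R : R) (blocks n m j.+1)%:R
      (blocks n m j)%:R => A B C F *.
    by rewrite ler_norml; apply/andP; split; lra.
  rewrite ler_pdivlMr ?exprn_gt0// -exprMn mulrC -(real_normK (num_real _)).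
  by rewrite expr_le1.
apply: (@le_trans _ _ (E (fun x => 3 * (D (blocks n m j.+1) x ^+ 2) +
    (3 * (D (blocks n m j) x ^+ 2) + 3 / n%:R ^+ 2)))).
  apply: Ex_le.
  - apply: bmeasX; apply: bmeasB; [exact: bmeas_blockvar|exact: bmeas_cst].
  - apply: bmeasD; first by apply: bmeasZ; apply: bmeasX; exact: bD.
    by apply: bmeasD; [apply: bmeasZ; apply: bmeasX; exact: bD|exact: bmeas_cst].
  move=> x; have -> : blockvar n m j x - 1 / m%:R = D (blocks n m j.+1) x - D (blocks n m j) x + dl.
    rewrite /D /dl /blockvar -!(big_mkord xpredT (fun i => weight 2 n x i ^+ 2)).
    by rewrite (@big_cat_nat _ _ _ (blocks n m j) 0)//= ?blocks_le//; ring.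
  have -> : 3 / n%:R ^+ 2 = 3 * (1 / n%:R ^+ 2) :> R by rewrite mulrA mulr1.
  move: (D _ x) (D _ x) dl (1 / _) dl2 => A B C F CF.
  have := sqr_ge0 (A + B); have := sqr_ge0 (B - C); have := sqr_ge0 (A + C); nra.
rewrite ExD; last first.
- by apply: bmeasD; [apply: bmeasZ; apply: bmeasX; exact: bD|exact: bmeas_cst].
- by apply: bmeasZ; apply: bmeasX; exact: bD.
rewrite ExD; last first.
- exact: bmeas_cst.
- by apply: bmeasZ; apply: bmeasX; exact: bD.
rewrite Ex_cst !ExZ; try by apply: bmeasX; exact: bD.
rewrite /vardefect; move: v1 v2; rewrite -/(D (blocks n m j)) -/(D (blocks n m j.+1)).
move: (mean_max _ _ _ + _) (Ex _ _) (Ex _ _) => A B C *; lra.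
Qed.

Lemma bmeas_osc (e : R) n m j : bmeas (fun x : seqR R =>
  (osc e (blocks n m j.+1 - blocks n m j) (blocks n m j) (weight 2 n x))%:R : R).
Proof.
apply: bmeas_bool; rewrite /osc; elim: (iota _ _) => [|l s IH] //=.
apply: measurable_or => //; apply: measurable_fun_ltr => //.
apply: measurableT_comp => //; apply: measurable_funD => //.
by apply: measurable_sum => i; exact: measurable_weight.
Qed.

(** The squared block variance is at most twice the squared defect plus [2 / m ^+ 2], which doubles
    the 6 of [savg_osc]. Over the [m] blocks the last term adds up to order [1 / m]. *)
Lemma osc_bound (e : R) n m j : 0 < e -> (0 < n)%N -> (0 < m)%N -> (j < m)%N ->
  E (fun x => (osc e (blocks n m j.+1 - blocks n m j) (blocks n m j) (weight 2 n x))%:R) <=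
  12 / e ^+ 4 * (vardefect n + 1 / m%:R ^+ 2).
Proof.
move=> e0 n0 m0 jm; set N := (blocks n m j.+1 - blocks n m j)%N; set i := blocks n m j.
have bo := bmeas_osc e n m j; have [bs <-] := law_savg iidX symX N i bo.
have e4 : 0 < e ^+ 4 by exact: exprn_gt0.
have bv := bmeas_blockvar n m0 jm.
have bw : bmeas (fun x : seqR R => (blockvar n m j x - 1 / m%:R) ^+ 2).
  by apply: bmeasX; apply: bmeasB => //; exact: bmeas_cst.
apply: (@le_trans _ _ (E (fun x => 12 / e ^+ 4 * ((blockvar n m j x - 1 / m%:R) ^+ 2 +
  1 / m%:R ^+ 2)))).
  apply: Ex_le => //.
    by apply: bmeasZ; apply: bmeasD => //; exact: bmeas_cst.
  move=> x; rewrite (savg_weight 2 n N i (fun y => (osc e N i y)%:R)).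
  apply: le_trans (savg_osc _ _ _ e0) _; rewrite /N subnKC ?blocks_le// -/(blockvar n m j x).
  rewrite (_ : 12 / e ^+ 4 = 6 / e ^+ 4 * 2); last by ring.
  rewrite -[leRHS]mulrA ler_wpM2l ?divr_ge0 ?(ltW e4)//.
  have -> : 1 / m%:R ^+ 2 = (1 / m%:R) ^+ 2 :> R by rewrite !div1r exprVn.
  move: (blockvar _ _ _ _) (1 / m%:R : R) => a b; have := sqr_ge0 (a - 2 * b); nra.
rewrite ExZ; last by apply: bmeasD => //; exact: bmeas_cst.
rewrite ler_wpM2l ?divr_ge0 ?(ltW e4)// ExD//; last exact: bmeas_cst.
by rewrite Ex_cst lerD2r blockvar_defect.
Qed.

Variables (L M : R) (Phi : C01 R -> R).
Hypotheses (L0 : 0 <= L) (PL : lipC L Phi) (PM : forall f, `|Phi f| <= M).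

Let bPhi m : bmeas (Phi_interp Phi m).
Proof.
split; last by exists M => u; exact: PM.
by apply: measurable_Phi_interp; exact: lipC_continuous L0 PL.
Qed.

Let bcomp m (g : seqR R -> seqR R) : measurable_fun [set: seqR R] g ->
  bmeas (fun x => Phi_interp Phi m (g x)).
Proof.
move=> mg; have [m1 [K HK]] := bPhi m; split; last by exists K => x; exact: HK.
exact: measurableT_comp m1 mg.
Qed.

Let measurable_bsum n m : measurable_fun [set: seqR R]
  (fun x : seqR R => (fun j => bsum (blocks n m) (weight 2 n x) j) : seqR R).
Proof.
apply: (@measurable_toseq _ _ (seqR R)) => j; apply: measurable_sum => i; exact: measurable_weight.
Qed.

(** If no block oscillates, [interp_blocks] and the Lipschitz bound apply; otherwise the trivial
    bound [2 * M] is multiplied by the number of oscillating blocks, a union bound in terms of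
    means. *)
Lemma interp_blocks_bound n m (e : R) : 0 < e -> (0 < n)%N -> (0 < m)%N ->
  `|E (fun x => Phi_interp Phi n (weight 2 n x)) -
    E (fun x => Phi_interp Phi m (bsum (blocks n m) (weight 2 n x)))| <=
  L * (2 * e + mean_max X 2 n) + 2 * M * (m%:R * (12 / e ^+ 4 * (vardefect n + 1 / m%:R ^+ 2))).
Proof.
move=> e0 n0 m0.
have M0 : 0 <= M by apply: le_trans (PM (interp 0 0 (fun=> 0))).
pose os j x : R := (osc e (blocks n m j.+1 - blocks n m j) (blocks n m j) (weight 2 n x))%:R.
have b1 := bmeas_max_weight n (ltac:(lra) : 0 < 2 :> R).
have b2 : bmeas (fun x => \sum_(j < m) os j x) by apply: bmeas_sum => j _; exact: bmeas_osc.
apply: (@le_trans _ _ (E (fun x => L * (2 * e + max_weight 2 n x) + 2 * M * \sum_(j < m) os j x))).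
  apply: Ex_dist_le.
  - by apply: bcomp; exact: measurable_weightseq.
  - by apply: bcomp; exact: measurable_bsum.
  - apply: bmeasD; apply: bmeasZ => //.
    by apply: bmeasD => //; exact: bmeas_cst.
  move=> x.
  have s0 : 0 <= \sum_(j < m) os j x by rewrite sumr_ge0.
  have /andP[m1 _] := @max_weight_itv R 2 n x ltac:(lra).
  have [ho|] := boolP [forall j : 'I_m,
      ~~ osc e (blocks n m j.+1 - blocks n m j) (blocks n m j) (weight 2 n x)].
    apply: (@le_trans _ _ (L * (2 * e + max_weight 2 n x))); last by rewrite lerDl !mulr_ge0.
    apply: PL => t; apply: interp_blocks => // [j jm|i iN]; last exact: max_weight_ge.
    by move/forallP: ho => /(_ (Ordinal jm)).
  rewrite negb_forall => /existsP[j]; rewrite negbK => oj.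
  have s1 : 1 <= \sum_(j < m) os j x.
    by rewrite (bigD1 j)//= {1}/os oj lerDl sumr_ge0.
  apply: (@le_trans _ _ (2 * M)).
    rewrite (le_trans (ler_normB _ _))//.
    by rewrite (_ : 2 * M = M + M); [rewrite lerD//; exact: PM|ring].
  apply: (@le_trans _ _ (2 * M * \sum_(j < m) os j x)); first by rewrite ler_peMr ?mulr_ge0.
  by rewrite lerDr mulr_ge0// addr_ge0// mulr_ge0// ltW.
rewrite ExD; last first.
- exact: bmeasZ.
- by apply: bmeasZ; apply: bmeasD => //; exact: bmeas_cst.
rewrite ExZ; last by apply: bmeasD => //; exact: bmeas_cst.
rewrite ExD//; last exact: bmeas_cst.
rewrite Ex_cst (ExZ _ _ b2) lerD2l ler_wpM2l ?mulr_ge0// Ex_sum; last by move=> j _;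
  exact: bmeas_osc.
rewrite [leRHS]mulr_natl -[X in _ <= _ *+ X](card_ord m) -sumr_const; apply: ler_sum => j _.
exact: osc_bound.
Qed.

Lemma block_clt_bound n m (h dl : R) : 0 < h -> 0 < dl -> (0 < n)%N -> (0 < m)%N ->
  `|E (fun x => Phi_interp Phi m (bsum (blocks n m) (weight 2 n x))) -
    Ex Q (fun w => Phi_interp Phi m (fun j => incr W (grid R m) j w))| <=
  m%:R * (4 * L * h + (1 + gauss_m4 R) * (8 * L / h ^+ 2 * mean_max X 2 n +
    L * (dl + vardefect n / dl ^+ 3))).
Proof.
move=> h0 d0 n0 m0; set q := Ex Q _.
have b1 := bmeas_max_weight n (ltac:(lra) : 0 < 2 :> R).
have bF := bcomp m (measurable_bsum n m).
have [bs <-] := law_savg iidX symX n 0 bF.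
have bD j : (j < m)%N -> bmeas (fun x : seqR R => (blockvar n m j x - 1 / m%:R) ^+ 2).
  by move=> jm; apply: bmeasX; apply: bmeasB; [exact: bmeas_blockvar|exact: bmeas_cst].
have g0 : 0 <= 1 + gauss_m4 R by rewrite addr_ge0// /gauss_m4 Ex_ge0// => z; exact: exprn_even_ge0.
have d3 : 0 < dl ^+ 3 by exact: exprn_gt0.
pose B j x := (1 + gauss_m4 R) * (8 * L / h ^+ 2 * max_weight 2 n x +
    L * (dl + (dl ^+ 3)^-1 * (blockvar n m j x - 1 / m%:R) ^+ 2)).
have bB0 j : (j < m)%N ->
  bmeas (fun x : seqR R => dl + (dl ^+ 3)^-1 * (blockvar n m j x - 1 / m%:R) ^+ 2).
  by move=> jm; apply: bmeasD; [exact: bmeas_cst|apply: bmeasZ; exact: bD].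
have bB j : (j < m)%N -> bmeas (B j).
  by move=> jm; apply: bmeasZ; apply: bmeasD; apply: bmeasZ => //; exact: bB0.
apply: (@le_trans _ _ (E (fun x => \sum_(j < m) (4 * L * h + B j x)))).
  rewrite -[q](Ex_cst (law X)); apply: Ex_dist_le => //; first exact: bmeas_cst.
    by apply: bmeas_sum => j _; apply: bmeasD; [exact: bmeas_cst|exact: bB].
  move=> x; rewrite (savg_weight 2 n n 0 (fun y => Phi_interp Phi m (bsum (blocks n m) y))).
  have k0 : blocks n m 0 = 0%N by rewrite /blocks muln0 div0n.
  have := block_clt bmW (weight 2 n x) m0 h0 L0 (blocks_le n m) (blocks_max n m0) (bPhi m)
    (lipC_interp m L0 PL).
  rewrite k0 subn0 => /le_trans; apply; apply: ler_sum => j _; rewrite /block_err lerD2l.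
  rewrite ler_wpM2l// lerD//.
    have c0 : 0 <= 8 * L / h ^+ 2 by rewrite divr_ge0 ?sqr_ge0// mulr_ge0.
    by apply: ler_wpM2l c0 _ _ _; apply: weight3_sum_le; exact: blocks_bound.
  rewrite ler_wpM2l// -/(blockvar n m j x) -(real_normK (num_real (_ - _ : R))).
  by rewrite [dl ^- 3 * _]mulrC; apply: sqrt_le_sqr.
rewrite Ex_sum; last by move=> j _; apply: bmeasD; [exact: bmeas_cst|exact: bB].
rewrite [leRHS]mulr_natl -[X in _ <= _ *+ X](card_ord m) -sumr_const; apply: ler_sum => j _.
rewrite ExD; [|exact: bmeas_cst|exact: bB].
rewrite Ex_cst lerD2l /B ExZ; last by apply: bmeasD; apply: bmeasZ => //; exact: bB0.
rewrite ler_wpM2l// ExD; [|exact: bmeasZ|by apply: bmeasZ; exact: bB0].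
rewrite ExZ// lerD2l ExZ; last exact: bB0.
rewrite ler_wpM2l// ExD; [|exact: bmeas_cst|by apply: bmeasZ; exact: bD].
rewrite Ex_cst lerD2l ExZ; last exact: bD.
by rewrite mulrC ler_wpM2r ?invr_ge0 ?(ltW d3)// blockvar_defect.
Qed.

End self_normalized_donsker.

Section donsker_limit.
Context (R : realType) d (T : measurableType d) (P : probability T R).
Variable X : nat -> {RV P >-> R}.
Hypotheses (iidX : iid X) (symX : forall i, symmetric_RV (X i)).
Context d' (T' : measurableType d') (Q : probability T' R) (W : T' -> C01 R).
Hypothesis bmW : standard_BM Q W.
Hypotheses (mean_max0 : mean_max X 2 n @[n --> \oo] --> 0) (null_prob0 : null_prob X 2 n @[n --> \oo] --> 0).

Lemma vardefect_cvg0 : vardefect X n @[n --> \oo] --> 0.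
Proof.
have i0 : (n%:R : R)^-1 @[n --> \oo] --> 0.
  apply/cvgr0Pnorm_lt => e e0; near=> n.
  by rewrite ger0_norm//; near: n; exact: near_infty_invn_lt.
have : 6 * (mean_max X 2 n + 2 * null_prob X 2 n) + 3 * (n%:R^-1 * n%:R^-1) @[n --> \oo] -->
    (6 * (0 + 2 * 0) + 3 * (0 * 0) : R).
  apply: cvgD; apply: cvgMr; last by exact: cvgM.
  by apply: cvgD => //; exact: cvgMr.
rewrite (_ : 6 * _ + _ = 0) => [H|]; last by ring.
rewrite (_ : vardefect X = fun n =>
  6 * (mean_max X 2 n + 2 * null_prob X 2 n) + 3 * (n%:R^-1 * n%:R^-1))//.
by apply/funext => n; rewrite /vardefect expr2 invfM.
Unshelve. all: by end_near. Qed.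

Lemma Ex_selfnorm p Phi n : continuous Phi -> (exists M : R, forall f, `|Phi f| <= M) ->
  Ex P (Phi \o selfnorm_process p X n) =
  Ex (law X) (fun x => Phi_interp Phi n (weight p n x)).
Proof.
move=> cP [M PM]; rewrite -Ex_sample.
  by apply: eq_Ex => w; exact: selfnorm_interp.
split; last by exists M => x; exact: PM.
exact: measurableT_comp (measurable_Phi_interp n cP) (@measurable_weightseq R p n).
Qed.

Lemma selfnorm_donsker : cvg_in_law P (selfnorm_process 2 X) Q W.
Proof.
apply: cvg_in_law_lipC.
- by move=> Phi n cP; exact: measurable_selfnorm.
- by move=> Phi cP; exact: (measurable_BM bmW cP).
move=> L Phi L0 PL [M PM]; have cP := lipC_continuous L0 PL.
have bP : exists M : R, forall f, `|Phi f| <= M by exists M.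
have M0 : 0 <= M by apply: le_trans (PM (interp 0 0 (fun=> 0))).
apply/cvgrPdist_le => eta eta0.
(* Order of choices: [e] from [L], then [m] to settle the discretization of [W] and the
   oscillations, then [h] and [dl] from [m], and last [n]. Six contributions of [eta / 6] result. *)
pose e := eta / (12 * (L + 1)).
have e0 : 0 < e by rewrite divr_gt0// mulr_gt0//; lra.
have e4 : 0 < e ^+ 4 by exact: exprn_gt0.
have Le : L * (2 * e) <= eta / 6.
  rewrite (_ : L * (2 * e) = (eta / 6) * (L / (L + 1))); last by rewrite /e; field; lra.
  rewrite ler_piMr//; first lra.
  by rewrite ler_pdivrMr; lra.
have [m [m0 mW mM]] : exists m : nat, [/\ (0 < m)%N,
    `|Ex Q (Phi \o W) - Ex Q (fun w => Phi_interp Phi m (fun j => incr W (grid R m) j w))| <=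
      eta / 6 &
    2 * M * (12 / e ^+ 4) * m%:R^-1 <= eta / 6].
  have /cvgrPdist_le /(_ (eta / 6) ltac:(lra)) H1 := Ex_BM_approx bmW cP bP.
  have C0 : 0 < 2 * M * (12 / e ^+ 4) + 1.
    by rewrite ltr_wpDl// !mulr_ge0// invr_ge0 ltW.
  have H2 := near_infty_invn_lt (divr_gt0 (ltac:(lra) : 0 < eta / 6) C0).
  near \oo => m; exists m; split; first by near: m; exact: nbhs_infty_gt.
    by near: m; exact: H1.
  have : m%:R^-1 < (eta / 6) / (2 * M * (12 / e ^+ 4) + 1) by near: m.
  rewrite ltr_pdivlMr// => /ltW; apply: le_trans.
  by rewrite mulrC ler_wpM2l ?invr_ge0// lerDl.
have m0' : 0 < m%:R :> R by rewrite ltr0n.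
set g := 1 + gauss_m4 R.
have g0 : 0 < g by rewrite ltr_pwDl// /gauss_m4 Ex_ge0// => z; exact: exprn_even_ge0.
pose h := eta / (24 * m%:R * (L + 1)); pose dl := eta / (6 * m%:R * g * (L + 1)).
have h0 : 0 < h by rewrite divr_gt0// !mulr_gt0//; lra.
have dl0 : 0 < dl by rewrite divr_gt0// !mulr_gt0//; lra.
have L1 : L / (L + 1) <= 1 by rewrite ler_pdivrMr; lra.
have hh : m%:R * (4 * L * h) <= eta / 6.
  rewrite [leLHS](_ : _ = (eta / 6) * (L / (L + 1))); last by rewrite /h; field; lra.
  by rewrite ler_piMr//; lra.
have hd : m%:R * (g * (L * dl)) <= eta / 6.
  rewrite [leLHS](_ : _ = (eta / 6) * (L / (L + 1))); last by rewrite /dl; field; lra.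
  by rewrite ler_piMr//; lra.
pose C1 := L + m%:R * (g * (8 * L / h ^+ 2)).
pose C2 := 2 * M * (m%:R * (12 / e ^+ 4)) + m%:R * (g * (L / dl ^+ 3)).
have rest : C1 * mean_max X 2 n + C2 * vardefect X n @[n --> \oo] --> 0.
  rewrite (_ : 0 = C1 * 0 + C2 * 0); last by rewrite !mulr0 addr0.
  by apply: cvgD; apply: cvgMr => //; exact: vardefect_cvg0.
have /cvgrPdist_le /(_ (eta / 6) ltac:(lra)) rest' := rest.
near=> n.
have n0 : (0 < n)%N by near: n; exact: nbhs_infty_gt.
rewrite Ex_selfnorm//.
have A1 := interp_blocks_bound iidX symX L0 PL PM e0 n0 m0.
have A2 := block_clt_bound iidX symX bmW L0 PL PM h0 dl0 n0 m0.
have A3 : C1 * mean_max X 2 n + C2 * vardefect X n <= eta / 6.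
  rewrite (le_trans (ler_norm _))// -normrN -sub0r; near: n; exact: rest'.
rewrite distrC.
move: A1 A2 mW; move: (Ex _ _) (Ex _ _) (Ex _ _) (Ex _ _) => A B D F.
move=> A1 A2 A4.
rewrite (_ : F - A = (F - D) + (D - B) + (B - A)); last by ring.
rewrite (le_trans (ler_normD _ _))// (le_trans (lerD (ler_normD _ _) (lexx _)))//.
rewrite [ `|B - A| ]distrC.
apply: (le_trans (lerD (lerD A1 A2) A4)).
have E1 : L * (2 * e + mean_max X 2 n) + 2 * M * (m%:R * (12 / e ^+ 4 * (vardefect X n +
  1 / m%:R ^+ 2))) +
  m%:R * (4 * L * h + g * (8 * L / h ^+ 2 * mean_max X 2 n + L * (dl + vardefect X n / dl ^+ 3))) =
  L * (2 * e) + 2 * M * (12 / e ^+ 4) * m%:R^-1 + m%:R * (4 * L * h) + m%:R * (g * (L * dl)) +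
  (C1 * mean_max X 2 n + C2 * vardefect X n).
  rewrite /C1 /C2; field; lra.
rewrite E1; lra.
Unshelve. all: by end_near. Qed.

End donsker_limit.

(** * Characteristic functions and limit laws *)

Section trigonometric_bounds.
Context (R : realType).
Implicit Types (u t : R).

Lemma lip_is_derive (f df : R -> R) (L : R) : (forall x : R, is_derive x 1 f (df x)) ->
  (forall x, `|df x| <= L) -> lip L f.
Proof.
move=> fdf dfL x y.
wlog xy : x y / x <= y.
  move=> H; case: (leP x y) => [xy|/ltW xy]; first exact: H.
  by rewrite distrC [ `|x - y| ]distrC; exact: H.
have cf : {within `[x, y], continuous f}.
  apply: derivable_within_continuous => z _; by have [] := fdf z.
have [c _ fE] := MVT_segment xy (fun z _ => fdf z) cf.
by rewrite distrC fE normrM [ `|x - y| ]distrC ler_wpM2r.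
Qed.

Lemma lip_cos : lip 1 (@cos R).
Proof.
by apply: (@lip_is_derive _ (fun x => - sin x)) => x; rewrite normrN sin_max.
Qed.

Lemma lip_sin : lip 1 (@sin R).
Proof. by apply: (@lip_is_derive _ (@cos R)) => x; exact: cos_max. Qed.

Lemma lip_cosM t : 0 <= t -> lip t (fun z => cos (t * z)).
Proof.
move=> t0 x y; rewrite (le_trans (lip_cos _ _))// mul1r -mulrBr normrM.
by rewrite (ger0_norm t0).
Qed.

Lemma blip_cosM t : blip (fun z => cos (t * z)).
Proof.
split; last by exists 1 => x; exact: cos_max.
by exists `|t| => x y; rewrite (le_trans (lip_cos _ _))// mul1r -mulrBr normrM.
Qed.

Lemma norm_sin_le u : `|sin u| <= `|u|.
Proof. by have := lip_sin u 0; rewrite sin0 !subr0 mul1r. Qed.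

Lemma cosB1E u : 1 - cos u = 2 * sin (u / 2) ^+ 2.
Proof.
rewrite {1}(_ : u = (u / 2) *+ 2); last by rewrite mulr2n; field.
by rewrite cos_mulr2n -[X in X + _](cos2Dsin2 (u / 2)) mulr2n; have := cos2Dsin2 (u / 2) => h; lra.
Qed.

Lemma cosB1_le u : 1 - cos u <= u ^+ 2 / 2.
Proof.
rewrite cosB1E; have := norm_sin_le (u / 2).
rewrite -ler_sqr ?nnegrE// !real_normK ?num_real// => h.
by apply: le_trans (ler_wpM2l _ h) _ => //; rewrite le_eqVlt; apply/orP; left; apply/eqP; field.
Qed.

Lemma cosB1_ge u : `|u| <= 1 -> u ^+ 2 / 8 <= 1 - cos u.
Proof.
move=> u1; rewrite cosB1E; set v := u / 2.
have -> : u ^+ 2 / 8 = 2 * (`|v| / 2) ^+ 2.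
  by rewrite expr_div_n real_normK ?num_real// /v; field.
rewrite ler_wpM2l//.
have v1 : `|v| <= 1 by rewrite /v normrM (ger0_norm (_ : 0 <= 2^-1))//; move: u1; lra.
suff : `|v| / 2 <= `|sin v|.
  by move=> h; rewrite -(real_normK (num_real (sin v))) lerXn2r ?nnegrE ?divr_ge0.
have -> : `|sin v| = `|sin `|v| |.
  case: (leP 0 v) => [v0|v0]; first by rewrite (ger0_norm v0).
  by rewrite (ltr0_norm v0) sinN normrN.
move: v1; have := normr_ge0 v; move: `|v| => w w0 w1.
have cs : {within `[0, w], continuous (@sin R)}.
  by apply: derivable_within_continuous => z _; exact: derivable_sin.
have [c] := MVT_segment w0 (fun z _ => is_derive_sin z) cs.
rewrite in_itv/= sin0 !subr0 => /andP[c0 cw] ->.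
have c2 : c ^+ 2 <= 1 by rewrite expr_le1// (le_trans cw).
have := cosB1_le c => h.
have : 1 / 2 <= cos c by lra.
move=> h2; rewrite (le_trans _ (ler_norm _))// mulrC ler_wpM2r//; lra.
Qed.

End trigonometric_bounds.

Section law_transfer.
Context (R : realType).

Lemma Ex_eq_dist d (T : measurableType d) (P : probability T R)
    d' (T' : measurableType d') (P' : probability T' R)
    (g : T -> R) (g' : T' -> R) (f : R -> R) :
  measurable_fun [set: T] g -> measurable_fun [set: T'] g' ->
  (forall A : set R, measurable A -> P (g @^-1` A) = P' (g' @^-1` A)) ->
  bmeas (f : measurableTypeR R -> R) ->
  Ex P (fun w => f (g w)) = Ex P' (fun w => f (g' w)).
Proof.
move=> mg mg' gg' bf.
pose G : {RV P >-> measurableTypeR R} :=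
  MeasurableFun.Pack (MeasurableFun.Class (isMeasurableFun.Build _ _ _ (measurableTypeR R) g mg)).
pose G' : {RV P' >-> measurableTypeR R} :=
  MeasurableFun.Pack (MeasurableFun.Class (isMeasurableFun.Build _ _ _ (measurableTypeR R) g' mg')).
rewrite -[LHS](Ex_distribution G bf) -[RHS](Ex_distribution G' bf).
by apply: eq_Ex_measure => A mA; exact: gg'.
Qed.

Lemma Ex_eq0_ae d (T : measurableType d) (P : probability T R) (f : T -> R) :
  bmeas f -> (forall x, 0 <= f x) -> Ex P f = 0 -> {ae P, forall x, f x = 0}.
Proof.
move=> bf f0 E0; have [mf _] := bf.
apply: filterS ((ae_eq_integral_abs P measurableT (f := EFin \o f) _).1 _).
- by move=> x /(_ I) []; exact.
- exact/measurable_EFinP.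
transitivity (0%:E : \bar R) => //.
rewrite -E0 -expectation_Ex// unlock; apply: eq_integral => x _.
by rewrite /= ger0_norm.
Qed.

End law_transfer.

(** * Squared moduli of characteristic functions *)

Section characteristic_function.
Context (R : realType).
Implicit Types (t c m : R).

(* The squared modulus of the characteristic function of [g]; it is blind to
   translations of [g]. *)
Definition cf2 d (T : measurableType d) (P : probability T R) (g : T -> R) t : R :=
  Ex P (fun w => cos (t * g w)) ^+ 2 + Ex P (fun w => sin (t * g w)) ^+ 2.

Let bcos d (T : measurableType d) (g : T -> R) t : measurable_fun [set: T] g ->
  bmeas (fun w => cos (t * g w)).
Proof. by move=> mg; apply: bmeas_cos; exact: measurable_funM. Qed.

Let bsin d (T : measurableType d) (g : T -> R) t : measurable_fun [set: T] g ->
  bmeas (fun w => sin (t * g w)).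
Proof. by move=> mg; apply: bmeas_sin; exact: measurable_funM. Qed.

Section one_variable.
Context d (T : measurableType d) (P : probability T R) (g : T -> R).
Hypothesis mg : measurable_fun [set: T] g.

Lemma cf2_ge0 t : 0 <= cf2 P g t.
Proof. by rewrite addr_ge0// sqr_ge0. Qed.

Lemma Ex_trig t a b : Ex P (fun w => a * cos (t * g w) + b * sin (t * g w)) =
  a * Ex P (fun w => cos (t * g w)) + b * Ex P (fun w => sin (t * g w)).
Proof.
have bc := bcos t mg; have bs := bsin t mg.
by rewrite ExD; [rewrite ExZ// ExZ|exact: bmeasZ|exact: bmeasZ].
Qed.

Lemma cf2_affine c m t : cf2 P (fun w => c * g w + m) t = cf2 P g (c * t).
Proof.
rewrite /cf2.
have -> : Ex P (fun w => cos (t * (c * g w + m))) =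
    Ex P (fun w => cos (t * m) * cos (c * t * g w) + (- sin (t * m)) * sin (c * t * g w)).
  apply: eq_Ex => w; rewrite mulrDr cosD (_ : t * (c * g w) = c * t * g w); last by ring.
  by ring.
have -> : Ex P (fun w => sin (t * (c * g w + m))) =
    Ex P (fun w => sin (t * m) * cos (c * t * g w) + cos (t * m) * sin (c * t * g w)).
  apply: eq_Ex => w; rewrite mulrDr sinD (_ : t * (c * g w) = c * t * g w); last by ring.
  by ring.
rewrite !Ex_trig; move: (Ex _ _) (Ex _ _) => A B.
rewrite -[RHS]mul1r -(cos2Dsin2 (t * m)); ring.
Qed.

(** Cauchy-Schwarz in linear form: the combination of cosine and sine with coefficients [A], [B] is
    pointwise at most [(A ^+ 2 + B ^+ 2 + 1) / 2] and has mean [A ^+ 2 + B ^+ 2]. *)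
Lemma cf2_le1 t : cf2 P g t <= 1.
Proof.
set A := Ex P (fun w => cos (t * g w)); set B := Ex P (fun w => sin (t * g w)).
have h : A * A + B * B <= (A ^+ 2 + B ^+ 2 + 1) / 2.
  rewrite -[leLHS]Ex_trig; apply: Ex_le_cst.
    by apply: bmeasD; apply: bmeasZ; [exact: bcos|exact: bsin].
  move=> w; have := cos2Dsin2 (t * g w); move: (cos _) (sin _) => u v.
  have := sqr_ge0 (A - u); have := sqr_ge0 (B - v); lra.
rewrite /cf2 -/A -/B; move: h; rewrite -!expr2; lra.
Qed.

Lemma cf2_cvg (u : nat -> R) : u n @[n --> \oo] --> 0 -> cf2 P g (u n) @[n --> \oo] --> (1 : R).
Proof.
move=> u0.
have ug w : u n * g w @[n --> \oo] --> 0 by rewrite -(mul0r (g w)); exact: cvgMl.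
have c1 : Ex P (fun w => cos (u n * g w)) @[n --> \oo] --> (1 : R).
  rewrite -(Ex_cst P 1); apply: (@Ex_cvg _ _ _ P _ _ 1) => //.
  - by move=> n; case: (bcos (u n) mg).
  - by move=> n w; exact: cos_max.
  by move=> w; rewrite -(cos0 R); apply: continuous_cvg => //; exact: continuous_cos.
have s0 : Ex P (fun w => sin (u n * g w)) @[n --> \oo] --> 0.
  rewrite -(Ex_cst P 0); apply: (@Ex_cvg _ _ _ P _ _ 1) => //.
  - by move=> n; case: (bsin (u n) mg).
  - by move=> n w; exact: sin_max.
  by move=> w; rewrite -(sin0 R); apply: continuous_cvg => //; exact: continuous_sin.
rewrite (_ : 1 = 1 * 1 + 0 * 0); last by ring.
by apply: cvgD; rewrite /= ?expr2; under eq_fun do rewrite expr2; apply: cvgM.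
Qed.

(* If the modulus of the characteristic function is 1 at [t] then [g] is almost
   surely constant modulo [2 * pi / t]; this for small [t] makes [g] constant. *)
Lemma cf2_degenerate (u : nat -> R) : u n @[n --> \oo] --> 0 -> (forall n, 0 < u n) ->
  (forall n, cf2 P g (u n) = 1) -> exists c, {ae P, forall w, g w = c}.
Proof.
move=> u0 un h1.
pose A n := Ex P (fun w => cos (u n * g w)); pose B n := Ex P (fun w => sin (u n * g w)).
have ae1 n : {ae P, forall w, cos (u n * g w) = A n /\ sin (u n * g w) = B n}.
  (* When [A n ^+ 2 + B n ^+ 2 = 1] this nonnegative function has mean 0, so the pair of cosine and
     sine is almost surely constant. *)
  have bf : bmeas (fun w => 1 - (A n * cos (u n * g w) + B n * sin (u n * g w))).
    apply: bmeasB; first exact: bmeas_cst.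
    by apply: bmeasD; apply: bmeasZ; [exact: bcos|exact: bsin].
  have AB : A n ^+ 2 + B n ^+ 2 = 1 by exact: h1.
  have f0 w : 0 <= 1 - (A n * cos (u n * g w) + B n * sin (u n * g w)).
    have := cos2Dsin2 (u n * g w); move: (cos _) (sin _) AB => a b AB.
    have := sqr_ge0 (A n - a); have := sqr_ge0 (B n - b); lra.
  apply: filterS (Ex_eq0_ae bf f0 _) => [w|].
    have := cos2Dsin2 (u n * g w); move: (cos _) (sin _) AB => a b AB ab E.
    have : (A n - a) ^+ 2 + (B n - b) ^+ 2 = 0 by lra.
    move/eqP; rewrite paddr_eq0 ?sqr_ge0// !sqrf_eq0 !subr_eq0 => /andP[/eqP-> /eqP->].
    by [].
  rewrite ExB; [|exact: bmeas_cst|by apply: bmeasD; apply: bmeasZ; [exact: bcos|exact: bsin]].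
  rewrite Ex_cst Ex_trig -/(A n) -/(B n); move: AB; rewrite !expr2 => ->; ring.
have ae2 : {ae P, forall w, forall n, cos (u n * g w) = A n /\ sin (u n * g w) = B n}.
  by apply/ae_foralln.
have [w0 hw0] : exists w, forall n, cos (u n * g w) = A n /\ sin (u n * g w) = B n.
  apply: contrapT => /forallNP H.
  have : Ex P (fun=> 0) = Ex P (fun=> 1 : R).
    by apply: Ex_ae; [exact: bmeas_cst|exact: bmeas_cst|apply: filterS ae2 => w /H].
  by rewrite !Ex_cst => /esym /eqP; rewrite oner_eq0.
exists (g w0); apply: filterS ae2 => w hw.
(* Otherwise the angles [u n * (g w - g w0)] are nonzero, have cosine 1 for all [n], and tend to 0,
   against [cosB1_ge]. *)
apply/eqP; rewrite -subr_eq0; apply/negPn/negP => gw.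
have cos1 n : cos (u n * (g w - g w0)) = 1.
  rewrite mulrBr cosB; have [-> ->] := hw n; have [-> ->] := hw0 n.
  by rewrite -!expr2; exact: h1.
have h0 : u n * (g w - g w0) @[n --> \oo] --> 0.
  by rewrite -(mul0r (g w - g w0)); exact: cvgMl.
have /cvgr0Pnorm_le /(_ 1 ltr01) [N _ hN] := h0.
have := cosB1_ge (hN N (leqnn N)); rewrite cos1 subrr.
have : 0 < (u N * (g w - g w0)) ^+ 2.
  by rewrite lt_def sqr_ge0 sqrf_eq0 mulf_neq0// gt_eqF.
lra.
Qed.

End one_variable.

Lemma cf2_product d (T : measurableType d) (P : probability T R) (g : T -> R)
    d' (T' : measurableType d') (P' : probability T' R) (g' : T' -> R) t :
  measurable_fun [set: T] g -> measurable_fun [set: T'] g' ->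
  cf2 (product_prob P P') (fun z => g z.1 + g' z.2) t = cf2 P g t * cf2 P' g' t.
Proof.
move=> mg mg'.
have mgg : measurable_fun [set: T * T'] (fun z => g z.1 + g' z.2).
  by apply: measurable_funD; apply: measurableT_comp => //;
    exact: measurable_fst || exact: measurable_snd.
rewrite /cf2 (Ex_product_prob P P' (bcos t mgg)) (Ex_product_prob P P' (bsin t mgg)).
set A := Ex P' (fun w => cos (t * g' w)); set B := Ex P' (fun w => sin (t * g' w)).
have -> : Ex P (fun x => Ex P' (fun y => cos (t * (g x + g' y)))) =
    Ex P (fun x => A * cos (t * g x) + (- B) * sin (t * g x)).
  apply: eq_Ex => x; transitivity (Ex P' (fun y => cos (t * g x) * cos (t * g' y) +
      (- sin (t * g x)) * sin (t * g' y))).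
    by apply: eq_Ex => y; rewrite mulrDr cosD mulNr.
  by rewrite Ex_trig//; rewrite -/A -/B; ring.
have -> : Ex P (fun x => Ex P' (fun y => sin (t * (g x + g' y)))) =
    Ex P (fun x => B * cos (t * g x) + A * sin (t * g x)).
  apply: eq_Ex => x; transitivity (Ex P' (fun y => sin (t * g x) * cos (t * g' y) +
      cos (t * g x) * sin (t * g' y))).
    by apply: eq_Ex => y; rewrite mulrDr sinD.
  by rewrite Ex_trig//; rewrite -/A -/B; ring.
by rewrite !Ex_trig//; ring.
Qed.

End characteristic_function.

Lemma cvg_in_law_Ex (R : realType) (S : topologicalType)
    d (T : measurableType d) (P : probability T R) (Z : nat -> T -> S)
    d' (T' : measurableType d') (Q : probability T' R) (W : T' -> S) (Phi : S -> R) :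
  cvg_in_law P Z Q W -> continuous Phi -> (exists M : R, forall x, `|Phi x| <= M) ->
  (forall n, measurable_fun [set: T] (Phi \o Z n)) -> measurable_fun [set: T'] (Phi \o W) ->
  Ex P (Phi \o Z n) @[n --> \oo] --> Ex Q (Phi \o W).
Proof.
move=> ZW cP [M PM] mZ mW; have := ZW Phi cP (ex_intro _ M PM).
have bW : bmeas (Phi \o W) by split => //; exists M => w; exact: PM.
have bZ n : bmeas (Phi \o Z n) by split => //; exists M => w; exact: PM.
rewrite (expectation_Ex _ bW) => H.
have {}H : (Ex P (Phi \o Z n))%:E @[n --> \oo] --> (Ex Q (Phi \o W))%:E.
  by apply: cvg_trans H; apply: near_eq_cvg; apply: nearW => n; rewrite expectation_Ex.
exact: fine_cvg H.
Qed.

(** * Functional equations satisfied by the limit laws *)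

Section limit_laws.
Context (R : realType).
Implicit Types (mu : probability (measurableTypeR R) R) (alpha t : R).
Local Notation id := (fun x : R => x).
Local Notation gauss := (@gauss R).

(** Stability with [a = b = 1]: the sum of two independent copies has the law of [c * U + m], and
    [cf2] ignores the shift [m]. *)
Lemma stable_law_cf2 alpha mu t : stable_law alpha mu ->
  cf2 mu id (2 `^ alpha^-1 * t) = cf2 mu id t ^+ 2.
Proof.
move=> /(_ 1 1 ltr01 ltr01) [m]; rewrite powR1 => muE; set c := _ `^ _ in muE *.
have mI : measurable_fun [set: measurableTypeR R] id by exact: measurable_id.
rewrite -(cf2_affine mu mI c m t) expr2 -(cf2_product mu mu t mI mI).
have mcm : measurable_fun [set: measurableTypeR R] (fun x : R => c * x + m).
  by apply: measurable_funD => //; exact: measurable_funM.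
have mfs : measurable_fun [set: measurableTypeR R * measurableTypeR R] (fun z : R * R => z.1 + z.2).
  by apply: measurable_funD; [exact: measurable_fst|exact: measurable_snd].
have eqE f : bmeas (f : measurableTypeR R -> R) ->
    Ex mu (fun x : R => f (c * x + m)) = Ex (product_prob mu mu) (fun z : R * R => f (z.1 + z.2)).
  move=> bf; apply/esym; apply: Ex_eq_dist => // A mA; rewrite -[RHS]muE//.
  by congr (_ _); apply/seteqP; split => z /=; rewrite !mul1r.
rewrite /cf2; congr (_ ^+ 2 + _ ^+ 2).
  by apply: (eqE (fun y => cos (t * y))); apply: bmeas_cos; exact: measurable_funM.
by apply: (eqE (fun y => sin (t * y))); apply: bmeas_sin; exact: measurable_funM.
Qed.

Lemma normal_probN m s (A : set (measurableTypeR R)) : normal_prob m (- s) A = normal_prob m s A.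
Proof.
rewrite /normal_prob; apply: eq_integral => x _; congr EFin.
by rewrite /normal_pdf oppr_eq0 /normal_fun /normal_peak sqrrN.
Qed.

Lemma normal_law_gauss mu : normal_law mu -> exists s, [/\ 0 < s,
  forall c, mu [set c] = 0%E & forall t, cf2 mu id t = cf2 gauss id (s * t)].
Proof.
move=> [m [s [s0 muE]]]; exists `|s|; split; first by rewrite normr_gt0.
  move=> c; rewrite muE//.
  have /null_content_dominatesP := @normal_prob_dominates R m s; apply => //.
  exact: lebesgue_measure_set1.
have muE' A : measurable A -> mu A = normal_prob m `|s| A.
  move=> mA; transitivity (normal_prob m s A); first exact: muE.
  case: (leP 0 s) => h; first by rewrite (ger0_norm h).
  by rewrite (ltr0_norm h); exact/esym/normal_probN.
have s1 : 0 < `|s| by rewrite normr_gt0.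
move=> t; have mI : measurable_fun [set: measurableTypeR R] id by exact: measurable_id.
rewrite -(cf2_affine gauss mI `|s| m t) /cf2.
congr (_ ^+ 2 + _ ^+ 2); rewrite (eq_Ex_measure _ muE') Ex_normal//.
- by apply: eq_Ex => z; rewrite addrC.
- by apply: bmeas_cos; exact: measurable_funM.
- by apply: eq_Ex => z; rewrite addrC.
- by apply: bmeas_sin; exact: measurable_funM.
Qed.

Lemma gauss_sin t : Ex gauss (fun z : R => sin (t * z)) = 0.
Proof.
have bs : bmeas (fun z : measurableTypeR R => sin (t * z)).
  by apply: bmeas_sin; exact: measurable_funM.
have := Ex_gauss_opp bs.
rewrite (_ : Ex gauss (fun z => sin (t * - z)) = - Ex gauss (fun z => sin (t * z))).
  by move=> h; move: (Ex _ _) h => A; lra.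
rewrite -ExN//; apply: eq_Ex => z; by rewrite mulrN sinN.
Qed.

Lemma nondegenerate_gauss : Defs.nondegenerate gauss.
Proof.
move=> c; have /null_content_dominatesP H := @normal_prob_dominates R 0 1.
rewrite [LHS](H [set c])//; last exact: lebesgue_measure_set1.
by apply/eqP; rewrite eq_sym onee_eq0.
Qed.

Lemma nondegenerate_cf2 mu : Defs.nondegenerate mu -> exists2 t, 0 < t & cf2 mu id t < 1.
Proof.
move=> ndg; apply: contrapT => H.
have mI : measurable_fun [set: measurableTypeR R] id by exact: measurable_id.
have h1 t : 0 < t -> cf2 mu id t = 1.
  move=> t0; apply/eqP; rewrite eq_le cf2_le1//= leNgt; apply/negP => h.
  by apply: H; exists t.
have u0 : (n.+1%:R : R)^-1 @[n --> \oo] --> 0.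
  apply/cvgr0Pnorm_lt => e e0; near=> n.
  rewrite ger0_norm//; near: n.
  have [N _ hN] := near_infty_invn_lt e0.
  by exists N => // n /= Nn; apply: hN; rewrite /= leqW.
have un n : 0 < (n.+1%:R^-1 : R) by rewrite invr_gt0.
have [c aec] := cf2_degenerate mI u0 un (fun n => h1 _ (un n)).
apply: (ndg c).
have : Ex mu (\1_[set c]) = Ex mu (fun=> 1).
  apply: Ex_ae; [|exact: bmeas_cst|].
    split; first exact: measurable_indic.
    by exists 1 => x; rewrite indicE ger0_norm// lern1 leq_b1.
  by apply: filterS aec => x ->; rewrite indicE mem_set.
rewrite Ex_indic// Ex_cst => E1.
by rewrite -[LHS]fineK ?fin_num_measure// E1.
Unshelve. all: by end_near. Qed.

Context d' (T' : measurableType d') (Q : probability T' R) (W : T' -> C01 R).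
Hypothesis bmW : standard_BM Q W.

(** The Gaussian characteristic function is never computed: [gavg t] multiplies [cos] by a constant,
    and by [gavg_comp] applying it twice is [gavg (Num.sqrt 2 * t)]. *)
Lemma gauss_cf2 t : 0 <= t -> cf2 gauss id (Num.sqrt 2 * t) = cf2 gauss id t ^+ 2.
Proof.
move=> t0; rewrite /cf2 !gauss_sin expr0n/= !addr0; congr (_ ^+ 2).
have bc : blip (@cos R) by have := blip_cosM (1 : R); under eq_fun do rewrite mul1r.
have gavgE u : 0 <= u -> Ex gauss (fun z : R => cos (u * z)) = gavg u (@cos R) 0.
  by move=> _; apply: eq_Ex => z; rewrite add0r.
rewrite !gavgE// ?mulr_ge0 ?sqrtr_ge0//.
have := gavg_comp bmW 0 bc t0 t0.
have -> : Num.sqrt (t ^+ 2 + t ^+ 2) = Num.sqrt 2 * t.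
  have -> : t ^+ 2 + t ^+ 2 = 2 * t ^+ 2 by ring.
  rewrite sqrtrM; last exact: ler0n.
  by congr (_ * _); rewrite sqrtr_sqr ger0_norm.
move=> <-.
have Gac a : gavg t (@cos R) a = gavg t (@cos R) 0 * cos a.
  transitivity (Ex gauss (fun z : R => cos a * cos (t * z) + (- sin a) * sin (t * z))).
    by apply: eq_Ex => z; rewrite cosD mulNr.
  have mI : measurable_fun [set: measurableTypeR R] id by exact: measurable_id.
  by rewrite (Ex_trig gauss mI) gauss_sin mulr0 addr0 mulrC gavgE.
transitivity (Ex gauss (fun z : R => gavg t (@cos R) 0 * cos (t * z))).
  by rewrite {1}/gavg; apply: eq_Ex => z; rewrite add0r Gac.
rewrite ExZ; first by rewrite expr2 gavgE.
by apply: bmeas_cos; exact: measurable_funM.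
Qed.

Lemma limit_law_cf2 alpha mu : limit_law alpha mu -> Defs.nondegenerate mu /\
  forall t, 0 <= t -> cf2 mu id (2 `^ alpha^-1 * t) = cf2 mu id t ^+ 2.
Proof.
rewrite /limit_law; case: eqP => [->|_] => [/normal_law_gauss [s [s0 mu0 muE]]|[st ndg]].
  split; first by move=> c; rewrite mu0 => /eqP; rewrite eq_sym onee_eq0.
  move=> t t0; rewrite !muE -(gauss_cf2 (mulr_ge0 (ltW s0) t0)) -powR12_sqrt//.
  by rewrite mulrCA.
by split => // t _; exact: stable_law_cf2.
Qed.

End limit_laws.

Section partial_sums.
Context (R : realType) d (T : measurableType d) (P : probability T R).
Variable X : nat -> {RV P >-> R}.
Hypotheses (iidX : iid X) (symX : forall i, symmetric_RV (X i)).
Local Notation E := (Ex (law X)).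
Implicit Types (x : seqR R) (f : R -> R).

Definition psum n (x : nat -> R) : R := \sum_(i < n) x i.

Definition charfun (s : R) : R := Ex P (fun w => cos (s * X 0%N w)).

Lemma measurable_psum n : measurable_fun [set: seqR R] (psum n : seqR R -> R).
Proof. by apply: measurable_sum => i; exact: measurable_coord. Qed.

Lemma Ex_psum_rad n f : bmeas (fun x : seqR R => f (psum n x)) ->
  bmeas (fun x : seqR R => rad n 0 f x 0) /\
  E (fun x => f (psum n x)) = E (fun x => rad n 0 f x 0).
Proof.
move=> bf; have [bs Es] := law_savg iidX symX n 0 bf.
have H : savg n 0 (fun y => f (psum n y)) = fun x => rad n 0 f x 0.
  apply/funext => x; rewrite -savg_rad; apply: eq_savg => y _.
  by rewrite add0r add0n /psum big_mkord.
by rewrite H in bs Es; rewrite Es.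
Qed.

Lemma Ex_cos_psum n s : E (fun x => cos (s * psum n x)) = charfun s ^+ n.
Proof.
have bc : bmeas (fun x : seqR R => cos (s * psum n x)).
  by apply: bmeas_cos; apply: measurable_funM => //; exact: measurable_psum.
have [_ ->] := Ex_psum_rad (f := fun u => cos (s * u)) bc.
have bcs : bmeas (fun z : R => cos (s * z)) by apply: bmeas_cos; exact: measurable_funM.
have := EX_prod iidX n bcs; rewrite /EX /sampled => <-.
rewrite (Ex_sample X (F := fun x => \prod_(i < n) cos (s * x i))).
  by apply: eq_Ex => x; rewrite rad_cos mulr0 cos0 mul1r add0n big_mkord.
apply: bmeas_prod => i _; apply: bmeas_cos; apply: measurable_funM => //.
exact: measurable_coord.
Qed.

Lemma psum_sym n f : bmeas (fun x : seqR R => f (psum n x)) ->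
  bmeas (fun x : seqR R => f (- psum n x)) ->
  E (fun x => f (- psum n x)) = E (fun x => f (psum n x)).
Proof.
move=> bf bf'; have [_ ->] := Ex_psum_rad (f := fun u => f (- u)) bf'.
have [_ ->] := Ex_psum_rad bf; apply: eq_Ex => x.
have := rad_reflect n 0 f x 0 0; rewrite addr0 subr0 => ->.
by congr rad; apply/funext => u; rewrite mulr0 sub0r.
Qed.

Lemma Ex_sin_psum n s : E (fun x => sin (s * psum n x)) = 0.
Proof.
have bs s' : bmeas (fun x : seqR R => sin (s' * psum n x)).
  by apply: bmeas_sin; apply: measurable_funM => //; exact: measurable_psum.
have := psum_sym (f := fun u => sin (s * u)) (bs s) _.
have bN : bmeas (fun x : seqR R => sin (s * - psum n x)).
  by apply: eq_bmeas (bs (- s)) => x; rewrite mulrN mulNr.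
move=> /(_ bN); rewrite (_ : E (fun x => sin (s * - psum n x)) = - E (fun x => sin (s * psum n x))).
  by move: (Ex _ _) => A h; lra.
by rewrite -ExN; [apply: eq_Ex => x; rewrite mulrN sinN|exact: bs].
Qed.

(** Symmetry kills the sine part and the modulus ignores [b], so attraction with any centring
    becomes a statement on powers of [charfun]. *)
Lemma cf2_psum n s a b : cf2 (law X) (fun x => (psum n x - b) / a) s = (charfun (s / a) ^+ n) ^+ 2.
Proof.
have mS := measurable_psum n.
have -> : (fun x => (psum n x - b) / a) = fun x : seqR R => a^-1 * psum n x + - b / a.
  by apply/funext => x; ring.
by rewrite cf2_affine// /cf2 Ex_sin_psum expr0n/= addr0 [a^-1 * s]mulrC Ex_cos_psum.
Qed.

End partial_sums.

Section domain_of_attraction.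
Context (R : realType) d (T : measurableType d) (P : probability T R).
Variable X : nat -> {RV P >-> R}.
Hypotheses (iidX : iid X) (symX : forall i, symmetric_RV (X i)).
Context d' (T' : measurableType d') (Q : probability T' R) (W : T' -> C01 R).
Hypothesis bmW : standard_BM Q W.
Local Notation E := (Ex (law X)).

Let mI : measurable_fun [set: measurableTypeR R] (fun x : R => x).
Proof. exact: measurable_id. Qed.

Lemma in_DA_Ex (mu : probability (measurableTypeR R) R) a b :
  cvg_in_law P (fun n w => (\sum_(i < n) X i w - b n) / a n) mu (fun x : R => x) ->
  forall f, blip f -> E (fun x => f ((psum n x - b n) / a n)) @[n --> \oo] --> Ex mu f.
Proof.
move=> cl f bf.
have mZ n : measurable_fun [set: seqR R] (fun x : seqR R => (psum n x - b n) / a n).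
  by apply: measurable_funM => //; apply: measurable_funB => //; exact: measurable_psum.
have mZ' n : measurable_fun [set: T] (fun w => (\sum_(i < n) X i w - b n) / a n).
  apply: measurable_funM => //; apply: measurable_funB => //.
  by apply: measurable_sum => i.
have cf := blip_continuous bf.
have := cvg_in_law_Ex cl cf bf.2 (fun n => (bmeas_blip bf (mZ' n)).1) (bmeas_blip bf mI).1.
apply: cvg_trans; apply: near_eq_cvg; apply: nearW => n.
have <- := Ex_sample X (bmeas_blip bf (mZ n)).
by [].
Qed.

Definition tight_sums (a : nat -> R) := forall e : R, 0 < e -> exists2 K, 0 < K &
  \forall n \near \oo, E (fun x => (K * a n < `|psum n x|)%R%:R) <= e.

Lemma blip_clamp (K : R) : blip (fun z : R => clamp01 (`|z| - K)).
Proof.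
split; last by exists 1 => x; have /andP[h1 h2] := clamp01_itv (`|x| - K); rewrite ger0_norm.
exists 1 => x y; rewrite (le_trans (clamp01_lip _ _))// !mul1r.
rewrite (_ : `|x| - K - (`|y| - K) = `|x| - `|y|); last by ring.
exact: ler_dist_dist.
Qed.

Lemma clamp_cvg0 d1 (T1 : measurableType d1) (P1 : probability T1 R) (g : T1 -> R) :
  measurable_fun [set: T1] g -> Ex P1 (fun w => clamp01 (`|g w| - K%:R)) @[K --> \oo] --> 0.
Proof.
move=> mg; rewrite -(Ex_cst P1 0); apply: (@Ex_cvg _ _ _ P1 _ _ 1) => //.
- by move=> n; case: (bmeas_blip (blip_clamp n%:R) mg).
- by move=> n w; have /andP[h1 h2] := clamp01_itv (`|g w| - n%:R); rewrite ger0_norm.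
move=> w; apply/cvgrPdist_le => e e0; near=> n.
have gn : `|g w| - n%:R <= 0 by rewrite subr_le0; near: n; exact: nbhs_infty_ger.
by rewrite clamp01E gn subrr normr0 ltW.
Unshelve. all: by end_near. Qed.

(** The centring is removed by symmetry: [psum] and its opposite have the same law, and a large
    [psum] makes one of the two centred quotients large, since these differ by
    [2 * psum n x / a n]. *)
Lemma in_DA_tight (mu : probability (measurableTypeR R) R) a b : (forall n, 0 < a n) ->
  (forall f, blip f -> E (fun x => f ((psum n x - b n) / a n)) @[n --> \oo] --> Ex mu f) ->
  tight_sums a.
Proof.
move=> a0 cl e e0.
have /cvgrPdist_lt /(_ (e / 4) ltac:(lra)) [K _ /(_ K (leqnn K)) hK] := clamp_cvg0 mu mI.
have /cvgrPdist_lt /(_ (e / 4) ltac:(lra)) hn := cl _ (blip_clamp K%:R).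
exists (K%:R + 1); first by rewrite ltr_wpDl.
apply: filterS hn => n hn.
pose tau (z : R) := clamp01 (`|z| - K%:R).
have tau0 z : 0 <= tau z by have /andP[] := clamp01_itv (`|z| - K%:R).
have mS := @measurable_psum R n.
have bt (s : R) : bmeas (fun x : seqR R => tau ((s * psum n x - b n) / a n)).
  apply: (bmeas_blip (blip_clamp K%:R)); apply: measurable_funM => //.
  by apply: measurable_funB => //; exact: measurable_funM.
have symE : E (fun x => tau ((- psum n x - b n) / a n)) = E (fun x => tau ((psum n x - b n) / a n)).
  apply: (psum_sym iidX symX (f := fun u => tau ((u - b n) / a n))).
    by apply: eq_bmeas (bt 1) => x; rewrite mul1r.
  by apply: eq_bmeas (bt (- 1)) => x; rewrite mulN1r.
have b1 : bmeas (fun x : seqR R => tau ((psum n x - b n) / a n)).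
  by apply: eq_bmeas (bt 1) => x; rewrite mul1r.
have b2 : bmeas (fun x : seqR R => tau ((- psum n x - b n) / a n)).
  by apply: eq_bmeas (bt (- 1)) => x; rewrite mulN1r.
apply: (@le_trans _ _ (E (fun x => tau ((psum n x - b n) / a n) + tau ((- psum n x - b n) / a n)))).
  apply: Ex_le; [|exact: bmeasD|].
    by apply: bmeas_lt => //; exact: measurableT_comp.
  move=> x; case: ltP => h /=; last exact: addr_ge0.
  set u := (psum n x - b n) / a n; set v := (- psum n x - b n) / a n.
  have : K%:R + 1 < `|u| \/ K%:R + 1 < `|v|.
    have uv : (u - v) * a n = 2 * psum n x by rewrite /u /v; field; rewrite gt_eqF.
    have H2 : 2 * (K%:R + 1) < `|u - v|.
      rewrite -(ltr_pM2r (a0 n)) -{2}(ger0_norm (ltW (a0 n))) -normrM uv normrM.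
      by rewrite (ger0_norm (ler0n _ 2)) -mulrA ltr_pM2l.
    case: (ltP (K%:R + 1) `|u|) => hu; [by left|right].
    move: hu (lt_le_trans H2 (ler_normB u v)); clear; move: `|u| `|v| => A B h1 h2; lra.
  have t1 z : K%:R + 1 < `|z| -> tau z = 1.
    by move=> hz; rewrite /tau clamp01E; case: ifP => h1; [lra|rewrite ifT; lra].
  by case=> /t1 ->; rewrite ?lerDl ?lerDr.
rewrite ExD// symE.
have : Ex mu tau < e / 4.
  by move: hK; rewrite sub0r normrN => /(le_lt_trans (ler_norm _)).
move: hn; rewrite /= -/tau distrC => /(le_lt_trans (ler_norm _)); rewrite -/tau.
rewrite -[E (fun x => clamp01 _)]/(E (fun x => tau ((psum n x - b n) / a n))).
move: (Ex (law X) _) (Ex mu _) => A B; lra.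
Qed.

(** The only form in which attraction is used later; [h] is the [cf2] of the limit law. *)
Lemma in_DA_charfun alpha : in_DA alpha X -> exists (a : nat -> R) (h : R -> R),
  [/\ forall n, 0 < a n,
      forall t, (charfun X (t / a n) ^+ n) ^+ 2 @[n --> \oo] --> h t,
      (forall t, 0 <= t -> h (2 `^ alpha^-1 * t) = h t ^+ 2) /\ (exists2 t, 0 < t & h t < 1),
      (forall u : nat -> R, u n @[n --> \oo] --> 0 -> h (u n) @[n --> \oo] --> (1 : R)) /\
      (forall t, 0 <= h t <= 1) &
      tight_sums a].
Proof.
move=> [mu [a [b [llmu a0 /in_DA_Ex cl]]]].
exists a, (cf2 mu (fun x => x)); have [ndg hs] := limit_law_cf2 bmW llmu.
split => //.
- move=> t; rewrite /cf2.
  have bsin : blip (fun z : R => sin (t * z)).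
    split; last by exists 1 => x; exact: sin_max.
    by exists `|t| => x y; rewrite (le_trans (lip_sin _ _))// mul1r -mulrBr normrM.
  have : cf2 (law X) (fun x => (psum n x - b n) / a n) t @[n --> \oo] --> cf2 mu (fun x => x) t.
    rewrite /cf2; under eq_fun do rewrite !expr2; rewrite !expr2.
    have c1 := cl _ (blip_cosM t); have c2 := cl _ bsin.
    by apply: cvgD; apply: cvgM.
  by under eq_fun do rewrite (cf2_psum iidX symX).
- by split => //; have [t t0 ht] := nondegenerate_cf2 ndg; exists t.
- split; first by move=> u u0; exact: cf2_cvg.
  by move=> t; rewrite cf2_ge0 cf2_le1.
- exact: in_DA_tight a0 cl.
Qed.

End domain_of_attraction.

Section sample_tightness.
Context (R : realType) d (T : measurableType d) (P : probability T R).
Variable X : nat -> {RV P >-> R}.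
Hypotheses (iidX : iid X) (symX : forall i, symmetric_RV (X i)).
Local Notation E := (Ex (law X)).
Implicit Types (x : seqR R) (f : R -> R).

Lemma Ex_coord i f : bmeas (f : measurableTypeR R -> R) ->
  E (fun x => f (x i)) = Ex P (fun w => f (X 0%N w)).
Proof.
move=> bf; have bfi j : bmeas (fun x : seqR R => f (x j)).
  by apply: bmeas_comp; [case: bf|exact: bf.2|exact: measurable_coord].
rewrite -(law_swap iidX 0 i (bfi i)) -[LHS]/(E (fun x => f (swap 0 i x i))).
transitivity (E (fun x => f (x 0%N))); last by rewrite -Ex_sample.
by apply: eq_Ex => x; rewrite /swap /swapn eqxx; case: eqP => // ->.
Qed.

(** Given the absolute values, the sum is at least half of the norm in modulus with probability at
    least 1/6, by [rad_anticoncentration]; a large norm thus forces a large sum in a fixed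
    proportion of cases. *)
Lemma tight_sums_Vnorm (a : nat -> R) : (forall n, 0 < a n) -> tight_sums X a ->
  forall e : R, 0 < e -> exists2 K, 0 < K &
  \forall n \near \oo, E (fun x => (K * a n < Vnorm 2 n x)%R%:R) <= e.
Proof.
move=> a0 tS e e0; have [K K0 hK] := tS (e / 6) ltac:(lra).
exists (2 * K); first by rewrite mulr_gt0.
apply: filterS hK => n hK.
have bS : bmeas (fun x : seqR R => (K * a n < `|psum n x|)%R%:R : R).
  by apply: bmeas_lt => //; apply: measurableT_comp => //; exact: measurable_psum.
have [br Er] := Ex_psum_rad iidX symX (f := fun u => (K * a n < `|u|)%R%:R) bS.
rewrite Er in hK.
apply: (@le_trans _ _ (E (fun x => 6 * rad n 0 (fun u => (K * a n < `|u|)%R%:R) x 0))).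
  apply: Ex_le; [|exact: bmeasZ|].
    by apply: bmeas_lt => //; exact: measurable_V.
  move=> x; have rad0 : 0 <= rad n 0 (fun u => (K * a n < `|u|)%R%:R) x 0.
    by rewrite -[leLHS](rad_cst n 0 0 x 0); apply: rad_le => u; exact: ler0n.
  case: ltP => h /=; last by rewrite mulr_ge0.
  pose s := \sum_(0 <= j < 0 + n) x j ^+ 2.
  have sE : s = Vnorm 2 n x ^+ 2.
    rewrite Vnorm2E sqr_sqrtr ?sumr_ge0// => [|i _]; last exact: sqr_ge0.
    by rewrite /s add0n big_mkord.
  have V0 : 0 < Vnorm 2 n x by rewrite (lt_trans _ h)// !mulr_gt0.
  have s0 : 0 < s by rewrite sE exprn_gt0.
  have := rad_anticoncentration s0; rewrite -/s => h6.
  suff : rad n 0 (fun u => (s / 4 <= u ^+ 2)%R%:R) x 0 <=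
         rad n 0 (fun u => (K * a n < `|u|)%R%:R) x 0.
    by move: h6; move: (rad _ _ _ _ _) (rad _ _ _ _ _) => A B; lra.
  apply: rad_le => u; case: (leP (s / 4)) => hu /=; last exact: ler0n.
  suff -> : K * a n < `|u| by [].
  rewrite ltNge; apply/negP => uK.
  have Ka : 0 <= K * a n by rewrite mulr_ge0 ?(ltW K0) ?(ltW (a0 n)).
  have u2 : u ^+ 2 <= (K * a n) ^+ 2.
    by rewrite -(real_normK (num_real u)) lerXn2r ?nnegrE.
  have : (2 * K * a n) ^+ 2 < Vnorm 2 n x ^+ 2.
    by rewrite ltr_pXn2r ?nnegrE ?(ltW V0)// -mulrA mulr_ge0.
  rewrite -mulrA exprMn -sE; move: hu u2; move: (u ^+ 2) ((K * a n) ^+ 2) => A B; lra.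
rewrite ExZ//; move: hK; move: (Ex _ _) => A; lra.
Qed.

Lemma Vnorm_eq0 p n x : 0 < p -> (Vnorm p n x == 0)%:R = \prod_(i < n) (x i == 0)%:R :> R.
Proof.
move=> p0; case: (boolP [forall i : 'I_n, x i == 0]) => [/forallP h|].
  rewrite big1 => [|i _]; last by rewrite h.
  suff -> : Vnorm p n x = 0 by rewrite eqxx.
  rewrite /Vnorm big1 ?powR0 ?invr_eq0 ?gt_eqF// => i _.
  by rewrite (eqP (h i)) normr0 powR0// gt_eqF.
rewrite negb_forall => /existsP[i xi].
rewrite (bigD1 i)//= (negbTE xi) mul0r.
by rewrite gt_eqF// (Vnorm_gt0 p (ltn_ord i) xi).
Qed.

(** The norm vanishes only with the whole sample, an event of probability [q ^+ n]. If [q] were 1,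
    [charfun] would be identically 1 and so would the limit [c]. *)
Lemma null_prob_cvg0 p (a : nat -> R) (c t : R) : 0 < p ->
  (charfun X (t / a n) ^+ n) ^+ 2 @[n --> \oo] --> c -> c < 1 ->
  null_prob X p n @[n --> \oo] --> 0.
Proof.
move=> p0 gc lec.
have b0 : bmeas (fun z : measurableTypeR R => (z == 0)%:R : R).
  by apply: bmeas_bool; apply: measurable_fun_eqr.
pose q := Ex P (fun w => (X 0%N w == 0)%:R : R).
have vE n : null_prob X p n = q ^+ n.
  have := EX_prod iidX n b0; rewrite /EX /sampled -/q => <-.
  rewrite (Ex_sample X (F := fun x => \prod_(i < n) (x i == 0)%:R)).
    by apply: eq_Ex => x; exact: Vnorm_eq0.
  apply: bmeas_prod => i _; apply: bmeas_bool.
  by apply: measurable_fun_eqr => //; exact: measurable_coord.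
have mX0 : measurable_fun [set: T] (X 0%N) by [].
have bq : bmeas (fun w => (X 0%N w == 0)%:R : R).
  by apply: bmeas_bool; exact: measurable_fun_eqr.
have q0 : 0 <= q by apply: Ex_ge0 => w.
have q1 : q <= 1 by apply: Ex_le_cst => // w; rewrite lern1 leq_b1.
have {q1} : q < 1.
  rewrite lt_neqAle q1 andbT; apply/eqP => q1'.
  have p1 s : charfun X s = 1.
    have bc : bmeas (fun w => cos (s * X 0%N w)) by apply: bmeas_cos; exact: measurable_funM.
    apply/eqP; rewrite eq_le; apply/andP; split.
      by apply: Ex_le_cst => // w; exact: cos_le1.
    have : Ex P (fun w => 2 * (X 0%N w == 0)%:R - 1) <= charfun X s.
      apply: Ex_le => //; first by apply: bmeasB; [exact: bmeasZ|exact: bmeas_cst].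
      move=> w; case: eqP => [->|_] /=; first by rewrite mulr0 cos0; lra.
      by rewrite mulr0 sub0r cos_geN1.
    rewrite ExB; [|exact: bmeasZ|exact: bmeas_cst].
    by rewrite ExZ// Ex_cst -/q q1'; move: (charfun X s) => A; lra.
  have c1 : (1 : R) @[n --> \oo] --> c.
    by move: gc; under eq_fun do rewrite p1 expr1n expr1n.
  have : c = 1 by apply: (@cvg_unique _ (@Rhausdorff R) _ _ _ _ c1); exact: cvg_cst.
  by move: lec => /[swap] ->; rewrite ltxx.
move=> q1; rewrite (_ : null_prob X p = fun n => q ^+ n); last by apply/funext.
by apply: cvg_expr; rewrite ger0_norm.
Qed.

End sample_tightness.

(** * The Gaussian domain of attraction *)

Lemma prod_ge_1Bsum (R : realFieldType) n (y : 'I_n -> R) : (forall i, 0 <= y i <= 1) ->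
  1 - \sum_(i < n) y i <= \prod_(i < n) (1 - y i).
Proof.
elim: n y => [|n IH] y y01; first by rewrite !big_ord0 subr0.
rewrite !big_ord_recr/=.
have h := IH _ (fun i => y01 (widen_ord (leqnSn n) i)).
have /andP[y0 y1] := y01 ord_max.
have s0 : 0 <= \sum_(i < n) y (widen_ord (leqnSn n) i).
  by rewrite sumr_ge0// => i _; case/andP: (y01 (widen_ord (leqnSn n) i)).
apply: (@le_trans _ _ ((1 - \sum_(i < n) y (widen_ord (leqnSn n) i)) * (1 - y ord_max))).
  by move: (\sum_(i < n) _) (y ord_max) s0 y0 => A B A0 B0; have := mulr_ge0 A0 B0; lra.
by rewrite ler_wpM2r// subr_ge0.
Qed.

Section gaussian_attraction.
Context (R : realType) d (T : measurableType d) (P : probability T R).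
Variable X : nat -> {RV P >-> R}.
Hypotheses (iidX : iid X) (symX : forall i, symmetric_RV (X i)).
Local Notation E := (Ex (law X)).
Implicit Types (x : seqR R) (t : R).

Variables (a : nat -> R) (h : R -> R).
Hypotheses (a0 : forall n, 0 < a n)
  (gh : forall t, (charfun X (t / a n) ^+ n) ^+ 2 @[n --> \oo] --> h t)
  (h2 : forall t, 0 <= t -> h (Num.sqrt 2 * t) = h t ^+ 2)
  (hlt1 : exists2 t, 0 < t & h t < 1)
  (h1 : forall u : nat -> R, u n @[n --> \oo] --> 0 -> h (u n) @[n --> \oo] --> (1 : R))
  (h01 : forall t, 0 <= h t <= 1)
  (tS : tight_sums X a).

Let bcos s : bmeas (fun w => cos (s * X 0%N w)).
Proof. by apply: bmeas_cos; exact: measurable_funM. Qed.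

Let h_pow k t : 0 <= t -> h (Num.sqrt 2 ^+ k * t) = h t ^+ (2 ^ k).
Proof.
move=> t0; elim: k => [|k IH]; first by rewrite expr0 mul1r expr1.
rewrite exprS -mulrA h2; last by rewrite mulr_ge0// exprn_ge0// ltW.
by rewrite IH -exprM expnSr.
Qed.

(** By the functional equation a zero would propagate to the points [t / Num.sqrt 2 ^+ k], which
    tend to 0, where [h] tends to 1. *)
Let h_gt0 t : 0 <= t -> 0 < h t.
Proof.
move=> t0; rewrite lt_def; case/andP: (h01 t) => -> _; rewrite andbT; apply/eqP => ht.
pose u k := (Num.sqrt 2)^-1 ^+ k * t.
have u0 : u k @[k --> \oo] --> 0.
  rewrite -(mul0r t); apply: cvgMl; apply: cvg_expr.
  rewrite ger0_norm ?invr_ge0 ?sqrtr_ge0// invf_lt1//.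
  by rewrite -[ltLHS]sqrtr1 ltr_sqrt; lra.
have hu k : h (u k) = 0.
  have : h (u k) ^+ (2 ^ k) = 0.
    rewrite -h_pow; last by rewrite mulr_ge0// exprn_ge0// invr_ge0 ltW.
    by rewrite /u mulrA -exprMn divff ?expr1n ?mul1r// gt_eqF.
  by move/eqP; rewrite expf_eq0 => /andP[_ /eqP].
have := h1 u0; under eq_fun do rewrite hu; move=> c0.
have : (1 : R) = 0 by apply: (@cvg_unique _ (@Rhausdorff R) _ _ _ _ c0); exact: cvg_cst.
by move/eqP; rewrite oner_eq0.
Qed.

Let charfun_le1 s : charfun X s <= 1.
Proof. by apply: Ex_le_cst => // w; exact: cos_le1. Qed.

(** Double angle formula and Jensen: the square of the cosine is bounded below by its tangent at
    [charfun X s]. *)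
Let charfun_double s : 2 * charfun X s ^+ 2 - 1 <= charfun X (2 * s).
Proof.
have : Ex P (fun w => 4 * charfun X s * cos (s * X 0%N w) - (2 * charfun X s ^+ 2 + 1)) <= charfun X (2 * s).
  apply: Ex_le => //; first by apply: bmeasB; [exact: bmeasZ|exact: bmeas_cst].
  move=> w; rewrite (_ : 2 * s * X 0%N w = (s * X 0%N w) *+ 2); last by rewrite mulr2n; ring.
  rewrite cos_mulr2n mulr2n; move: (cos _) (charfun X s) => c p.
  have := sqr_ge0 (c - p); lra.
rewrite ExB; [|exact: bmeasZ|exact: bmeas_cst].
rewrite ExZ// Ex_cst -/(charfun X s); move: (charfun X s) => p; lra.
Qed.

(** At [t / 2] the [n]-th power of the squared characteristic function has a positive limit, so the
    square tends to 1; doubling the argument with [charfun_double] recovers the sign. *)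
Let charfun_cvg1 t : 0 <= t -> charfun X (t / a n) @[n --> \oo] --> (1 : R).
Proof.
move=> t0; apply/cvgrPdist_le => e e0.
wlog e1 : e e0 / e < 1.
  move=> H; case: (ltP e 1) => e1; first exact: H.
  have H1 : (0 : R) < 1 / 2 by lra.
  have H2 : (1 / 2 : R) < 1 by lra.
  near=> n; apply: (@le_trans _ _ (1 / 2)); last lra.
  by near: n; exact: H.
have ht2 := h_gt0 (divr_ge0 t0 (ler0n _ 2)).
have c1 : (1 - e / 2) ^+ n @[n --> \oo] --> 0.
  by apply: cvg_expr; rewrite ger0_norm; lra.
have /cvgrPdist_lt /(_ (h (t / 2) / 2) ltac:(lra)) g1 := @gh (t / 2).
have /cvgr0Pnorm_lt /(_ (h (t / 2) / 2) ltac:(lra)) g2 := c1.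
near=> n.
have k1 : h (t / 2) / 2 < (charfun X (t / 2 / a n) ^+ n) ^+ 2.
  have : `|h (t / 2) - (charfun X (t / 2 / a n) ^+ n) ^+ 2| < h (t / 2) / 2 by near: n.
  by rewrite ltr_norml => /andP[_ ?]; lra.
have k2 : (1 - e / 2) ^+ n < h (t / 2) / 2.
  have : `|(1 - e / 2) ^+ n| < h (t / 2) / 2 by near: n.
  by move/(le_lt_trans (ler_norm _)).
have k3 : 1 - e / 2 <= charfun X (t / 2 / a n) ^+ 2.
  rewrite leNgt; apply/negP => k3.
  have : (charfun X (t / 2 / a n) ^+ 2) ^+ n <= (1 - e / 2) ^+ n.
    by rewrite lerXn2r ?nnegrE ?sqr_ge0// ?ltW//; lra.
  rewrite -!exprM mulnC exprM; move: k1 k2; rewrite -!exprM mulnC.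
  by move=> p1 p2 /(lt_le_trans p1)/lt_trans/(_ p2); rewrite ltxx.
have := charfun_double (t / 2 / a n).
have -> : 2 * (t / 2 / a n) = t / a n by field; rewrite gt_eqF.
move=> k4; rewrite ger0_norm; last by rewrite subr_ge0 charfun_le1.
by move: k3 k4; move: (charfun X (t / 2 / a n) ^+ 2) (charfun X (t / a n)) => A B; lra.
Unshelve. all: by end_near. Qed.

(** The logarithm of the convergence of powers, with [- ln p] exchanged for [1 - p] through
    [p * (- ln p) <= 1 - p <= - ln p]; both bounds share a limit as [p] tends to 1. *)
Let exponent_cvg t : 0 <= t -> n%:R * (1 - charfun X (t / a n)) @[n --> \oo] --> - (ln (h t) / 2).
Proof.
move=> t0; have p1 := charfun_cvg1 t0.
have pgt : \forall n \near \oo, 1 / 2 < charfun X (t / a n).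
  by apply: (cvgr_gt _ p1); lra.
pose A n := - (ln ((charfun X (t / a n) ^+ n) ^+ 2) / 2) : R.
have cA : A n @[n --> \oo] --> - (ln (h t) / 2).
  apply: cvgN; apply: cvgMl; apply: continuous_cvg => //; apply: continuous_ln; exact: h_gt0.
have AE : \forall n \near \oo, A n = n%:R * (- ln (charfun X (t / a n))).
  apply: filterS pgt => n pn; rewrite /A -exprM lnXn; last by lra.
  by rewrite mulrnA mulr2n -[ln _ *+ n]mulr_natr; field.
have cpA : charfun X (t / a n) * A n @[n --> \oo] --> - (ln (h t) / 2).
  by rewrite -[X in _ --> X]mul1r; apply: cvgM.
apply: (squeeze_cvgr _ cpA cA).
near=> n.
have pn : 1 / 2 < charfun X (t / a n) by near: n.
have -> : A n = n%:R * (- ln (charfun X (t / a n))) by near: n.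
set p := charfun X _ in pn *.
have lnle (y : R) : 0 < y -> ln y <= y - 1.
  by move=> y0; have := @le_ln1Dx R (y - 1); rewrite (_ : 1 + (y - 1) = y);
    [apply; lra|ring].
have l1 : ln p <= p - 1 by apply: lnle; lra.
have l2 : - ln p <= p^-1 - 1.
  rewrite -lnV ?posrE; last by lra.
  by apply: lnle; rewrite invr_gt0; lra.
apply/andP; split; last by rewrite ler_wpM2l//; lra.
rewrite mulrCA ler_wpM2l//.
apply: (@le_trans _ _ (p * (p^-1 - 1))); first by rewrite ler_wpM2l//; lra.
by rewrite mulrBr divff ?mulr1// gt_eqF//; lra.
Unshelve. all: by end_near. Qed.

(** [(1 - cos u) ^+ 2 = 2 * (1 - cos u) - (1 - cos (2 * u)) / 2]. The equation of [h] used twice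
    gives [ln (h (2 * t)) = 4 * ln (h t)], so the limits given by [exponent_cvg] cancel: this is
    where the Gaussian exponent matters. *)
Let square_moment_cvg0 t : 0 <= t ->
  n%:R * Ex P (fun w => (1 - cos (t / a n * X 0%N w)) ^+ 2) @[n --> \oo] --> 0.
Proof.
move=> t0; have c1 := exponent_cvg t0; have c2 := exponent_cvg (mulr_ge0 (ler0n _ 2) t0).
have h4 : h (2 * t) = h t ^+ 4.
  rewrite (_ : 2 = Num.sqrt 2 ^+ 2); last by rewrite sqr_sqrtr.
  by rewrite h_pow.
have : 2 * (n%:R * (1 - charfun X (t / a n))) - 2^-1 * (n%:R * (1 - charfun X (2 * t / a n)))
    @[n --> \oo] --> 2 * - (ln (h t) / 2) - 2^-1 * - (ln (h (2 * t)) / 2).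
  by apply: cvgB; exact: cvgMr.
have -> : ln (h (2 * t)) = 4 * ln (h t) by rewrite h4 lnXn ?h_gt0// mulr_natl.
have -> : 2 * - (ln (h t) / 2) - 2^-1 * - (4 * ln (h t) / 2) = 0 by field.
apply: cvg_trans; apply: near_eq_cvg; apply: nearW => n /=.
transitivity (n%:R * Ex P (fun w => 3 / 2 + (- 2 * cos (t / a n * X 0%N w) +
    1 / 2 * cos (2 * t / a n * X 0%N w)))).
  rewrite ExD; [|exact: bmeas_cst|by apply: bmeasD; exact: bmeasZ].
  rewrite Ex_cst ExD; [|exact: bmeasZ|exact: bmeasZ].
  rewrite !ExZ// -/(charfun X (t / a n)) -/(charfun X (2 * t / a n)).
  by move: (charfun _ _) (charfun _ _) => A B; field.
congr (_ * _); apply: eq_Ex => w.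
rewrite (_ : 2 * t / a n * X 0%N w = (t / a n * X 0%N w) *+ 2); last by rewrite mulr2n; ring.
by rewrite cos_mulr2n mulr2n; move: (cos _) => c; field.
Qed.

Definition exceeds (c : R) n (x : nat -> R) : bool := has (fun i => c < `|x i|) (iota 0 n).

Lemma exceedsP (c : R) n (x : nat -> R) i : ~~ exceeds c n x -> (i < n)%N -> `|x i| <= c.
Proof. by move=> /hasPn H iN; rewrite leNgt H// mem_iota. Qed.

Let bmeas_exceeds (c : R) n : bmeas (fun x : seqR R => (exceeds c n x)%:R : R).
Proof.
apply: bmeas_bool; rewrite /exceeds; elim: (iota _ _) => [|i s IH] //=.
apply: measurable_or => //; apply: measurable_fun_ltr => //.
by apply: measurableT_comp => //; exact: measurable_coord.
Qed.

(** Union bound over the coordinates. When the norm is at most [K * a n], the angle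
    [u = x i / (K * a n)] is at most 1 in modulus, and a coordinate beyond [e * a n] bounds
    [1 - cos u] from below by [cosB1_ge]; [C] brings the square of this above 1. *)
Let exceeds_cvg0 (e : R) : 0 < e -> E (fun x => (exceeds (e * a n) n x)%:R) @[n --> \oo] --> 0.
Proof.
move=> e0; apply/cvgr0Pnorm_le => eta eta0.
have [K K0 hK] := tight_sums_Vnorm iidX symX a0 tS (ltac:(lra) : 0 < eta / 2).
pose C := (8 * K ^+ 2 / e ^+ 2) ^+ 2.
have C0 : 0 <= C by exact: sqr_ge0.
have K1 : 0 <= K^-1 by rewrite invr_ge0 ltW.
have /cvgrPdist_le /(_ (eta / 2) ltac:(lra)) sm : 
    C * (n%:R * Ex P (fun w => (1 - cos (K^-1 / a n * X 0%N w)) ^+ 2)) @[n --> \oo] --> 0.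
  by rewrite -(mulr0 C); apply: cvgMr; exact: square_moment_cvg0.
near=> n.
have B1 : E (fun x => (K * a n < Vnorm 2 n x)%R%:R) <= eta / 2 by near: n.
have B2 : C * (n%:R * Ex P (fun w => (1 - cos (K^-1 / a n * X 0%N w)) ^+ 2)) <= eta / 2.
  by rewrite (le_trans (ler_norm _))// -normrN -sub0r; near: n.
rewrite ger0_norm; last by apply: Ex_ge0.
pose f (z : R) : R := C * (1 - cos (K^-1 / a n * z)) ^+ 2.
have bf : bmeas (f : measurableTypeR R -> R).
  apply: bmeasZ; apply: bmeasX; apply: bmeasB; first exact: bmeas_cst.
  by apply: bmeas_cos; exact: measurable_funM.
have bfi i : bmeas (fun x : seqR R => f (x i)).
  by apply: bmeas_comp; [case: bf|exact: bf.2|exact: measurable_coord].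
have bV : bmeas (fun x : seqR R => (K * a n < Vnorm 2 n x)%R%:R : R).
  by apply: bmeas_lt => //; exact: measurable_V.
apply: (@le_trans _ _ (E (fun x => (K * a n < Vnorm 2 n x)%R%:R + \sum_(i < n) f (x i)))).
  apply: Ex_le => //; first by apply: bmeasD => //; exact: bmeas_sum.
  move=> x; have f0 z : 0 <= f z by rewrite mulr_ge0// sqr_ge0.
  have s0 : 0 <= \sum_(i < n) f (x i) by rewrite sumr_ge0.
  case: (boolP (exceeds _ _ _)) => [/hasP[i]|_] /=; last exact: addr_ge0.
  rewrite mem_iota => /andP[_ iN] xi; case: ltP => KV /=; first by rewrite lerDl.
  rewrite add0r (bigD1 (Ordinal iN))//=.
  suff : 1 <= f (x i) by move=> h1'; rewrite (le_trans h1')// lerDl sumr_ge0.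
  have xK : `|x i| <= K * a n by apply: le_trans KV; apply: le_Vnorm.
  have an := a0 n.
  set u := K^-1 / a n * x i.
  have uE : `|u| = `|x i| / (K * a n).
    by rewrite /u normrM ger0_norm ?mulr_ge0 ?invr_ge0 ?ltW// invfM mulrC.
  have u1 : `|u| <= 1 by rewrite uE ler_pdivrMr ?mulr_gt0// mul1r.
  have u2 : (e / K) ^+ 2 <= u ^+ 2.
    rewrite -(real_normK (num_real u)) lerXn2r ?nnegrE ?divr_ge0 ?(ltW e0) ?(ltW K0)//.
    rewrite uE ler_pdivlMr ?mulr_gt0// mulrA divfK ?gt_eqF//; exact: ltW.
  have := cosB1_ge u1 => u3.
  have u4 : 1 <= 8 * K ^+ 2 / e ^+ 2 * (1 - cos u).
    have : 8 * K ^+ 2 / e ^+ 2 * ((e / K) ^+ 2 / 8) = 1.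
      by field; rewrite !gt_eqF.
    move=> E1; rewrite -[leLHS]E1; apply: ler_wpM2l.
      by rewrite divr_ge0 ?sqr_ge0// mulr_ge0 ?sqr_ge0.
    by move: u2 u3; move: ((e / K) ^+ 2) (u ^+ 2) => A B; lra.
  by rewrite /f -/u /C -exprMn exprn_ege1.
rewrite ExD//; last exact: bmeas_sum.
rewrite Ex_sum//.
rewrite (eq_bigr (fun=> Ex P (fun w => f (X 0%N w)))); last by move=> i _; exact: Ex_coord.
rewrite sumr_const card_ord -[X in _ + X <= _]mulr_natl ExZ; last first.
  by apply: bmeasX; apply: bmeasB => //; exact: bmeas_cst.
rewrite [n%:R * _]mulrCA; apply: le_trans (lerD B1 B2) _; lra.
Unshelve. all: by end_near. Qed.

(** If the norm is at most [a n / t], the sign average of [cos (t / a n * psum n x)] is a product of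
    cosines whose squared angles sum to at most 1, hence at least 1/2. Such small norms are rare
    once [charfun X (t / a n) ^+ n] is small. *)
Let small_Vnorm t n : 0 < t ->
  E (fun x => (Vnorm 2 n x <= a n / t)%R%:R) <=
  2 * (charfun X (t / a n) ^+ n + E (fun x => (exceeds (t^-1 * a n) n x)%:R)).
Proof.
move=> t0; have an := a0 n.
have bV : bmeas (fun x : seqR R => (Vnorm 2 n x <= a n / t)%R%:R : R).
  by apply: bmeas_le_bool => //; exact: measurable_V.
have bc : bmeas (fun x : seqR R => cos (t / a n * psum n x)).
  by apply: bmeas_cos; apply: measurable_funM => //; exact: measurable_psum.
have [br Er] := Ex_psum_rad iidX symX (f := fun u => cos (t / a n * u)) bc.
have be := bmeas_exceeds (t^-1 * a n) n.
rewrite -Ex_cos_psum// Er -(ExD _ br be) -(ExZ _ _ (bmeasD br be)).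
apply: Ex_le => //; first by apply: bmeasZ; exact: bmeasD.
move=> x; rewrite rad_cos mulr0 cos0 mul1r add0n big_mkord.
have ta : 0 < t / a n by rewrite divr_gt0.
(* An angle beyond 1 may make the product negative, but not below -1, which the indicator
   compensates; the norm then exceeds [a n / t]. *)
case: (boolP (exceeds _ _ _)) => [ex|nex] /=.
  have : `|\prod_(i < n) cos (t / a n * x i)| <= 1.
    rewrite normr_prod; apply: prodr_ile1 => i _; rewrite normr_ge0/=; exact: cos_max.
  rewrite ler_norml => /andP[p1 _].
  have -> : (Vnorm 2 n x <= a n / t) = false.
    apply/negP => V1; move: ex => /hasP[i]; rewrite mem_iota => /andP[_ iN].
    have := @le_Vnorm R 2 n x i ltac:(lra) iN.
    by move=> /le_trans/(_ V1); rewrite mulrC leNgt => /negP.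
  by rewrite /=; lra.
have u1 i : (i < n)%N -> `|t / a n * x i| <= 1.
  move=> iN; have := exceedsP nex iN; rewrite normrM gtr0_norm// => xi.
  apply: le_trans (ler_wpM2l (ltW ta) xi) _.
  by rewrite le_eqVlt; apply/orP; left; apply/eqP; field; rewrite !gt_eqF.
rewrite addr0; case: (leP (Vnorm 2 n x) (a n / t)) => V1 /=; last first.
  rewrite mulr_ge0// prodr_ge0// => i _.
  have := cosB1_le (t / a n * x i); have : (t / a n * x i) ^+ 2 <= 1.
    by rewrite -(real_normK (num_real _)) expr_le1// u1.
  by move: ((t / a n * x i) ^+ 2) (cos _) => A B; lra.
have V2 : \sum_(i < n) (t / a n * x i) ^+ 2 <= 1.
  under eq_bigr do rewrite exprMn.
  rewrite -mulr_sumr.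
  have -> : \sum_(i < n) x i ^+ 2 = Vnorm 2 n x ^+ 2.
    by rewrite Vnorm2E sqr_sqrtr// sumr_ge0// => i _; exact: sqr_ge0.
  rewrite -exprMn expr_le1//; last by rewrite mulr_ge0 ?Vnorm_ge0// ltW.
  apply: le_trans (ler_wpM2l (ltW ta) V1) _.
  by rewrite le_eqVlt; apply/orP; left; apply/eqP; field; rewrite !gt_eqF.
suff : 1 / 2 <= \prod_(i < n) cos (t / a n * x i) by lra.
pose y (i : 'I_n) := (t / a n * x i) ^+ 2 / 2.
have y01 i : 0 <= y i <= 1.
  rewrite /y divr_ge0 ?sqr_ge0//=.
  have : (t / a n * x i) ^+ 2 <= 1 by rewrite -(real_normK (num_real _)) expr_le1// u1.
  lra.
apply: (@le_trans _ _ (\prod_(i < n) (1 - y i))).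
  apply: le_trans (prod_ge_1Bsum y01); rewrite /y -mulr_suml.
  by move: V2; move: (\sum_(i < n) _) => A; lra.
apply: ler_prod => i _; have /andP[y0 y1] := y01 i.
by rewrite subr_ge0 y1/=; have := cosB1_le (t / a n * x i); rewrite -/(y i); lra.
Qed.

Lemma mean_max_cvg0 : mean_max X 2 n @[n --> \oo] --> 0.
Proof.
apply/cvgr0Pnorm_le => eta eta0; have [t0 t0_gt ht0] := hlt1.
have [t tgt ht] : exists2 t, 0 < t & h t < (eta / 16) ^+ 2.
  have c0 : h t0 ^+ k @[k --> \oo] --> 0.
    by apply: cvg_expr; rewrite ger0_norm//; case/andP: (h01 t0).
  have /cvgr0Pnorm_lt /(_ ((eta / 16) ^+ 2)) := c0.
  case; first by rewrite exprn_gt0//; lra.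
  move=> k _ /(_ (2 ^ k)%N) /= hk.
  exists (Num.sqrt 2 ^+ k * t0); first by rewrite mulr_gt0// exprn_gt0.
  rewrite h_pow ?ltW//; apply: le_lt_trans (ler_norm _) _; apply: hk.
  by rewrite ltnW// ltn_expl.
(* Makes [e * a n] equal to [eta / 4] times the lower bound [a n / t] for the norm, so that every
   weight is at most [eta / 4]. *)
pose e := eta / (4 * t).
have e0 : 0 < e by rewrite divr_gt0// mulr_gt0.
have ex1 := exceeds_cvg0 e0.
have /cvgr0Pnorm_le /(_ (eta / 4) ltac:(lra)) ex1' := ex1.
have ti : 0 < t^-1 by rewrite invr_gt0.
have /cvgr0Pnorm_le /(_ (eta / 16) ltac:(lra)) ex2' := exceeds_cvg0 ti.
have g1 : \forall n \near \oo, (charfun X (t / a n) ^+ n) ^+ 2 < (eta / 16) ^+ 2.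
  have /cvgrPdist_lt /(_ ((eta / 16) ^+ 2 - h t)) := @gh t.
  rewrite subr_gt0 => /(_ ht); apply: filterS => n.
  by rewrite distrC => /(le_lt_trans (ler_norm _)); rewrite ltrBlDr subrK.
near=> n.
rewrite ger0_norm ?mean_max_ge0//.
have B1 : E (fun x => (exceeds (e * a n) n x)%:R) <= eta / 4.
  by rewrite (le_trans (ler_norm _))//; near: n.
have B2 : E (fun x => (exceeds (t^-1 * a n) n x)%:R) <= eta / 16.
  by rewrite (le_trans (ler_norm _))//; near: n.
have B3 : charfun X (t / a n) ^+ n <= eta / 16.
  rewrite (le_trans (ler_norm _))// -(ler_pXn2r (ltn0Sn 1)) ?nnegrE//; last by lra.
  by rewrite real_normK ?num_real// ltW//; near: n.
have B4 := small_Vnorm n tgt.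
have bV : bmeas (fun x : seqR R => (Vnorm 2 n x <= a n / t)%R%:R : R).
  by apply: bmeas_le_bool => //; exact: measurable_V.
have be := bmeas_exceeds (e * a n) n.
have : mean_max X 2 n <= E (fun x => (Vnorm 2 n x <= a n / t)%R%:R +
    ((exceeds (e * a n) n x)%:R + eta / 4)).
  apply: Ex_le.
  - exact: bmeas_max_weight.
  - by apply: bmeasD => //; apply: bmeasD => //; exact: bmeas_cst.
  move=> x; have /andP[m0 m1] := @max_weight_itv R 2 n x ltac:(lra).
  case: (leP (Vnorm 2 n x) (a n / t)) => V1 /=.
    by rewrite (le_trans m1)// lerDl addr_ge0//; lra.
  case: (boolP (exceeds _ _ _)) => [_|nex] /=.
    by rewrite (le_trans m1)// add0r lerDl; lra.
  rewrite !add0r; apply: bigmax_le => [|i _]; first lra.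
  have an := a0 n; have V0 : 0 < Vnorm 2 n x by rewrite (lt_trans _ V1)// divr_gt0.
  rewrite /weight normrM normfV (gtr0_norm V0) ler_pdivrMr//.
  apply: le_trans (exceedsP nex (ltn_ord i)) _.
  rewrite (_ : e * a n = eta / 4 * (a n / t)); last by rewrite /e; field; rewrite gt_eqF.
  by rewrite ler_wpM2l ?(ltW V1)//; lra.
rewrite ExD//; last by apply: bmeasD => //; exact: bmeas_cst.
rewrite ExD//; last exact: bmeas_cst.
rewrite Ex_cst; move: B1 B2 B3 B4.
move: (charfun X (t / a n) ^+ n) => D; move: (Ex _ _) (Ex _ _) (Ex _ _) (mean_max _ _ _) => A B C K; lra.
Unshelve. all: by end_near. Qed.

End gaussian_attraction.

(** * Necessary conditions *)

Section path_modulus.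
Context (R : realType).
Implicit Types (f : C01 R) (dl : R).

Let mod_set dl f : set R := [set x | exists s t : I01 R,
  `|I01_val s - I01_val t| <= dl /\ x = Num.min 1 `|f s - f t|].

(** Truncated at 1 to give a bounded functional; weights are at most 1, so the truncation costs
    nothing in [max_weight_modulus]. *)
Definition modulus dl f : R := sup (mod_set dl f).

Let mod_has_sup dl f : 0 <= dl -> has_sup (mod_set dl f).
Proof.
move=> d0; split; last by exists 1 => _ [s [t [_ ->]]]; rewrite ge_min lexx.
exists (Num.min 1 `|f (toI 0) - f (toI 0)|), (toI 0), (toI 0); split => //.
by rewrite subrr normr0.
Qed.

Lemma modulus_ge dl f s t : 0 <= dl -> `|I01_val s - I01_val t| <= dl ->
  Num.min 1 `|f s - f t| <= modulus dl f.
Proof. by move=> d0 st; apply: ub_le_sup; [case: (mod_has_sup f d0)|exists s, t]. Qed.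

Lemma modulus_le dl f (c : R) : 0 <= dl ->
  (forall s t, `|I01_val s - I01_val t| <= dl -> Num.min 1 `|f s - f t| <= c) ->
  modulus dl f <= c.
Proof.
move=> d0 H; apply: ge_sup; first by case: (mod_has_sup f d0).
by move=> _ [s [t [st ->]]]; exact: H.
Qed.

Lemma modulus_itv dl f : 0 <= dl -> 0 <= modulus dl f <= 1.
Proof.
move=> d0; apply/andP; split.
  apply: le_trans (modulus_ge f (s := toI 0) (t := toI 0) d0 _); last by rewrite subrr normr0.
  by rewrite le_min ler01 normr_ge0.
by apply: modulus_le => // s t _; rewrite ge_min lexx.
Qed.

Lemma modulus_lipC dl : 0 <= dl -> lipC 2 (modulus dl).
Proof.
move=> d0; have H (f g : C01 R) (e : R) : (forall t, `|f t - g t| <= e) ->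
    modulus dl f <= modulus dl g + 2 * e.
  move=> fg; apply: modulus_le => // s t st.
  have := modulus_ge g d0 st; have e0 : 0 <= e by apply: le_trans (fg (toI 0)).
  have : `|f s - f t| <= `|g s - g t| + 2 * e.
    have := fg s; have := fg t; have := ler_norm (g s - g t); have := ler_norm (- (g s - g t)).
    rewrite normrN; move: `|g s - g t| => C; rewrite !ler_norml.
    by move=> ? ? /andP[? ?] /andP[? ?]; apply/andP; split; lra.
  move: `|f s - f t| `|g s - g t| => A B AB.
  rewrite !ge_min; case: (leP 1 B) => B1 h; [rewrite (_ : 1 <= _)//; lra|].
  by apply/orP; right; lra.
move=> f g e fg; rewrite ler_norml; apply/andP; split.
  by have := H g f e (fun t => ltac:(by rewrite distrC)); lra.
by have := H f g e fg; lra.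
Qed.

Lemma modulus_cvg0 f : modulus k.+1%:R^-1 f @[k --> \oo] --> 0.
Proof.
apply/cvgr0Pnorm_le => e e0; have [r r0 rP] := C01_unif f e0.
have [N _ hN] := near_infty_invn_lt r0.
exists N => // k /= Nk; have k0 : (0 : R) <= k.+1%:R^-1 by [].
rewrite ger0_norm; last by case/andP: (modulus_itv f k0).
apply: modulus_le => // s t st; rewrite ge_min; apply/orP; right.
apply: ltW; apply: rP; apply: le_lt_trans st _; apply: hN; exact: leqW.
Qed.

End path_modulus.

(** * Consequences of convergence to Brownian motion *)

Section necessary_conditions.
Context (R : realType) d (T : measurableType d) (P : probability T R).
Variable X : nat -> {RV P >-> R}.
Hypotheses (iidX : iid X) (symX : forall i, symmetric_RV (X i)).
Context d' (T' : measurableType d') (Q : probability T' R) (W : T' -> C01 R).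
Hypothesis bmW : standard_BM Q W.
Variable p : R.
Hypotheses (p0 : 0 < p) (cY : cvg_in_law P (selfnorm_process p X) Q W).
Local Notation E := (Ex (law X)).
Local Notation gauss := (@gauss R).
Implicit Types (x : seqR R).

Let cvg_lipC L Phi : 0 <= L -> lipC L Phi -> (exists M : R, forall f, `|Phi f| <= M) ->
  E (fun x => Phi_interp Phi n (weight p n x)) @[n --> \oo] --> Ex Q (Phi \o W).
Proof.
move=> L0 PL bP; have cP := lipC_continuous L0 PL.
have := cvg_in_law_Ex cY cP bP (fun n => measurable_selfnorm p X n cP) (measurable_BM bmW cP).
apply: cvg_trans; apply: near_eq_cvg; apply: nearW => n.
exact: Ex_selfnorm.
Qed.

Lemma max_weight_modulus n x (dl : R) : (0 < n)%N -> n%:R^-1 <= dl ->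
  max_weight p n x <= modulus dl (interp 0 n (weight p n x)).
Proof.
move=> n0 nd; have n0' : 0 < n%:R :> R by rewrite ltr0n.
have d0 : 0 <= dl by apply: le_trans nd; rewrite invr_ge0.
apply: bigmax_le => [|i _]; first by case/andP: (modulus_itv (interp 0 n (weight p n x)) d0).
have iN : (i < n)%N := ltn_ord i.
have i01 : 0 <= (i%:R / n%:R : R) <= 1.
  by rewrite divr_ge0//= ler_pdivrMr// mul1r ler_nat ltnW.
have i101 : 0 <= (i.+1%:R / n%:R : R) <= 1.
  by rewrite divr_ge0//= ler_pdivrMr// mul1r ler_nat.
have st : `|I01_val (toI (i.+1%:R / n%:R : R)) - I01_val (toI (i%:R / n%:R : R))| <= dl.
  by rewrite !toIE// -mulrBl -natr1 addrAC subrr add0r mul1r ger0_norm ?invr_ge0.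
apply: le_trans (modulus_ge _ d0 st).
have E1 : interp 0 n (weight p n x) (toI (i.+1%:R / n%:R)) = \sum_(j < i) weight p n x j + weight p n x i.
  rewrite interpE add0r toIE// mulrC divfK ?gt_eqF// (clamp_sum _ iN); last first.
    by rewrite lexx andbT ler_nat leqnSn.
  by rewrite -natr1 addrAC subrr add0r mul1r.
have E2 : interp 0 n (weight p n x) (toI (i%:R / n%:R)) = \sum_(j < i) weight p n x j.
  rewrite interpE add0r toIE// mulrC divfK ?gt_eqF// (clamp_sum _ iN); last first.
    by rewrite lexx ler_nat leqnSn.
  by rewrite subrr mul0r addr0.
rewrite E1 E2 addrAC subrr add0r le_min lexx andbT; exact: weight_le1.
Qed.

(** The mean modulus of [W] at scale [1 / k.+1] is small by path continuity and dominated
    convergence; for fixed [k] it is the limit of the mean moduli of the process, which dominate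
    [mean_max] for large [n]. *)
Lemma selfnorm_mean_max_cvg0 : mean_max X p n @[n --> \oo] --> 0.
Proof.
apply/cvgr0Pnorm_le => e e0.
have mod_bound k : exists M : R, forall f : C01 R, `|modulus k.+1%:R^-1 f| <= M.
  exists 1 => f; have k0 : (0 : R) <= k.+1%:R^-1 by [].
  by have /andP[h1 h2] := modulus_itv f k0; rewrite ger0_norm.
have mod_lip k : lipC 2 (modulus (k.+1%:R^-1 : R)) by exact: modulus_lipC.
have [k _ /(_ k (leqnn k)) hk] : \forall k \near \oo,
    Ex Q (modulus (k.+1%:R^-1 : R) \o W) < e / 2.
  have : Ex Q (modulus (k.+1%:R^-1 : R) \o W) @[k --> \oo] --> 0.
    rewrite -(Ex_cst Q 0); apply: (@Ex_cvg _ _ _ Q _ _ 1) => //.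
    - by move=> k; apply: (measurable_BM bmW); exact: lipC_continuous (mod_lip k).
    - move=> k w; have k0 : (0 : R) <= k.+1%:R^-1 by [].
      by have /andP[h1 h2] := modulus_itv (W w) k0; rewrite /= ger0_norm.
    - by move=> w; exact: modulus_cvg0.
  move=> /cvgr0Pnorm_lt /(_ (e / 2) ltac:(lra)); apply: filterS => k.
  by apply: le_lt_trans; exact: ler_norm.
have /cvgrPdist_lt /(_ (e / 2) ltac:(lra)) cE := cvg_lipC (ler0n _ 2) (mod_lip k) (mod_bound k).
near=> n.
have n0 : (0 < n)%N by near: n; exact: nbhs_infty_gt.
have nk : n%:R^-1 <= (k.+1%:R^-1 : R).
  by rewrite lef_pV2 ?posrE ?ltr0n// ler_nat; near: n; exact: nbhs_infty_gt.
rewrite ger0_norm ?mean_max_ge0//.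
have ck := lipC_continuous (ler0n _ 2) (mod_lip k).
have : mean_max X p n <= E (fun x => Phi_interp (modulus (k.+1%:R^-1 : R)) n (weight p n x)).
  apply: Ex_le; [exact: bmeas_max_weight| |by move=> x; exact: max_weight_modulus].
  have [M HM] := mod_bound k; split; last by exists M => x; exact: HM.
  exact: measurableT_comp (measurable_Phi_interp n ck) (@measurable_weightseq R p n).
have : `|Ex Q (modulus (k.+1%:R^-1 : R) \o W) -
    E (fun x => Phi_interp (modulus (k.+1%:R^-1 : R)) n (weight p n x))| < e / 2 by near: n.
rewrite distrC => /(le_lt_trans (ler_norm _)).
move: hk; move: (Ex _ _) (Ex _ _) (mean_max _ _ _) => A B C; lra.
Unshelve. all: by end_near. Qed.

Lemma interp1 n (c : nat -> R) : interp 0 n c (toI 1) = psum n c.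
Proof.
rewrite interpE add0r toIE ?ler01 ?lexx// mulr1; apply: eq_bigr => i _.
have i1 : 1 <= n%:R - i%:R :> R by rewrite lerBrDr addrC natr1 ler_nat.
by rewrite clamp01E ifF ?i1 ?mul1r//; apply/negbTE; rewrite -ltNge (lt_le_trans _ i1).
Qed.

Lemma BM_end_law (g : R -> R) : blip g -> Ex Q (fun w => g (W w (toI 1))) = Ex gauss g.
Proof.
move=> bg; have [mW W0 _ _] := bmW.
have g01 i : 0 <= grid R 1 i <= 1 by exact: grid01.
have t0 : grid R 1 0 = 0 by rewrite gridE// mul0r.
have t1 : grid R 1 1 = 1 by rewrite gridE// divff.
have := Ex_incr bmW (t := grid R 1) (i := 0) g01 _ bg.
rewrite t0 t1 subr0 sqrtr1 => /(_ ltr01) H.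
transitivity (gavg 1 g 0); last by apply: eq_Ex => z; rewrite add0r mul1r.
rewrite -H; apply: Ex_ae.
- exact: bmeas_blip.
- exact: bmeas_blip bg (measurable_incr bmW (grid R 1) 0).
apply: filterS (W0 (toI 0) (toIE _)) => [w w0|]; last by rewrite lexx ler01.
by rewrite /incr t0 t1 w0 subr0.
Qed.

Lemma selfnorm_end_cvg (g : R -> R) : blip g ->
  E (fun x => g (psum n (weight p n x))) @[n --> \oo] --> Ex gauss g.
Proof.
move=> bg; have [[L gL] [M gM]] := bg.
have L0 : 0 <= `|L| by [].
have gl : lipC `|L| (fun f : C01 R => g (f (toI 1))).
  move=> f f' e ff; apply: le_trans (gL _ _) _.
  apply: (@le_trans _ _ (`|L| * `|f (toI 1) - f' (toI 1)|)); first by rewrite ler_wpM2r// ler_norm.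
  by rewrite ler_wpM2l.
have bg' : exists M : R, forall f : C01 R, `|g (f (toI 1))| <= M by exists M.
have := cvg_lipC L0 gl bg'; rewrite [Ex Q _](BM_end_law bg).
apply: cvg_trans; apply: near_eq_cvg; apply: nearW => n.
by apply: eq_Ex => x; rewrite /Phi_interp interp1.
Qed.

Let bpsum (g : R -> R) n : blip g -> bmeas (fun x : seqR R => g (psum n (weight p n x))).
Proof.
move=> bg; apply: bmeas_blip => //; apply: measurable_sum => i; exact: measurable_weight.
Qed.

Lemma Ex_selfnorm_rad (g : R -> R) n : bmeas (fun x : seqR R => g (psum n (weight p n x))) ->
  bmeas (fun x : seqR R => rad n 0 g (weight p n x) 0) /\
  E (fun x => g (psum n (weight p n x))) = E (fun x => rad n 0 g (weight p n x) 0).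
Proof.
move=> bf; have [bs Es] := law_savg iidX symX n 0 bf.
have H : savg n 0 (fun y => g (psum n (weight p n y))) = fun x => rad n 0 g (weight p n x) 0.
  apply/funext => x; rewrite (savg_weight p n n 0 (fun y => g (psum n y))).
  rewrite -savg_rad; apply: eq_savg => y _.
  by rewrite add0r add0n /psum big_mkord.
by rewrite H in bs Es; rewrite Es.
Qed.

Lemma weightp_sum n x : \sum_(i < n) `|weight p n x i| `^ p = (Vnorm p n x != 0)%:R.
Proof.
have [V0|V0] := eqVneq (Vnorm p n x) 0.
  by rewrite big1// => i _; rewrite /weight V0 invr0 mulr0 normr0 powR0// gt_eqF.
have Vp : 0 < Vnorm p n x by rewrite lt_def V0 Vnorm_ge0.
have S0 : 0 <= \sum_(i < n) `|x i| `^ p by rewrite sumr_ge0// => i _; exact: powR_ge0.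
have SV : \sum_(i < n) `|x i| `^ p = Vnorm p n x `^ p.
  by rewrite /Vnorm -powRrM mulVf ?gt_eqF// powRr1.
rewrite (eq_bigr (fun i : 'I_n => `|x i| `^ p * (Vnorm p n x `^ p)^-1)); last first.
  move=> i _; rewrite /weight normrM normfV (gtr0_norm Vp) powRM ?invr_ge0 ?(ltW Vp)//.
  by rewrite -(powR_inv1 (ltW Vp)) -powRrM mulN1r powRN.
by rewrite -mulr_suml SV divff// gt_eqF// powR_gt0.
Qed.

(** The means of [cos (t * psum n (weight p n x))] would tend to 1, against nondegeneracy of the
    Gaussian law, because [1 - cos] is bounded by the second moment of the Rademacher sum. *)
Lemma selfnorm_p_ge2 : ~ p < 2.
Proof.
move=> p2; have [t t0] := nondegenerate_cf2 (@nondegenerate_gauss R).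
have q0 : 0 < 2 - p by rewrite subr_gt0.
suff : Ex gauss (fun z => cos (t * z)) = 1.
  by move=> E1; rewrite /cf2 gauss_sin E1 expr1n expr0n/= addr0 ltxx.
have c1 := selfnorm_end_cvg (blip_cosM t).
apply: (@cvg_unique _ (@Rhausdorff R) _ _ _ _ c1).
apply/cvgrPdist_le => e e0.
(* The power [2 - p] of [max_weight] is at most [e / t ^+ 2] below [dl] and at most 1 above it,
   where [max_weight / dl] exceeds 1; this affine bound involves [max_weight] only through its
   mean. *)
pose dl := (e / (t ^+ 2)) `^ (2 - p)^-1.
have t2 : 0 < t ^+ 2 by rewrite exprn_gt0.
have et : 0 < e / t ^+ 2 by rewrite divr_gt0.
have d0 : 0 < dl by rewrite powR_gt0.
have dq : dl `^ (2 - p) = e / t ^+ 2.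
  by rewrite /dl -powRrM mulVf ?gt_eqF// powRr1// ltW.
have /cvgr0Pnorm_le /(_ (e / t ^+ 2 * dl) (mulr_gt0 et d0)) kc := selfnorm_mean_max_cvg0.
near=> n.
have bc := bpsum n (blip_cosM t).
have [br Er] := Ex_selfnorm_rad (g := fun u => cos (t * u)) bc.
have kn : mean_max X p n <= e / t ^+ 2 * dl by rewrite (le_trans (ler_norm _))//; near: n.
rewrite Er -[1](Ex_cst (law X)).
have bm := bmeas_max_weight n p0.
apply: (@le_trans _ _ (E (fun x => t ^+ 2 / 2 * (e / t ^+ 2 + dl^-1 * max_weight p n x)))).
  apply: Ex_dist_le => //; first exact: bmeas_cst.
    by apply: bmeasZ; apply: bmeasD; [exact: bmeas_cst|exact: bmeasZ].
  move=> x; have /andP[m0 m1] := max_weight_itv n x p0.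
  have sq : \sum_(i < n) weight p n x i ^+ 2 <= e / t ^+ 2 + dl^-1 * max_weight p n x.
    apply: (@le_trans _ _ (max_weight p n x `^ (2 - p))).
      apply: (@le_trans _ _ (max_weight p n x `^ (2 - p) * \sum_(i < n) `|weight p n x i| `^ p)); last first.
        by rewrite weightp_sum ler_piMr ?powR_ge0// lern1 leq_b1.
      rewrite mulr_sumr; apply: ler_sum => i _.
      have -> : weight p n x i ^+ 2 = `|weight p n x i| `^ (2 - p) * `|weight p n x i| `^ p.
        rewrite -powRD; last by rewrite subrK pnatr_eq0.
        by rewrite subrK powR_mulrn// real_normK ?num_real.
      rewrite ler_wpM2r ?powR_ge0//; apply: ge0_ler_powR; rewrite ?nnegrE ?(ltW q0)//.
      exact: max_weight_ge.
    case: (leP (max_weight p n x) dl) => h.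
      rewrite -dq; apply: ler_wpDr; first by rewrite mulr_ge0// invr_ge0 ltW.
      by apply: ge0_ler_powR; rewrite ?nnegrE ?(ltW q0) ?(ltW d0).
    apply: ler_wpDl; first exact: ltW.
    apply: (@le_trans _ _ 1).
      have E1 : 1 `^ (2 - p) = 1 :> R by rewrite powR1.
      by rewrite -[leRHS]E1; apply: ge0_ler_powR; rewrite ?nnegrE ?(ltW q0) ?ler01.
    by rewrite mulrC ler_pdivlMr// mul1r ltW.
  have r1 : rad n 0 (fun u => 1 - cos (t * u)) (weight p n x) 0 <=
      rad n 0 (fun u => t ^+ 2 / 2 * u ^+ 2) (weight p n x) 0.
    by apply: rad_le => u; have := cosB1_le (t * u); rewrite exprMn mulrAC.
  have r2 : 0 <= rad n 0 (fun u => 1 - cos (t * u)) (weight p n x) 0.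
    rewrite -[leLHS](rad_cst n 0 0 (weight p n x) 0); apply: rad_le => u.
    by rewrite subr_ge0 cos_le1.
  have r3 : rad n 0 (fun u => 1 - cos (t * u)) (weight p n x) 0 =
      1 - rad n 0 (fun u => cos (t * u)) (weight p n x) 0.
    transitivity (rad n 0 (fun u => 1 + (-1) * cos (t * u)) (weight p n x) 0).
      by congr rad; apply/funext => u; rewrite mulN1r.
    by rewrite radD radZ rad_cst mulN1r.
  rewrite r3 in r1 r2; rewrite ger0_norm//; apply: le_trans r1 _.
  rewrite radZ rad_sqr expr0n/= add0r add0n big_mkord.
  by rewrite ler_wpM2l ?divr_ge0 ?sqr_ge0.
rewrite ExZ; last by apply: bmeasD; [exact: bmeas_cst|exact: bmeasZ].
rewrite ExD; [|exact: bmeas_cst|exact: bmeasZ].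
rewrite Ex_cst ExZ// -/(mean_max X p n).
apply: (@le_trans _ _ (t ^+ 2 / 2 * (e / t ^+ 2 + e / t ^+ 2))).
  rewrite ler_wpM2l ?divr_ge0 ?sqr_ge0// lerD2l mulrC ler_pdivrMr//.
by rewrite le_eqVlt; apply/orP; left; apply/eqP; field; rewrite gt_eqF.
Unshelve. all: by end_near. Qed.

(** By anticoncentration, a sum of squares tending to infinity would leave Gaussian mass at least
    1/6 beyond every [k]. *)
Lemma selfnorm_p_le2 : null_prob X p n @[n --> \oo] --> 0 -> ~ 2 < p.
Proof.
move=> v0 p2; have q0 : 0 < p - 2 by rewrite subr_gt0.
have mI : measurable_fun [set: measurableTypeR R] (fun x : R => x) by exact: measurable_id.
have H k : 1 / 6 <= Ex gauss (fun z => clamp01 (`|z| - k%:R)).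
  have cE := selfnorm_end_cvg (blip_clamp (k%:R : R)).
  (* Below this threshold of [max_weight] the squares sum to at least [4 * k.+1%:R ^+ 2], so
     [rad_anticoncentration] reaches [k.+1], where the clamp is 1; the other cases cost [null_prob]
     and [mean_max / dl]. *)
  pose dl := (1 / (4 * k.+1%:R ^+ 2)) `^ (p - 2)^-1 : R.
  have k1 : 0 < k.+1%:R :> R by rewrite ltr0n.
  have c0 : 0 < 1 / (4 * k.+1%:R ^+ 2) :> R by rewrite divr_gt0// mulr_gt0// exprn_gt0.
  have d0 : 0 < dl by rewrite powR_gt0.
  have dq : dl `^ (p - 2) = 1 / (4 * k.+1%:R ^+ 2).
    by rewrite /dl -powRrM mulVf ?gt_eqF// powRr1// ltW.
  have lim : 1 / 6 * (1 + - 1 * (null_prob X p n + dl^-1 * mean_max X p n)) @[n --> \oo] --> (1 / 6 : R).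
    rewrite [X in _ --> X](_ : _ = 1 / 6 * (1 + -1 * (0 + dl^-1 * 0)));
      last by rewrite mulr0 addr0 mulr0 addr0 mulr1.
    apply: cvgMr; apply: cvgD; first exact: cvg_cst.
    apply: cvgMr; apply: cvgD => //; apply: cvgMr; exact: selfnorm_mean_max_cvg0.
  apply: (ler_cvg_to lim cE); apply: nearW => n.
  have bc := bpsum n (blip_clamp (k%:R : R)).
  pose g (u : R) := clamp01 (`|u| - k%:R).
  have [br ->] := Ex_selfnorm_rad (g := g) bc.
  have bm := bmeas_max_weight n p0; have bv := bmeas_null_prob p n.
  have b1 := bmeasZ dl^-1 bm; have b2 := bmeasD bv b1; have b3 := bmeasZ (-1) b2.
  have b4 := bmeasD (bmeas_cst (seqR R) (1 : R)) b3.
  have -> : 1 / 6 * (1 + -1 * (null_prob X p n + dl^-1 * mean_max X p n)) =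
      E (fun x => 1 / 6 * (1 + -1 * ((Vnorm p n x == 0)%:R + dl^-1 * max_weight p n x))).
    rewrite (ExZ _ _ b4) (ExD _ (bmeas_cst (seqR R) (1 : R)) b3) Ex_cst (ExZ _ _ b2).
    by rewrite (ExD _ bv b1) (ExZ _ _ bm).
  apply: Ex_le => //; first exact: bmeasZ.
  move=> x; have g0 u : 0 <= g u by have /andP[] := clamp01_itv (`|u| - k%:R).
  have r0 : 0 <= rad n 0 g (weight p n x) 0.
    by rewrite -[leLHS](rad_cst n 0 0 (weight p n x) 0); apply: rad_le.
  have /andP[m0 m1] := max_weight_itv n x p0.
  have [V0|V0] := eqVneq (Vnorm p n x) 0; rewrite /=.
    have : 0 <= dl^-1 * max_weight p n x by rewrite mulr_ge0// invr_ge0 ltW.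
    by move: r0; move: (_ * max_weight _ _ _) (rad _ _ _ _ _) => A B; lra.
  case: (leP (max_weight p n x) dl) => md; last first.
    have : 1 <= dl^-1 * max_weight p n x by rewrite mulrC ler_pdivlMr// mul1r ltW.
    by move: r0; move: (_ * max_weight _ _ _) (rad _ _ _ _ _) => A B; lra.
  apply: (@le_trans _ _ (1 / 6)).
    have : 0 <= dl^-1 * max_weight p n x by rewrite mulr_ge0// invr_ge0 ltW.
    by move: (_ * max_weight _ _ _) => A; lra.
  pose s := \sum_(0 <= j < 0 + n) weight p n x j ^+ 2.
  have s4 : 4 * k.+1%:R ^+ 2 <= s.
    have sE : s = \sum_(i < n) weight p n x i ^+ 2 by rewrite /s add0n big_mkord.
    have s0 : 0 <= s by rewrite sE sumr_ge0// => i _; exact: sqr_ge0.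
    have : 1 <= max_weight p n x `^ (p - 2) * s.
      have S1 : \sum_(i < n) `|weight p n x i| `^ p = 1 by rewrite weightp_sum V0.
      rewrite -[leLHS]S1 sE mulr_sumr; apply: ler_sum => i _.
      have -> : `|weight p n x i| `^ p = `|weight p n x i| `^ (p - 2) * weight p n x i ^+ 2.
        rewrite -(real_normK (num_real (weight p n x i))) -powR_mulrn// -powRD ?subrK//.
        by rewrite gt_eqF.
      rewrite ler_wpM2r ?sqr_ge0//; apply: ge0_ler_powR; rewrite ?nnegrE ?(ltW q0)//.
      exact: max_weight_ge.
    have : max_weight p n x `^ (p - 2) * s <= dl `^ (p - 2) * s.
      by rewrite ler_wpM2r//; apply: ge0_ler_powR; rewrite ?nnegrE ?(ltW q0) ?(ltW d0).
    rewrite dq => h1 h2; have := le_trans h2 h1.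
    by rewrite mulrC mulrA mulr1 ler_pdivlMr ?mul1r// mulr_gt0// exprn_gt0.
  have s0 : 0 < s by apply: lt_le_trans s4; rewrite mulr_gt0// exprn_gt0.
  apply: le_trans (rad_anticoncentration s0) _; apply: rad_le => u.
  case: (leP (s / 4) (u ^+ 2)) => hu /=; last exact: g0.
  have : k.+1%:R <= `|u|.
    rewrite -(ler_pXn2r (ltn0Sn 1)) ?nnegrE ?(ltW k1)// real_normK ?num_real//.
    by move: s4 hu; move: (u ^+ 2) (k.+1%:R ^+ 2 : R) => A B; lra.
  rewrite -natr1 => uk; rewrite /g clamp01E; case: ifP => h1; first by lra.
  by rewrite ifT//; lra.
have [k _ /(_ k (leqnn k)) hk] : \forall k \near \oo,
    Ex gauss (fun z => clamp01 (`|z| - k%:R)) < 1 / 6.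
  have /cvgr0Pnorm_lt /(_ (1 / 6) ltac:(lra)) := clamp_cvg0 gauss mI.
  by apply: filterS => k; apply: le_lt_trans; exact: ler_norm.
by have := le_lt_trans (H k) hk; rewrite ltxx.
Qed.

End necessary_conditions.

(** * Comparison of the sums of [n] and of [2 * n] variables *)

Section doubling.
Context (R : realType) d (T : measurableType d) (P : probability T R).
Variable X : nat -> {RV P >-> R}.
Hypotheses (iidX : iid X) (symX : forall i, symmetric_RV (X i)).
Context d' (T' : measurableType d') (Q : probability T' R) (W : T' -> C01 R).
Hypothesis bmW : standard_BM Q W.
Local Notation E := (Ex (law X)).
Implicit Types (x : seqR R) (t : R).

Let half_sum n x : R := \sum_(i < n) weight 2 (n + n) x i ^+ 2.

(** A vanishing norm is no exception: all coordinates below [N] are then 0. *)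
Lemma weightK p N x i : (i < N)%N -> x i = Vnorm p N x * weight p N x i.
Proof.
move=> iN; have [V0|V0] := eqVneq (Vnorm p N x) 0; last by rewrite /weight mulrCA divff// mulr1.
rewrite V0 mul0r; apply/eqP/negPn/negP => xi.
by have := Vnorm_gt0 p iN xi; rewrite V0 ltxx.
Qed.

(** The common Gaussian target in [rad_doubling]: halving the variance compensates for the factor
    [Num.sqrt 2] in the frequency. *)
Lemma cos_gauss_half (w : R) : gavg (Num.sqrt (1 / 2)) (fun z => cos (Num.sqrt 2 * w * z)) 0 =
  gavg (Num.sqrt 1) (fun z => cos (w * z)) 0.
Proof.
have sq : Num.sqrt 2 * Num.sqrt (1 / 2) = 1 :> R.
  by rewrite -sqrtrM ?ler0n// (_ : 2 * (1 / 2) = 1) ?sqrtr1//; field.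
apply: eq_Ex => z; rewrite !add0r sqrtr1; congr cos.
by rewrite mulrACA sq !mul1r.
Qed.

(* Given the squared weights, both sides are Rademacher sums with variance close
   to [w ^+ 2], hence close to the same Gaussian average. *)
Lemma rad_doubling n x (w B hh dl : R) (c := weight 2 (n + n) x) : 0 <= w -> Num.sqrt 2 * w <= B ->
  0 < hh -> 0 < dl ->
  `|rad n 0 (fun u => cos (Num.sqrt 2 * w * u)) c 0 - rad (n + n) 0 (fun u => cos (w * u)) c 0| <=
  8 * B * hh + (1 + gauss_m4 R) * (16 * B / hh ^+ 2 * max_weight 2 (n + n) x +
    B * (2 * dl + (dl ^+ 3)^-1 * ((half_sum n x - 1 / 2) ^+ 2 + (Vnorm 2 (n + n) x == 0)%:R))).
Proof.
move=> w0 wB h0 d0.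
have s2 : 1 <= Num.sqrt 2 :> R by rewrite -[leLHS]sqrtr1 ler_sqrt; lra.
have w2 : w <= Num.sqrt 2 * w by rewrite ler_peMl.
have B0 : 0 <= B by apply: le_trans wB; rewrite mulr_ge0// (le_trans _ s2).
have lipB (v : R) : 0 <= v -> v <= B -> lip B (fun z => cos (v * z)).
  by move=> v0 vB y z; apply: le_trans (lip_cosM v0 _ _) _; rewrite ler_wpM2r.
have l1 := lipB _ (mulr_ge0 (le_trans ler01 s2) w0) wB.
have l2 := lipB _ w0 (le_trans w2 wB).
have half0 : 0 <= 1 / 2 :> R by lra.
have r1 := rad_clt bmW n 0 c 0 l1 (blip_cosM _) h0 half0.
have r2 := rad_clt bmW (n + n) 0 c 0 l2 (blip_cosM _) h0 ler01.
rewrite cos_gauss_half in r1.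
have g0 : 0 <= 1 + gauss_m4 R by rewrite addr_ge0// gauss_m4_ge0.
have d3 : 0 < dl ^+ 3 by exact: exprn_gt0.
have c0 : 0 <= 8 * B / hh ^+ 2 by rewrite divr_ge0 ?sqr_ge0// mulr_ge0.
have m1 : \sum_(0 <= i < 0 + n) `|c i| ^+ 3 <= max_weight 2 (n + n) x.
  by rewrite add0n weight3_sum_le// leq_addr.
have m2 : \sum_(0 <= i < 0 + (n + n)) `|c i| ^+ 3 <= max_weight 2 (n + n) x.
  by rewrite add0n weight3_sum_le.
have q1 : Num.sqrt `|\sum_(0 <= i < 0 + n) c i ^+ 2 - 1 / 2| <=
    dl + (dl ^+ 3)^-1 * (half_sum n x - 1 / 2) ^+ 2.
  rewrite add0n big_mkord -/(half_sum n x) -[(half_sum n x - 1 / 2) ^+ 2]real_normK ?num_real//.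
  by rewrite [(dl ^+ 3)^-1 * _]mulrC; apply: sqrt_le_sqr.
have q2 : Num.sqrt `|\sum_(0 <= i < 0 + (n + n)) c i ^+ 2 - 1| <=
    dl + (dl ^+ 3)^-1 * (Vnorm 2 (n + n) x == 0)%:R.
  rewrite add0n big_mkord weight2_sum.
  have -> : (Vnorm 2 (n + n) x == 0)%:R = `|(Vnorm 2 (n + n) x != 0)%:R - 1| ^+ 2 :> R.
    by case: (Vnorm _ _ _ == 0) => /=;
      rewrite ?sub0r ?normrN ?normr1 ?expr1n ?subrr ?normr0 ?expr0n.
  by rewrite [(dl ^+ 3)^-1 * _]mulrC; apply: sqrt_le_sqr.
have t1 : 4 * B * hh + (1 + gauss_m4 R) * (8 * B / hh ^+ 2 * \sum_(0 <= i < 0 + n) `|c i| ^+ 3 +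
    B * Num.sqrt `|\sum_(0 <= i < 0 + n) c i ^+ 2 - 1 / 2|) <=
    4 * B * hh + (1 + gauss_m4 R) * (8 * B / hh ^+ 2 * max_weight 2 (n + n) x +
    B * (dl + (dl ^+ 3)^-1 * (half_sum n x - 1 / 2) ^+ 2)).
  by rewrite lerD2l; apply: ler_wpM2l => //; apply: lerD; exact: ler_wpM2l.
have t2 : 4 * B * hh + (1 + gauss_m4 R) * (8 * B / hh ^+ 2 * 
    \sum_(0 <= i < 0 + (n + n)) `|c i| ^+ 3 +
    B * Num.sqrt `|\sum_(0 <= i < 0 + (n + n)) c i ^+ 2 - 1|) <=
    4 * B * hh + (1 + gauss_m4 R) * (8 * B / hh ^+ 2 * max_weight 2 (n + n) x +
    B * (dl + (dl ^+ 3)^-1 * (Vnorm 2 (n + n) x == 0)%:R)).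
  by rewrite lerD2l; apply: ler_wpM2l => //; apply: lerD; exact: ler_wpM2l.
have {}r1 := le_trans r1 t1; have {}r2 := le_trans r2 t2.
move: r1 r2; move: (rad _ _ _ _ _) (rad _ _ _ _ _) (gavg _ _ _) => A2 A1 A3 r1 r2.
rewrite (_ : A1 - A2 = (A1 - A3) - (A2 - A3)); last by ring.
apply: le_trans (ler_normB _ _) _; apply: le_trans (lerD r1 r2) _.
by rewrite le_eqVlt; apply/orP; left; apply/eqP; ring.
Qed.

Variables (a : nat -> R) (a0 : forall n, 0 < a n) (tS : tight_sums X a).
Hypotheses (mean_max0 : mean_max X 2 n @[n --> \oo] --> 0) (null_prob0 : null_prob X 2 n @[n --> \oo] --> 0).

Let bhalf n : bmeas (fun x => (half_sum n x - 1 / 2) ^+ 2).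
Proof.
apply: bmeasX; apply: bmeasB; last exact: bmeas_cst.
apply: bmeas_sum => i _; apply: bmeasX; apply: bmeas_weight => //.
exact: leq_trans (ltn_ord i) (leq_addr _ _).
Qed.

(** Both sums are written with the weights of the sample of size [n + n]; its norm turns into a
    random frequency [w], and [rad_doubling] applies wherever [w] is bounded. [B] uses
    [Num.sqrt 2 <= 2]. *)
Lemma charfun_doubling_bound n t (K hh dl : R) (B := 2 * (2 * K * t)) : (0 < n)%N -> 0 < t ->
  0 < K -> 0 < hh -> 0 < dl ->
  `|charfun X (Num.sqrt 2 * t / a n) ^+ n - (charfun X (t / a n) ^+ n) ^+ 2| <=
  2 * E (fun x => (K * a n < Vnorm 2 n x)%R%:R) +
  (8 * B * hh + (1 + gauss_m4 R) * (16 * B / hh ^+ 2 * mean_max X 2 (n + n) +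
    B * (2 * dl + (dl ^+ 3)^-1 * (mean_max X 2 (n + n) + 3 * null_prob X 2 (n + n)))) +
   32 * (mean_max X 2 (n + n) + 2 * null_prob X 2 (n + n))).
Proof.
move=> n0 t0 K0 h0 d0; have an := a0 n; pose N := (n + n)%N.
have N0 : (0 < N)%N by rewrite addn_gt0 n0.
have nN : (n <= N)%N by exact: leq_addr.
have B0 : 0 <= B by rewrite !mulr_ge0// ltW.
have g0 : 0 <= 1 + gauss_m4 R by rewrite addr_ge0// gauss_m4_ge0.
have d3 : 0 < dl ^+ 3 by exact: exprn_gt0.
have bcs s k : bmeas (fun x : seqR R => cos (s * psum k x)).
  by apply: bmeas_cos; apply: measurable_funM => //; exact: measurable_psum.
rewrite -exprM muln2 -addnn -/N -!Ex_cos_psum//.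
have [b1 ->] := Ex_psum_rad iidX symX (f := fun u => cos (Num.sqrt 2 * t / a n * u)) (bcs _ n).
have [b2 ->] := Ex_psum_rad iidX symX (f := fun u => cos (t / a n * u)) (bcs _ N).
have bV : bmeas (fun x : seqR R => (K * a n < Vnorm 2 n x)%R%:R : R).
  by apply: bmeas_lt => //; exact: measurable_V.
have bm := bmeas_max_weight N (ltac:(lra) : 0 < 2 :> R).
have bv := bmeas_null_prob (2 : R) N; have bh := bhalf n.
pose F x := 8 * B * hh + ((1 + gauss_m4 R) * (16 * B / hh ^+ 2 * max_weight 2 N x +
    B * (2 * dl + (dl ^+ 3)^-1 * ((half_sum n x - 1 / 2) ^+ 2 + (Vnorm 2 N x == 0)%:R))) +
    32 * (half_sum n x - 1 / 2) ^+ 2).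
have bF1 := bmeasD bh bv.
have bF2 := bmeasD (bmeas_cst (seqR R) (2 * dl)) (bmeasZ (dl ^+ 3)^-1 bF1).
have bF3 := bmeasD (bmeasZ (16 * B / hh ^+ 2) bm) (bmeasZ B bF2).
have bF4 := bmeasD (bmeasZ (1 + gauss_m4 R) bF3) (bmeasZ 32 bh).
have bF : bmeas F by exact: (bmeasD (bmeas_cst (seqR R) (8 * B * hh)) bF4).
have EF : E F <= 8 * B * hh + (1 + gauss_m4 R) * (16 * B / hh ^+ 2 * mean_max X 2 N +
    B * (2 * dl + (dl ^+ 3)^-1 * (mean_max X 2 N + 3 * null_prob X 2 N))) +
   32 * (mean_max X 2 N + 2 * null_prob X 2 N).
  rewrite /F (ExD _ (bmeas_cst (seqR R) (8 * B * hh)) bF4) Ex_cst.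
  rewrite (ExD _ (bmeasZ (1 + gauss_m4 R) bF3) (bmeasZ 32 bh)) (ExZ _ _ bF3) (ExZ _ _ bh).
  rewrite (ExD _ (bmeasZ (16 * B / hh ^+ 2) bm) (bmeasZ B bF2)) (ExZ _ _ bm) (ExZ _ _ bF2).
  rewrite (ExD _ (bmeas_cst (seqR R) (2 * dl)) (bmeasZ (dl ^+ 3)^-1 bF1)) Ex_cst (ExZ _ _ bF1).
  rewrite (ExD _ bh bv) -/(mean_max X 2 N) -/(null_prob X 2 N).
  have pv : E (fun x => (half_sum n x - 1 / 2) ^+ 2) <= mean_max X 2 N + 2 * null_prob X 2 N.
    have := partial_weight_variance iidX N0 nN.
    have -> // : n%:R / N%:R = 1 / 2 :> R.
    by rewrite /N addnn -muln2 natrM; field; rewrite pnatr_eq0 -lt0n.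
  rewrite -addrA lerD2l; apply: lerD; last by rewrite ler_wpM2l.
  rewrite ler_wpM2l// lerD2l ler_wpM2l// lerD2l ler_wpM2l ?invr_ge0 ?(ltW d3)//.
  by move: pv; move: (Ex _ _) (mean_max _ _ _) (null_prob _ _ _) => A C D; lra.
apply: (@le_trans _ _ (E (fun x => 2 * (K * a n < Vnorm 2 n x)%R%:R + F x))); last first.
  by rewrite ExD//; [rewrite ExZ// lerD2l|exact: bmeasZ].
apply: Ex_dist_le => //; first by apply: bmeasD => //; exact: bmeasZ.
move=> x; set V := Vnorm 2 N x.
pose w := t / a n * V.
have w0 : 0 <= w by rewrite mulr_ge0 ?Vnorm_ge0// divr_ge0// ltW.
have m0 : 0 <= max_weight 2 N x by have /andP[] := @max_weight_itv R 2 N x ltac:(lra).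
have F0 : 0 <= F x - 32 * (half_sum n x - 1 / 2) ^+ 2.
  rewrite /F addrA addrK addr_ge0//; first by rewrite mulr_ge0 ?(ltW h0)// mulr_ge0.
  rewrite mulr_ge0// addr_ge0//.
    by rewrite mulr_ge0// divr_ge0 ?sqr_ge0// mulr_ge0.
  rewrite mulr_ge0// addr_ge0//; first by rewrite mulr_ge0// ltW.
  by rewrite mulr_ge0 ?invr_ge0 ?(ltW d3)// addr_ge0 ?sqr_ge0.
have E1 : rad n 0 (fun u => cos (Num.sqrt 2 * t / a n * u)) x 0 =
    rad n 0 (fun u => cos (Num.sqrt 2 * w * u)) (weight 2 N x) 0.
  rewrite !rad_cos !mulr0; congr (_ * _); rewrite !big_nat; apply: eq_bigr => i /andP[_ iN].
  by rewrite [x i](@weightK 2 N x i) ?(leq_trans iN)// /w -/V; congr cos; ring.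
have E2 : rad N 0 (fun u => cos (t / a n * u)) x 0 = rad N 0 (fun u => cos (w * u)) (weight 2 N x) 0.
  rewrite !rad_cos !mulr0; congr (_ * _); rewrite !big_nat; apply: eq_bigr => i /andP[_ iN].
  by rewrite [x i](@weightK 2 N x i)// /w -/V; congr cos; ring.
rewrite E1 E2.
have s2 : Num.sqrt 2 <= 2 :> R.
  rewrite -[leRHS](ger0_norm (ler0n _ 2)) -sqrtr_sqr ler_sqrt ?sqr_ge0//; lra.
(* The norm of the first [n] terms is controlled by [K * a n], not [V] itself. If [V > 2 * K * a n],
   either that control fails, or the first half carries at most 1/4 of the squares and
   [32 * (half_sum n x - 1 / 2) ^+ 2 >= 2] pays for the trivial bound 2. *)
case: (leP V (2 * K * a n)) => VK.
  have wB : Num.sqrt 2 * w <= B.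
    apply: ler_pM => //.
    rewrite /w; apply: (@le_trans _ _ (t / a n * (2 * K * a n))).
      by rewrite ler_wpM2l// divr_ge0// ltW.
    by rewrite le_eqVlt; apply/orP; left; apply/eqP; field; rewrite gt_eqF.
  apply: le_trans (rad_doubling n x w0 wB h0 d0) _.
  apply: ler_wpDl; first by rewrite mulr_ge0.
  by rewrite /F -/N [leRHS]addrA lerDl mulr_ge0// sqr_ge0.
have r2 : `|rad n 0 (fun u => cos (Num.sqrt 2 * w * u)) (weight 2 N x) 0 -
    rad N 0 (fun u => cos (w * u)) (weight 2 N x) 0| <= 2.
  rewrite !rad_cos !mulr0 !cos0 !mul1r.
  have p1 k v : `|\prod_(0 <= j < k) cos (v * weight 2 N x j)| <= 1.
    by rewrite normr_prod; apply: prodr_ile1 => i _; rewrite normr_ge0/=; exact: cos_max.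
  apply: le_trans (ler_normB _ _) _; have := lerD (p1 (0 + n)%N (Num.sqrt 2 * w)) (p1 (0 + N)%N w).
  by move=> /le_trans; apply; lra.
apply: le_trans r2 _.
case: (ltP (K * a n) (Vnorm 2 n x)) => Vn /=; first by rewrite mulr1 lerDl; move: F0;
  have := sqr_ge0 (half_sum n x - 1 / 2); move: (_ ^+ 2) (F x) => A C; lra.
have Va : 0 < 2 * K * a n by rewrite !mulr_gt0.
have Vp : 0 < V by apply: lt_trans VK.
have hs : half_sum n x <= 1 / 4.
  have hE : half_sum n x = Vnorm 2 n x ^+ 2 / V ^+ 2.
    rewrite Vnorm2E sqr_sqrtr; last by rewrite sumr_ge0// => i _; exact: sqr_ge0.
    by rewrite mulr_suml; apply: eq_bigr => i _; rewrite /weight exprMn exprVn.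
  rewrite hE ler_pdivrMr ?exprn_gt0//.
  have v1 : Vnorm 2 n x ^+ 2 <= (K * a n) ^+ 2.
    by rewrite lerXn2r ?nnegrE ?Vnorm_ge0// mulr_ge0// ltW.
  have v2 : (2 * K * a n) ^+ 2 <= V ^+ 2.
    by rewrite lerXn2r ?nnegrE ?(ltW Va) ?(ltW Vp)// ltW.
  move: v1 v2; rewrite -[2 * K * a n]mulrA exprMn.
  by move: (Vnorm 2 n x ^+ 2) (V ^+ 2) ((K * a n) ^+ 2) => A C D; lra.
rewrite mulr0 add0r.
have : 1 / 16 <= (half_sum n x - 1 / 2) ^+ 2.
  have : (1 / 4) ^+ 2 <= (1 / 2 - half_sum n x) ^+ 2 :> R.
    by rewrite lerXn2r ?nnegrE//; move: (half_sum n x) hs => y; lra.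
  by rewrite -[(1 / 2 - _) ^+ 2]sqrrN opprB; move: (_ ^+ 2 : R) => A; lra.
by move: F0; move: ((half_sum n x - 1 / 2) ^+ 2) (F x) => A C; lra.
Qed.

Lemma charfun_doubling t : 0 < t ->
  charfun X (Num.sqrt 2 * t / a n) ^+ n - (charfun X (t / a n) ^+ n) ^+ 2 @[n --> \oo] --> 0.
Proof.
move=> t0; apply/cvgr0Pnorm_le => e e0.
have [K K0 hK] := tight_sums_Vnorm iidX symX a0 tS (ltac:(lra) : 0 < e / 8).
pose B := 2 * (2 * K * t); pose g := 1 + gauss_m4 R.
have B0 : 0 < B by rewrite !mulr_gt0.
have g0 : 0 < g by rewrite ltr_pwDl// gauss_m4_ge0.
pose hh := e / (32 * B); pose dl := e / (8 * g * B).
have h0 : 0 < hh by rewrite divr_gt0// mulr_gt0.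
have d0 : 0 < dl by rewrite divr_gt0// !mulr_gt0.
have e1 : 8 * B * hh = e / 4 by rewrite /hh; field; rewrite gt_eqF.
have e2 : g * (B * (2 * dl)) = e / 4 by rewrite /dl; field; rewrite !gt_eqF.
pose C1 := g * (16 * B / hh ^+ 2) + g * (B * (dl ^+ 3)^-1) + 32.
pose C2 := g * (B * (dl ^+ 3)^-1) * 3 + 64.
have double (u : nat -> R) : u n @[n --> \oo] --> 0 -> u (n + n)%N @[n --> \oo] --> 0.
  move=> u0; apply: (@cvg_comp _ _ _ (fun n => (n + n)%N) u \oo \oo) => //.
  move=> A [M _ MA]; exists M => // n /= Mn; apply: MA; exact: leq_trans Mn (leq_addr _ _).
have rest : C1 * mean_max X 2 (n + n) + C2 * null_prob X 2 (n + n) @[n --> \oo] --> 0.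
  rewrite (_ : 0 = C1 * 0 + C2 * 0); last by rewrite !mulr0 addr0.
  by apply: cvgD; apply: cvgMr; exact: double.
have /cvgr0Pnorm_le /(_ (e / 4) ltac:(lra)) rest' := rest.
near=> n.
have n0 : (0 < n)%N by near: n; exact: nbhs_infty_gt.
apply: le_trans (charfun_doubling_bound n0 t0 K0 h0 d0) _; rewrite -/B -/g.
have R1 : C1 * mean_max X 2 (n + n) + C2 * null_prob X 2 (n + n) <= e / 4.
  by rewrite (le_trans (ler_norm _))//; near: n.
have R2 : E (fun x => (K * a n < Vnorm 2 n x)%R%:R) <= e / 8 by near: n.
rewrite (_ : 8 * B * hh + g * (16 * B / hh ^+ 2 * mean_max X 2 (n + n) +
    B * (2 * dl + (dl ^+ 3)^-1 * (mean_max X 2 (n + n) + 3 * null_prob X 2 (n + n)))) +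
   32 * (mean_max X 2 (n + n) + 2 * null_prob X 2 (n + n)) =
   8 * B * hh + g * (B * (2 * dl)) + (C1 * mean_max X 2 (n + n) + C2 * null_prob X 2 (n + n))).
  rewrite e1 e2; move: R1 R2; move: (Ex _ _) (_ + C2 * _) => A C; lra.
rewrite /C1 /C2; move: (mean_max _ _ _) (null_prob _ _ _) ((dl ^+ 3)^-1) (hh ^+ 2)^-1 => A C D F; ring.
Unshelve. all: by end_near. Qed.

Lemma doubling_limit (h : R -> R) t : 0 < t ->
  (forall t, (charfun X (t / a n) ^+ n) ^+ 2 @[n --> \oo] --> h t) ->
  h (Num.sqrt 2 * t) = h t ^+ 2.
Proof.
move=> t0 gh; have c1 := gh (Num.sqrt 2 * t); have c2 := gh t; have c3 := charfun_doubling t0.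
(* The convergence [gh] concerns squares only, so limits are compared through [u ^+ 2 = v ^+ 4 + (u
   - v ^+ 2) ^+ 2 + 2 * v ^+ 2 * (u - v ^+ 2)]. *)
pose u n := charfun X (Num.sqrt 2 * t / a n) ^+ n; pose v n := charfun X (t / a n) ^+ n.
have c4 : v n ^+ 2 * v n ^+ 2 @[n --> \oo] --> h t ^+ 2 by rewrite expr2; exact: cvgM.
have c5 : (u n - v n ^+ 2) * (u n - v n ^+ 2) + 2 * (v n ^+ 2 * (u n - v n ^+ 2))
    @[n --> \oo] --> (0 * 0 + 2 * (h t * 0) : R).
  by apply: cvgD; [exact: cvgM|apply: cvgMr; exact: cvgM].
have c6 : v n ^+ 2 * v n ^+ 2 + ((u n - v n ^+ 2) * (u n - v n ^+ 2) +
  2 * (v n ^+ 2 * (u n - v n ^+ 2)))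
    @[n --> \oo] --> (h t ^+ 2 + (0 * 0 + 2 * (h t * 0)) : R) by exact: cvgD.
apply: (@cvg_unique _ (@Rhausdorff R) _ _ _ _ c1).
rewrite (_ : h t ^+ 2 = h t ^+ 2 + (0 * 0 + 2 * (h t * 0))); last by ring.
rewrite /=; apply: cvg_trans c6; apply: near_eq_cvg; apply: nearW => n /=.
by rewrite /u /v; ring.
Qed.

End doubling.

Theorem theorem2 (R : realType)
  (d : measure_display) (T : measurableType d) (P : probability T R)
  (X : nat -> {RV P >-> R}) (alpha p : R)
  (d' : measure_display) (T' : measurableType d') (Q : probability T' R)
  (W : T' -> C01 R) :
  0 < alpha -> alpha <= 2 -> 0 < p ->
  iid X -> (forall i, symmetric_RV (X i)) -> in_DA alpha X ->
  standard_BM Q W ->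
  (cvg_in_law P (selfnorm_process p X) Q W <-> p = 2 /\ alpha = 2).
Proof.
move=> al0 al2 p0 iidX symX da bmW.
have [a [h [a0 gh [hs hlt1] [h1 h01] tS]]] := in_DA_charfun iidX symX bmW da.
have v0 q : 0 < q -> null_prob X q n @[n --> \oo] --> 0.
  by move=> q0; have [t _ ht] := hlt1; exact: (null_prob_cvg0 iidX q0 (gh t) ht).
split=> [cY|[-> al]]; last first.
  rewrite al powR12_sqrt// in hs.
  apply: selfnorm_donsker => //; last by apply: v0; lra.
  exact: (mean_max_cvg0 (h := h) iidX symX a0 gh hs hlt1 h1 h01 tS).
have p2 : p = 2.
  apply/eqP; rewrite eq_le; apply/andP; split; rewrite leNgt; apply/negP.
    by have := selfnorm_p_le2 iidX symX bmW p0 cY (v0 p p0).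
  by have := selfnorm_p_ge2 iidX symX bmW p0 cY.
split => //; apply/eqP; rewrite eq_le al2 leNgt; apply/negP => al_lt2.
have kap := selfnorm_mean_max_cvg0 bmW p0 cY; rewrite p2 in kap.
have h2 t : 0 < t -> h (Num.sqrt 2 * t) = h t ^+ 2.
  move=> t0; apply: (doubling_limit (h := h) iidX symX bmW a0 tS kap _ t0 gh).
  by apply: v0; lra.
have sq0 : 0 < Num.sqrt 2 :> R by rewrite sqrtr_gt0.
(* For [alpha < 2] the two equations give [h (r * t) = h t] with [r < 1]; iterating towards 0, where
   [h] tends to 1, contradicts [h t < 1]. *)
pose c : R := 2 `^ alpha^-1; pose r := Num.sqrt 2 / c.
have c0 : 0 < c by rewrite powR_gt0.
have r0 : 0 < r by rewrite divr_gt0.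
have r1 : r < 1.
  rewrite ltr_pdivrMr// mul1r -powR12_sqrt// /c /powR gt_eqF// ltr_expR.
  by rewrite ltr_pM2r ?ltf_pV2 ?posrE// ln_gt0//; lra.
have hr t : 0 < t -> h (r * t) = h t.
  move=> t0; have tc : 0 < t / c by rewrite divr_gt0.
  rewrite (_ : r * t = Num.sqrt 2 * (t / c)); last by rewrite /r; ring.
  by rewrite (h2 _ tc) -hs ?(ltW tc)// -/c mulrCA divff ?mulr1// gt_eqF.
have [t t0] := hlt1.
have hrk k : h (r ^+ k * t) = h t.
  elim: k => [|k IH]; first by rewrite expr0 mul1r.
  by rewrite exprS -mulrA hr// mulr_gt0// exprn_gt0.
have u0 : r ^+ k * t @[k --> \oo] --> 0.
  by rewrite -(mul0r t); apply: cvgMl; apply: cvg_expr; rewrite gtr0_norm.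
have := h1 _ u0; under eq_fun do rewrite hrk; move=> ch.
have -> : h t = 1 by apply: (@cvg_unique _ (@Rhausdorff R) _ _ _ _ _ ch); exact: cvg_cst.
by rewrite ltxx.
Qed.
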